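(* Assume the following. (i) There are constants $\tau_1,\tau_2$ with $0<\tau_1<\lambda_{\min}(\boldsymbol\Sigma_0)\le\lambda_{\max}(\boldsymbol\Sigma_0)<\tau_2<\infty$ for all $n$. (ii) $a_{n1}=O\big(\{(1+p_n/(s_{n1}+1))\log p_n/n\}^{1/2}\big)$, $b_{n1}=o(1)$, and $\min_{(i,j)\in S_1}|\omega^0_{ij}|/\lambda_{n1}\to\infty$ as $n\to\infty$. (iii) The penalty $p_\lambda(\cdot)$ is singular at the origin, with $\lim_{t\downarrow0}p_\lambda(t)/(\lambda t)=k_0>0$. (iv) There are constants $C$ and $D$ such that, whenever $\theta_1,\theta_2>C\lambda_{n1}$, $|p''_{\lambda_{n1}}(\theta_1)-p''_{\lambda_{n1}}(\theta_2)|\le D|\theta_1-\theta_2|$. If $(p_n+s_{n1})\log p_n/n=O(\lambda_{n1}^2)$ and $(p_n+s_{n1})(\log p_n)^k/n=O(1)$ for some $k>1$, then there exists a local minimizer $\hat{\boldsymbol\Omega}$ of $$q_1(\boldsymbol\Omega)=\operatorname{tr}(\mathbf S\boldsymbol\Omega)-\log|\boldsymbol\Omega|+\sum_{i\ne j}p_{\lambda_{n1}}(|\omega_{ij}|)$$ such that $\|\hat{\boldsymbol\Omega}-\boldsymbol\Omega_0\|_F^2=O_P\{(p_n+s_{n1})\log p_n/n\}$. For the $L_1$-penalty $p_\lambda(\theta)=\lambda|\theta|$, the condition $(p_n+s_{n1})\log p_n/n=O(\lambda_{n1}^2)$ may be replaced by $\log p_n/n=O(\lambda_{n1}^2)$.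
   Context: For each sample size $n$, $\mathbf y_1,\dots,\mathbf y_n$ is a random (i.i.d.) sample in $\mathbb R^{p_n}$ with mean zero and covariance matrix $\boldsymbol\Sigma_0$ (depending on $n$); asymptotics are as $n\to\infty$. Sub-Gaussian tail condition: with $\mathbf y_i=(y_{i1},\dots,y_{ip_n})$ and $G_j$ the c.d.f. of $y_{ij}^2$, there is $\lambda_0>0$ such that for $0<|\lambda|<\lambda_0$, $\max_{1\le j\le p_n}\int_0^\infty\exp(\lambda t)\,dG_j(t)<\infty$ (bounded uniformly in $n$). $\mathbf S=n^{-1}\sum_{i=1}^n\mathbf y_i\mathbf y_i^T$ is the sample covariance matrix. $\boldsymbol\Omega_0=\boldsymbol\Sigma_0^{-1}=(\omega^0_{ij})$ is the true precision matrix. $q_1$ is a function of symmetric positive definite matrices $\boldsymbol\Omega=(\omega_{ij})$, and $|\boldsymbol\Omega|$ is the determinant. $p_\lambda(\cdot)$ is a penalty function on $[0,\infty)$, possibly nonconvex, depending on a regularization parameter $\lambda>0$ (here $\lambda=\lambda_{n1}$); derivatives $p'_\lambda,p''_\lambda$ are with respect to the argument. $S_1=\{(i,j):\omega^0_{ij}\ne0\}$, $s_{n1}=|S_1|-p_n$ (the number of nonzero off-diagonal entries of $\boldsymbol\Omega_0$), $a_{n1}=\max_{(i,j)\in S_1}p'_{\lambda_{n1}}(|\omega^0_{ij}|)$, $b_{n1}=\max_{(i,j)\in S_1}p''_{\lambda_{n1}}(|\omega^0_{ij}|)$. A local minimizer means an interior point of a given closed set which minimizes the target function over that set. $\|\cdot\|_F$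 is the Frobenius norm; $\lambda_{\min},\lambda_{\max}$ are the extreme eigenvalues.
   Formalization: Penalty taken continuous and nondecreasing on [0,∞); p_n ≥ 2 for all n; in the L1 clause, log p_n/n = O(λ²) is read as log p_n/n ≤ c0 λ² eventually for some c0 > 0 chosen before λ, since the claim fails for an arbitrary implied constant. *)

(* Defs.v *)
From HB Require Import structures.
From mathcomp Require Import all_boot all_order all_algebra.
From mathcomp Require Import all_classical all_reals all_analysis.
From mathcomp Require Import measurable_realfun.

Set Implicit Arguments.
Unset Strict Implicit.
Unset Printing Implicit Defensive.

Import Order.TTheory GRing.Theory Num.Theory.
Import numFieldNormedType.Exports.

Local Open Scope classical_set_scope.
Local Open Scope ring_scope.

Section matrices.
Context {R : realType} {p : nat}.
Implicit Types A Om : 'M[R]_p.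

Definition frobenius A : R := Num.sqrt (\sum_i \sum_j A i j ^+ 2).

(* For a symmetric matrix the set of real eigenvalues is finite, and nonempty
   when p > 0, so that inf and sup are a minimum and a maximum. *)
Definition lambda_min A : R := inf [set a | eigenvalue A a].
Definition lambda_max A : R := sup [set a | eigenvalue A a].

Definition spd A : Prop :=
  A^T = A /\ forall v : 'rV[R]_p, v != 0 -> 0 < (v *m A *m v^T) 0 0.

(* Om is an interior point of a closed set C which minimizes f over C.  The
   function f lives on the symmetric positive definite matrices, an open subset
   of the space of symmetric matrices; closedness in 'M_p and in that space
   agree, but "interior" has to be relative to it, since symmetric matrices
   have empty interior in 'M_p. *)
Definition local_minimizer (f : 'M[R]_p -> R) Om : Prop :=
  exists C : set 'M[R]_p,
    [/\ closed C, C `<=` spd,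
        C Om /\ (\forall X \near Om, spd X -> C X)
      & forall X, C X -> f Om <= f X].

(* Index pairs of the nonzero entries; the diagonal is included. *)
Definition S1 Om : {set 'I_p * 'I_p} :=
  [set ij : 'I_p * 'I_p | Om ij.1 ij.2 != 0]%SET.

(* The diagonal of a positive definite matrix lies in S1, so this subtraction
   does not truncate. *)
Definition s1 Om : nat := (#|S1 Om| - p)%N.

(* sup and inf below range over finite sets, nonempty when Om is nonzero. *)
Definition max_pen' (f : R -> R) Om : R :=
  sup [set derive1 f `|Om ij.1 ij.2| | ij in [set` S1 Om]].
Definition max_pen'' (f : R -> R) Om : R :=
  sup [set derive1 (derive1 f) `|Om ij.1 ij.2| | ij in [set` S1 Om]].
Definition min_signal Om : R :=
  inf [set `|Om ij.1 ij.2| | ij in [set` S1 Om]].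

Definition q1 (f : R -> R) (S Om : 'M[R]_p) : R :=
  \tr (S *m Om) - ln (\det Om) + \sum_i \sum_(j | i != j) f `|Om i j|.

End matrices.

Section sample.
Context {R : realType} {d : measure_display} {T : measurableType d}.
Context {P : probability T R} {p : nat}.

Definition entry (y : {RV P >-> p.-tuple R}) (j : 'I_p) (w : T) : R :=
  tnth (y w) j.

Definition entry_sq (y : {RV P >-> p.-tuple R}) (j : 'I_p) (w : T) : R :=
  entry y j w ^+ 2.

Lemma measurable_entry y j : measurable_fun setT (entry y j).
Proof.
exact: (measurableT_comp (@measurable_tnth _ (measurableTypeR R) p j)
  (measurable_funPT y)).
Qed.

Lemma measurable_entry_sq y j : measurable_fun setT (entry_sq y j).
Proof. exact: measurable_funX 2 (measurable_entry y j). Qed.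

HB.instance Definition _ y j :=
  isMeasurableFun.Build _ _ _ _ (entry_sq y j) (measurable_entry_sq y j).

Context {n : nat}.
Implicit Type y : 'I_n -> {RV P >-> p.-tuple R}.

(* Independence of the random vectors y_i: taking B i = setT gives the product
   rule for every subfamily. *)
Definition iid y : Prop :=
  (forall B : 'I_n -> set (p.-tuple R), (forall i, measurable (B i)) ->
     P (\bigcap_(i in [set: 'I_n]) (y i @^-1` B i)) =
     (\prod_(i < n) P (y i @^-1` B i))%E) /\
  (forall (i i' : 'I_n) (B : set (p.-tuple R)), measurable B ->
     distribution P (y i) B = distribution P (y i') B).

Definition mean_zero y : Prop :=
  forall i j, ('E_P[entry (y i) j] = 0)%E.

Definition has_covariance y (Sigma : 'M[R]_p) : Prop :=
  forall i j k, covariance P (entry (y i) j) (entry (y i) k) = (Sigma j k)%:E.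

Definition sample_cov y (w : T) : 'M[R]_p :=
  \matrix_(j, k) (n%:R^-1 * \sum_(i < n) entry (y i) j w * entry (y i) k w).

End sample.

Section asymptotics.
Context {R : realType} {d : nat -> measure_display}.
Context {T : forall n, measurableType (d n)}.
Variable P : forall n, probability (T n) R.

(* Local minimizers need not depend measurably on the sample, so events are
   understood up to inner approximation by measurable ones; for measurable Q
   and X the two notions below are the usual ones. *)
Definition with_prob_tending_to_1 (Q : forall n, T n -> Prop) : Prop :=
  forall e : R, 0 < e -> \forall n \near \oo,
    exists E : set (T n),
      [/\ measurable E, ((1 - e)%:E <= P n E)%E & forall w, E w -> Q n w].

Definition OP (X : forall n, T n -> R) (r : nat -> R) : Prop :=
  forall e : R, 0 < e -> exists2 M : R, 0 < M & \forall n \near \oo,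
    exists E : set (T n),
      [/\ measurable E, ((1 - e)%:E <= P n E)%E
        & forall w, E w -> `|X n w| <= M * r n].

Variable p : nat -> nat.

(* dG_j is the law of the square of the j-th coordinate; it does not depend on
   the index i of the observation. *)
Definition sub_gaussian
    (y : forall n, 'I_n -> {RV (P n) >-> (p n).-tuple R}) : Prop :=
  exists2 lambda0 : R, 0 < lambda0 &
    forall l : R, 0 < `|l| < lambda0 ->
      exists B : R, forall n (i : 'I_n) (j : 'I_(p n)),
        (\int[distribution (P n) (entry_sq (y n i) j)]_(t in `[0%R, +oo[)
           (expR (l * t))%:E <= B%:E)%E.

End asymptotics.

Section conditions.
Context {R : realType} {p : nat -> nat}.
Variable Om0 : forall n, 'M[R]_(p n).
Variables (pen : R -> R -> R) (lam : nat -> R).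

Local Notation s n := (s1 (Om0 n)).
Local Notation logp n := (ln ((p n)%:R : R)).

Definition rate (n : nat) : R := (p n + s n)%:R * logp n / n%:R.

(* A penalty is continuous and nondecreasing on [0, +oo), not necessarily
   convex.  In particular the derivatives in max_pen' are nonnegative, so that
   this maximum does bound their absolute values. *)
Definition penalty : Prop := forall n,
  {within `[0, +oo[, continuous (pen (lam n))} /\
  {in `[0, +oo[ &, {homo pen (lam n) : t u / t <= u}}.

Definition penalty_rates : Prop :=
  [/\ (fun n => max_pen' (pen (lam n)) (Om0 n)) =O_\oo
        (fun n => Num.sqrt
           ((1 + (p n)%:R / (s n).+1%:R) * logp n / n%:R)),
      (fun n => max_pen'' (pen (lam n)) (Om0 n)) =o_\oo (fun=> (1 : R))
    & min_signal (Om0 n) / lam n @[n --> \oo] --> +oo].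

Definition penalty_singular : Prop :=
  exists2 k0 : R, 0 < k0 &
    forall n, pen (lam n) t / (lam n * t) @[t --> 0^'+] --> k0.

(* Derivatives are total functions here, hence the explicit differentiability
   clauses; they are only asked beyond C * lam n, which allows for penalties
   whose second derivative has jumps near the origin. *)
Definition penalty_smooth : Prop :=
  exists C : R, exists2 D : R, 0 < C & forall n,
    (forall t, C * lam n < t ->
       derivable (pen (lam n)) t 1 /\ derivable (derive1 (pen (lam n))) t 1) /\
    (forall t u, C * lam n < t -> C * lam n < u ->
       `|derive1 (derive1 (pen (lam n))) t - derive1 (derive1 (pen (lam n))) u|
         <= D * `|t - u|).

Definition dimension_growth : Prop :=
  exists2 k : R, 1 < k &
    (fun n => (p n + s n)%:R * (logp n `^ k) / n%:R) =O_\oo (fun=> (1 : R)).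

End conditions.

Definition L1_penalty {R : realType} (l t : R) : R := l * `|t|.

(* Main.v *)
(* Up to sign, the log-determinant is strongly convex near Om0, and by a Chernoff
   bound the entries of the sample covariance deviate from those of Sigma0 by at
   most kap, a multiple of sqrt (log p / n).  Hence, on the sphere around Om0 whose
   radius r is a large multiple of the square root of the rate, the quadratic term
   exceeds the noise and the penalty on the support of Om0, and the objective has
   a minimizer inside the sphere provided that the noise off the support is under
   control too.  If p is bounded, it is by Cauchy-Schwarz.  If p is large, kap is
   negligible against lam and the penalty has to dominate kap t.  The singularity
   at 0 gives this only on an interval which may shrink with n arbitrarily fast,
   so a ramp, constant beyond a small multiple of its starting point, is added to
   the penalty.  No entry of a minimizer of the perturbed objective lies on the
   ramp, where it would pay to move on to a larger value; the ramp is therefore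
   locally constant at these entries, and the minimizer is a local minimizer of
   the original objective.  Entries larger than a multiple tstar of r need no
   penalty: there |t| <= t^2 / tstar. *)

Require Import Defs.
From mathcomp Require Import all_boot all_order all_algebra.
From mathcomp Require Import all_classical all_reals all_analysis.
From mathcomp Require Import measurable_realfun.
From mathcomp Require Import ring lra.
From mathcomp Require complex.
Import Order.TTheory GRing.Theory Num.Theory.
Import numFieldNormedType.Exports.

Set Implicit Arguments.
Unset Strict Implicit.
Unset Printing Implicit Defensive.

Local Open Scope classical_set_scope.
Local Open Scope ring_scope.

(** * Symmetric matrices *)

(** Large [p] makes the noise negligible because [p log p / n] is at most the rate, which is
    [O(lam^2)]: with [eps = sqrt (log p / n)] this gives [eps / lam = O(1 / sqrt p)]. The size of
    [p] also decides the deviation constant. A union bound over the [p^2] entries leaves a failure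
    probability [2 / p^q]; for large [p] the fixed choice [q = 1] serves a given level, whereas for
    bounded [p] the constant has to grow as the level shrinks. That growth is harmless in the
    Cauchy-Schwarz argument but would spoil a comparison of the noise with [lam]. The obstacle for
    the penalty is the range between the origin and [C lam]: there it is only known to be continuous
    and nondecreasing, so it may be almost flat and pay for no noise. The L1-penalty has slope [lam]
    throughout, so it needs no ramp, and [c0] only has to put [lam] above the noise at [q = 1]. *)

Lemma mxtrace_conj2 (F : comNzRingType) n (U D W E : 'M[F]_n) :
  \tr (U *m D *m W *m E *m (U *m D *m W *m E)) =
  \tr (D *m (W *m E *m U) *m (D *m (W *m E *m U))).
Proof. by rewrite -!mulmxA [LHS]mxtrace_mulC -!mulmxA. Qed.

Lemma conj_sqr (F : comUnitRingType) n (V D : 'M[F]_n) : V \in unitmx ->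
  invmx V *m D *m V *m (invmx V *m D *m V) = invmx V *m (D *m D) *m V.
Proof. by move=> uV; rewrite !mulmxA mulmxK. Qed.

Section spectral.
Local Open Scope sesquilinear_scope.
Import complex.
Context {R : rcfType} {p : nat}.
Local Notation C := (complex R).
Local Notation toC := (real_complex R).
Implicit Types A D Sg : 'M[R]_p.

Lemma conjC_real (x : R) : (toC x)^* = toC x.
Proof. by apply/CrealP/complex_realP; exists x. Qed.

(** Over [complex R] a real symmetric matrix is Hermitian, hence unitarily diagonalizable with real
    eigenvalues; taking real parts of the diagonal loses nothing. The matrix [U] itself stays
    complex. *)
Lemma symmetric_spectral A : A^T = A ->
  exists U : 'M[C]_p, exists2 d : 'rV[R]_p, U \is unitarymx &
    map_mx toC A = U ^t* *m diag_mx (map_mx toC d) *m U.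
Proof.
move=> symA; set B := map_mx toC A.
have hB : B \is hermsymmx.
  apply: realsym_hermsym.
    by apply/is_hermitianmxP; rewrite expr0 scale1r map_mx_id // map_trmx symA.
  by apply/mxOverP => i j; rewrite mxE; apply/complex_realP; exists (A i j).
exists (spectralmx B); exists (map_mx (@complex.Re R) (spectral_diag B)).
  exact: spectral_unitarymx.
have /mxOverP dr := hermitian_spectral_diag_real hB.
have -> : map_mx toC (map_mx (@complex.Re R) (spectral_diag B)) = spectral_diag B.
  by apply/rowP => i; rewrite !mxE; have /complex_realP[x ->] := dr 0 i.
rewrite -invmx_unitary ?spectral_unitarymx //.
exact/orthomx_spectralP/hermitian_normalmx.
Qed.

Lemma spectral_eigenvalue A (U : 'M[C]_p) (d : 'rV[R]_p) i :
  U \is unitarymx -> map_mx toC A = U ^t* *m diag_mx (map_mx toC d) *m U ->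
  eigenvalue A (d 0 i).
Proof.
move=> uU eqA; rewrite -(eigenvalue_map (real_complex R)); apply/eigenvalueP.
exists (row i U).
  rewrite eqA !mulmxA -[row i U *m _]row_mul (unitarymxP uU).
  rewrite row1 -rowE row_diag_mx -scalemxAl -rowE mxE.
  by [].
apply/eqP => rU0; have := congr1 (row i) (unitarymxP uU).
rewrite row_mul rU0 mul0mx row1 => /rowP/(_ i); rewrite !mxE eqxx /=.
by move=> /eqP; rewrite !eqxx eq_sym oner_eq0.
Qed.

(** The rectangular shape lets one notion serve as the squared Frobenius norm of matrices and as the
    squared Euclidean norm of row vectors. *)
Definition fro2 {m n} (A : 'M[R]_(m, n)) : R := \sum_i \sum_j A i j ^+ 2.

Lemma fro2_tr m n (A : 'M[R]_(m, n)) : fro2 A = \tr (A *m A^T).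
Proof.
by apply: eq_bigr => i _; rewrite mxE; apply: eq_bigr => j _; rewrite mxE -expr2.
Qed.

Definition qform (A : 'M[R]_p) (v : 'rV[R]_p) : R := (v *m A *m v^T) 0 0.

(** The Loewner order [a I <= A <= b I]. Unlike bounds on [lambda_min] and [lambda_max], it passes
    to sums and inverses by evaluating quadratic forms. *)
Definition qbounded (a b : R) A : Prop :=
  A^T = A /\ forall v, a * fro2 v <= qform A v <= b * fro2 v.

Lemma fro2_rv (v : 'rV[R]_p) : fro2 v = (v *m v^T) 0 0.
Proof. by rewrite fro2_tr /mxtrace big_ord1. Qed.

Lemma fro2_ge0 m n (A : 'M[R]_(m, n)) : 0 <= fro2 A.
Proof. by do 2! apply: sumr_ge0 => ? _; apply: sqr_ge0. Qed.

Lemma fro2_eq0 m n (A : 'M[R]_(m, n)) : (fro2 A == 0) = (A == 0).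
Proof.
apply/idP/eqP => [|->].
  rewrite psumr_eq0 => [/allP/= A0|i _]; last by apply: sumr_ge0 => *; apply: sqr_ge0.
  apply/matrixP => i j; rewrite mxE; have := A0 i (mem_index_enum _).
  rewrite psumr_eq0 => [/allP/(_ j (mem_index_enum _))|*]; last exact: sqr_ge0.
  by rewrite sqrf_eq0 => /eqP.
by rewrite /fro2 big1 // => i _; rewrite big1 // => j _; rewrite mxE expr0n.
Qed.

Lemma qbounded_eigenvalue a b A x : qbounded a b A -> eigenvalue A x -> a <= x <= b.
Proof.
move=> [_ qA] /eigenvalueP[v vA v0]; have := qA v.
have v_gt0 : 0 < fro2 v by rewrite lt_neqAle eq_sym fro2_eq0 v0 fro2_ge0.
by rewrite /qform vA -scalemxAl mxE -fro2_rv !ler_pM2r.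
Qed.

Lemma qbounded_spectral a b A : qbounded a b A ->
  exists U : 'M[C]_p, exists d : 'rV[R]_p, [/\ U \is unitarymx,
    map_mx toC A = U ^t* *m diag_mx (map_mx toC d) *m U &
    forall i, a <= d 0 i <= b].
Proof.
move=> qA; have [U [d uU eqA]] := symmetric_spectral qA.1.
exists U, d; split => // i; apply: qbounded_eigenvalue qA _.
exact: spectral_eigenvalue eqA.
Qed.

Lemma spectral_det A (U : 'M[C]_p) (d : 'rV[R]_p) :
  U \is unitarymx -> map_mx toC A = U ^t* *m diag_mx (map_mx toC d) *m U ->
  \det A = \prod_i d 0 i.
Proof.
move=> uU eqA; apply: (@complexI R); rewrite -det_map_mx eqA.
rewrite -invmx_unitary // -mulmxA det_mulmx mulrC -det_mulmx mulmxK ?unitarymx_unit //.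
by rewrite det_diag rmorph_prod; apply: eq_bigr => i _; rewrite mxE.
Qed.

(** The middle trace is the sum of [d_i d_j |H_ij|^2], and every weight [d_i d_j] lies between [a^2]
    and [b^2]. *)
Lemma trace_square_spectral (a b : R) (d : 'rV[R]_p) (H : 'M[C]_p) :
  0 <= a -> (forall i, a <= d 0 i <= b) -> H ^t* = H ->
  toC (a ^+ 2) * \tr (H *m H)
    <= \tr (H *m diag_mx (map_mx toC d) *m (H *m diag_mx (map_mx toC d)))
    <= toC (b ^+ 2) * \tr (H *m H).
Proof.
move=> a0 dab hH.
have trE : \tr (H *m H) = \sum_i \sum_j `|H i j| ^+ 2.
  rewrite /mxtrace; apply: eq_bigr => i _; rewrite mxE; apply: eq_bigr => j _.
  by rewrite -[in H j i]hH !mxE normCK.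
have trDE : \tr (H *m diag_mx (map_mx toC d) *m (H *m diag_mx (map_mx toC d))) =
    \sum_i \sum_j toC (d 0 i * d 0 j) * `|H i j| ^+ 2.
  rewrite /mxtrace; apply: eq_bigr => i _; rewrite mxE; apply: eq_bigr => j _.
  rewrite !mul_mx_diag !mxE normCK rmorphM /=.
  by rewrite -[in H j i]hH !mxE; ring.
rewrite trE trDE !mulr_sumr; apply/andP; split; apply: ler_sum => i _;
  rewrite mulr_sumr; apply: ler_sum => j _; apply: ler_wpM2r;
  rewrite ?exprn_ge0 // lecR expr2.
- by apply: ler_pM => //; [case/andP: (dab i)|case/andP: (dab j)].
- have [/andP[ai ib] /andP[aj jb]] := (dab i, dab j).
  by apply: ler_pM => //; exact: le_trans a0 _.
Qed.

(* With M^* M = Sg, the product D Sg is similar to the Hermitian matrix M D M^*. *)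
Lemma relative_spectrum (a b : R) Sg D : 0 < a -> qbounded a b Sg -> D^T = D ->
  exists e : 'rV[R]_p,
    [/\ \det (1%:M + D *m Sg) = \prod_i (1 + e 0 i),
        \tr (D *m Sg) = \sum_i e 0 i &
        a ^+ 2 * fro2 D <= \sum_i e 0 i ^+ 2 <= b ^+ 2 * fro2 D].
Proof.
move=> a0 qSg symD; have [U [d [uU eqSg dab]]] := qbounded_spectral qSg.
have d_gt0 i : 0 < d 0 i by case/andP: (dab i) => ? _; exact: lt_le_trans a0 _.
pose h := map_mx toC (map_mx Num.sqrt d).
pose M := diag_mx h *m U.
have hC : map_mx Num.conj h = h by apply/rowP => i; rewrite !mxE conjC_real.
have MtM : M ^t* *m M = map_mx toC Sg.
  rewrite /M trmx_mul map_mxM tr_diag_mx map_diag_mx hC eqSg !mulmxA.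
  congr (_ *m _); rewrite -!mulmxA; congr (_ *m _).
  rewrite mul_diag_mx; apply/matrixP => i j; rewrite !mxE.
  case: eqP => [->|]; last by rewrite !mulr0n mulr0.
  by rewrite !mulr1n -rmorphM /= -expr2 sqr_sqrtr // ltW.
have uM : M \in unitmx.
  rewrite unitmx_mul (unitarymx_unit uU) andbT unitmxE det_diag unitfE.
  apply/prodf_neq0 => i _; rewrite !mxE -(rmorph0 toC) (inj_eq (@complexI R)).
  by rewrite gt_eqF // sqrtr_gt0.
clearbody M.
pose Dc := map_mx toC D.
have hDc : Dc ^t* = Dc.
  by apply/matrixP => i j; rewrite !mxE conjC_real -{1}symD mxE.
pose H := M *m Dc *m M ^t*.
have hH : H ^t* = H.
  by rewrite /H !trmx_mul !map_mxM hDc trmxCK mulmxA.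
have hermH : H \is hermsymmx.
  by apply/is_hermitianmxP; rewrite expr0 scale1r hH.
have /orthomx_spectralP eqH := hermitian_normalmx hermH.
have /mxOverP er := hermitian_spectral_diag_real hermH.
have uV := spectral_unit H.
pose e := map_mx (@complex.Re R) (spectral_diag H).
have eE : spectral_diag H = map_mx toC e.
  by apply/rowP => i; rewrite !mxE; have /complex_realP[x ->] := er 0 i.
have DSgE : map_mx toC (D *m Sg) = invmx M *m H *m M.
  by rewrite map_mxM -/Dc -MtM /H !mulmxA (mulVmx uM) mul1mx.
clearbody H.
have detE : \det (1%:M + D *m Sg) = \prod_i (1 + e 0 i).
  apply: (@complexI R); rewrite -det_map_mx map_mxD map_mx1 DSgE.
  have -> : 1%:M + invmx M *m H *m M = invmx M *m (1%:M + H) *m M.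
    by rewrite mulmxDr mulmxDl mulmx1 mulVmx.
  rewrite -mulmxA det_mulmx mulrC -det_mulmx mulmxK //.
  rewrite eqH; set V := spectralmx H.
  have -> : 1%:M + invmx V *m diag_mx (spectral_diag H) *m V =
      invmx V *m (1%:M + diag_mx (spectral_diag H)) *m V.
    by rewrite mulmxDr mulmxDl mulmx1 mulVmx.
  rewrite -mulmxA det_mulmx mulrC -det_mulmx mulmxK //.
  have -> : 1%:M + diag_mx (spectral_diag H) = diag_mx (const_mx 1 + map_mx toC e).
    by rewrite linearD /= diag_const_mx eE.
  by rewrite det_diag rmorph_prod; apply: eq_bigr => i _; rewrite !mxE rmorphD rmorph1.
move: (spectralmx H) eqH uV => V eqH uV.
have [tr2 tr1] : \tr (H *m H) = toC (\sum_i e 0 i ^+ 2) /\ \tr H = toC (\sum_i e 0 i).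
  have -> : H *m H = invmx (V) *m (diag_mx (map_mx toC e) *m diag_mx (map_mx toC e)) *m V.
    by rewrite -conj_sqr // -eE -eqH.
  split.
    rewrite -mulmxA mxtrace_mulC mulmxK // mul_diag_mx rmorph_sum.
    by apply: eq_bigr => i _; rewrite !mxE eqxx mulr1n -expr2 rmorphXn.
  rewrite {1}eqH -mulmxA mxtrace_mulC mulmxK // eE mxtrace_diag rmorph_sum.
  by apply: eq_bigr => i _; rewrite !mxE.
exists e; split => //.
  apply: (@complexI R); rewrite -tr1 -trace_map_mx DSgE -mulmxA mxtrace_mulC mulmxK //.
have trH2 : \tr (H *m H) = toC (\tr (D *m Sg *m (D *m Sg))).
  rewrite -trace_map_mx map_mxM DSgE.
  have -> : invmx M *m H *m M *m (invmx M *m H *m M) = invmx M *m (H *m H *m M).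
    by rewrite conj_sqr ?mulmxA.
  by rewrite [RHS]mxtrace_mulC (mulmxK uM).
(* [H'] is [D] in the eigenbasis of [Sg]: conjugation by [U] keeps the Frobenius norm and turns
   [tr (D Sg D Sg)] into the trace that [trace_square_spectral] bounds. *)
pose H' := U *m Dc *m U ^t*.
have hH' : H' ^t* = H' by rewrite /H' !trmx_mul !map_mxM hDc trmxCK mulmxA.
have UU : U ^t* *m U = 1%:M by rewrite -invmx_unitary // mulVmx ?unitarymx_unit.
have trH' : \tr (H' *m H') = toC (fro2 D).
  rewrite /H' !mulmxA -[_ *m U^t* *m U]mulmxA UU mulmx1 -!mulmxA mxtrace_mulC.
  by rewrite -!mulmxA UU mulmx1 -map_mxM trace_map_mx fro2_tr symD.
have trHD : \tr (H' *m diag_mx (map_mx toC d) *m (H' *m diag_mx (map_mx toC d))) =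
    toC (\tr (D *m Sg *m (D *m Sg))).
  by rewrite mxtrace_conj2 -eqSg /Dc -!map_mxM trace_map_mx.
have := trace_square_spectral (ltW a0) dab hH'.
by rewrite trH' trHD -trH2 tr2 -!rmorphM /= !lecR.
Qed.

Lemma spectral_qbounded (a b : R) A (U : 'M[C]_p) (d : 'rV[R]_p) :
  A^T = A -> U \is unitarymx ->
  map_mx toC A = U ^t* *m diag_mx (map_mx toC d) *m U ->
  (forall i, a <= d 0 i <= b) -> qbounded a b A.
Proof.
move=> symA uU eqA dab; split => // v.
pose w := map_mx toC v *m U ^t*.
have wE : w ^t* = U *m map_mx toC v^T.
  rewrite /w !trmx_mul !map_mxM trmxCK; congr (_ *m _).
  by apply/matrixP => i j; rewrite !mxE; exact: conjC_real.
have UU : U ^t* *m U = 1%:M by rewrite -invmx_unitary // mulVmx ?unitarymx_unit.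
have toE (B : 'M[R]_1) : toC (B 0 0) = (map_mx toC B) 0 0 by rewrite mxE.
have fE : toC (fro2 v) = \sum_i `|w 0 i| ^+ 2.
  rewrite fro2_rv toE.
  have -> : map_mx toC (v *m v^T) = w *m w ^t*.
    by rewrite wE /w mulmxA -[_ *m U^t* *m U]mulmxA UU mulmx1 -map_mxM.
  by rewrite mxE; apply: eq_bigr => i _; rewrite !mxE normCK.
have qE : toC (qform A v) = \sum_i toC (d 0 i) * `|w 0 i| ^+ 2.
  rewrite /qform toE.
  have -> : map_mx toC (v *m A *m v^T) = w *m diag_mx (map_mx toC d) *m w ^t*.
    by rewrite !map_mxM eqA wE /w !mulmxA.
  rewrite mul_mx_diag mxE; apply: eq_bigr => i _.
  rewrite [(map_mx _ w^T) _ _]mxE [w^T _ _]mxE normCK.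
  by rewrite mxE [(map_mx _ d) _ _]mxE -mulrA [RHS]mulrCA.
rewrite -!lecR !rmorphM /= fE qE !mulr_sumr; apply/andP; split; apply: ler_sum => i _;
  by apply: ler_wpM2r; rewrite ?exprn_ge0 // lecR; case/andP: (dab i).
Qed.

(** [inf] and [sup] of a set of reals are informative only when the set is bounded; this is what
    ties [lambda_min] and [lambda_max] to the individual eigenvalues. *)
Lemma eigenvalues_bounded A : A^T = A ->
  exists K, forall x, eigenvalue A x -> - K <= x <= K.
Proof.
move=> symA; have [U [d uU eqA]] := symmetric_spectral symA.
exists (\sum_i `|d 0 i|) => x; apply: qbounded_eigenvalue.
apply: spectral_qbounded uU eqA _ => // i; rewrite -ler_norml.
by rewrite (bigD1 i) //= lerDl sumr_ge0.
Qed.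

Lemma eigenvalues_qbounded (a b : R) A : A^T = A ->
  (forall x, eigenvalue A x -> a <= x <= b) -> qbounded a b A.
Proof.
move=> symA eab; have [U [d uU eqA]] := symmetric_spectral symA.
by apply: (spectral_qbounded symA uU eqA) => i; apply/eab/(spectral_eigenvalue i uU eqA).
Qed.

Lemma qbounded_det_gt0 (a b : R) A : 0 < a -> qbounded a b A -> 0 < \det A.
Proof.
move=> a0 qA; have [U [d [uU eqA dab]]] := qbounded_spectral qA.
rewrite (spectral_det uU eqA) prodr_gt0 // => i _.
by case/andP: (dab i) => + _; apply: lt_le_trans.
Qed.
End spectral.

Section CauchySchwarz.
Context {R : rcfType}.

(** Lagrange's identity: twice the defect of the squared inequality is the sum of
    [(a_i b_j - a_j b_i)^2]. *)
Lemma CauchySchwarz_sum (I : finType) (P : pred I) (a b : I -> R) :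
  \sum_(i | P i) a i * b i <=
  Num.sqrt (\sum_(i | P i) a i ^+ 2) * Num.sqrt (\sum_(i | P i) b i ^+ 2).
Proof.
rewrite -sqrtrM ?sumr_ge0 // => [|i _]; last exact: sqr_ge0.
apply: (le_trans (ler_norm _)); rewrite -sqrtr_sqr ler_wsqrtr //.
rewrite -subr_ge0 -(pmulr_rge0 _ (ltr0Sn R 1)).
have -> : 2 * ((\sum_(i | P i) a i ^+ 2) * (\sum_(i | P i) b i ^+ 2) -
    (\sum_(i | P i) a i * b i) ^+ 2) =
    \sum_(i | P i) \sum_(j | P j) (a i * b j - a j * b i) ^+ 2.
  have E : \sum_(i | P i) \sum_(j | P j) (a i * b j - a j * b i) ^+ 2 =
     \sum_(i | P i) \sum_(j | P j) (a i ^+ 2 * b j ^+ 2) +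
     \sum_(i | P i) \sum_(j | P j) (b i ^+ 2 * a j ^+ 2) -
     2 * \sum_(i | P i) \sum_(j | P j) (a i * b i * (a j * b j)).
    rewrite mulr_sumr -big_split -sumrB; apply: eq_bigr => i _ /=.
    rewrite mulr_sumr -big_split -sumrB; apply: eq_bigr => j _ /=; ring.
  rewrite E -!big_distrlr /= [X in _ = _ + X - _]mulrC expr2; ring.
by apply: sumr_ge0 => i _; apply: sumr_ge0 => j _; apply: sqr_ge0.
Qed.

Lemma sum_norm_le_sqrt_card (I : finType) (P : pred I) (a : I -> R) :
  \sum_(i | P i) `|a i| <= Num.sqrt #|P|%:R * Num.sqrt (\sum_(i | P i) a i ^+ 2).
Proof.
have := CauchySchwarz_sum P (fun=> 1) (fun i => `|a i|).
rewrite (eq_bigr (fun i => `|a i|)) => [|i _]; last by rewrite mul1r.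
rewrite [X in Num.sqrt X * _](eq_bigr (fun=> 1)) => [|i _]; last by rewrite expr1n.
rewrite [X in _ * Num.sqrt X](eq_bigr (fun i => a i ^+ 2)) => [|i _]; last first.
  exact: real_normK (num_real _).
by rewrite sumr_const.
Qed.
End CauchySchwarz.

Section qbounded_theory.
Context {R : rcfType} {p : nat}.
Implicit Types (A D Om : 'M[R]_p) (a b : R).

Lemma qform_sum A v : qform A v = \sum_i \sum_j A i j * (v 0 i * v 0 j).
Proof.
rewrite /qform mxE exchange_big; apply: eq_bigr => j _ /=; rewrite !mxE mulr_suml.
by apply: eq_bigr => i _; rewrite mulrAC mulrC.
Qed.

Lemma qform_line A (u w : 'rV[R]_p) t : qform A (u + t *: w) =
  qform A u + t * ((u *m A *m w^T) 0 0 + (w *m A *m u^T) 0 0) + t ^+ 2 * qform A w.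
Proof.
rewrite /qform; have -> : (u + t *: w)^T = u^T + t *: w^T.
  by apply/matrixP => i j; rewrite !mxE.
rewrite !mulmxDl !mulmxDr -!scalemxAl -!scalemxAr.
have E (X Y Z W : 'M[R]_1) : (X + t *: Y + (t *: Z + t *: (t *: W))) 0 0 =
    X 0 0 + t * (Y 0 0 + Z 0 0) + t ^+ 2 * W 0 0.
  by rewrite !mxE; ring.
by rewrite E.
Qed.

Lemma fro2_line (u w : 'rV[R]_p) t :
  fro2 (u + t *: w) = fro2 u + t * ((u *m w^T) 0 0 + (w *m u^T) 0 0) + t ^+ 2 * fro2 w.
Proof.
have E v : fro2 v = qform 1%:M v by rewrite fro2_rv /qform mulmx1.
by rewrite !E qform_line !mulmx1.
Qed.

Lemma qformD A D v : qform (A + D) v = qform A v + qform D v.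
Proof. by rewrite /qform mulmxDr mulmxDl mxE. Qed.

(** Cauchy-Schwarz over index pairs; the rank-one matrix [v_i v_j] has Frobenius norm [fro2 v]. *)
Lemma qform_le_fro D v : `|qform D v| <= Num.sqrt (fro2 D) * fro2 v.
Proof.
rewrite qform_sum.
have E (f : 'I_p -> 'I_p -> R) : \sum_i \sum_j f i j = \sum_(ij : 'I_p * 'I_p) f ij.1 ij.2.
  by rewrite pair_bigA.
have vE : fro2 v = Num.sqrt (\sum_i \sum_j (v 0 i * v 0 j) ^+ 2).
  have -> : \sum_i \sum_j (v 0 i * v 0 j) ^+ 2 = fro2 v ^+ 2.
    rewrite /fro2 big_ord1 expr2 big_distrlr /=.
    by apply: eq_bigr => i _; apply: eq_bigr => j _; rewrite exprMn.
  by rewrite sqrtr_sqr ger0_norm ?fro2_ge0.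
rewrite vE /fro2 !E ler_norml lerNl -sumrN; apply/andP; split; last exact: CauchySchwarz_sum.
under eq_bigr do rewrite -mulrN.
apply: le_trans (CauchySchwarz_sum _ _ _) _ => /=.
by under [X in _ * Num.sqrt X <= _]eq_bigr do rewrite sqrrN.
Qed.

Lemma qboundedD a b Om D : qbounded a b Om -> D^T = D ->
  qbounded (a - Num.sqrt (fro2 D)) (b + Num.sqrt (fro2 D)) (Om + D).
Proof.
move=> [symO qO] symD; split; first by rewrite linearD /= symO symD.
move=> v; rewrite qformD mulrBl mulrDl; have /andP[q1 q2] := qO v.
have := qform_le_fro D v; rewrite ler_norml => /andP[q3 q4].
by apply/andP; split; [apply: lerD | apply: lerD].
Qed.

Lemma qbounded_unit a b A : 0 < a -> qbounded a b A -> A \in unitmx.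
Proof. by move=> a0 qA; rewrite unitmxE unitfE gt_eqF // (qbounded_det_gt0 a0 qA). Qed.

(** With [w = u A^-1] both forms equal [qform A w]. The lower bound expands
    [qform A (u - b w) >= 0], the upper one [fro2 (u - a w) >= 0]; the factors [b] and [a] are those
    that make the remaining terms cancel. *)
Lemma qbounded_inv a b A : (0 < p)%N -> 0 < a -> qbounded a b A ->
  qbounded b^-1 a^-1 (invmx A).
Proof.
move=> p0 a0 qA; have uA := qbounded_unit a0 qA; have [symA qA'] := qA.
have symV : (invmx A)^T = invmx A by rewrite trmx_inv symA.
have b0 : 0 < b.
  have /andP[h1 h2] := qA' (const_mx 1).
  have c0 : 0 < fro2 (const_mx 1 : 'rV[R]_p).
    rewrite lt_neqAle fro2_ge0 eq_sym fro2_eq0 andbT; apply/eqP => /rowP/(_ (Ordinal p0)).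
    by move/eqP; rewrite !mxE oner_eq0.
  by rewrite -(pmulr_lgt0 _ c0); apply: lt_le_trans h2; apply: lt_le_trans h1; rewrite mulr_gt0.
split => // u.
set w := u *m invmx A.
have uE : u = w *m A by rewrite /w mulmxKV.
have fu0 : 0 <= fro2 u by exact: fro2_ge0.
have qE : qform (invmx A) u = qform A w.
  by rewrite /qform -/w [in LHS]uE trmx_mul symA mulmxA.
clearbody w.
have H t : qform A (u - t *: w) = qform A u - 2 * t * fro2 u + t ^+ 2 * qform A w.
  have e1 : (u *m A *m w^T) 0 0 = fro2 u.
    by rewrite fro2_rv {3}uE trmx_mul symA mulmxA.
  have e2 : (w *m A *m u^T) 0 0 = fro2 u by rewrite -uE fro2_rv.
  by rewrite -scaleNr qform_line e1 e2; ring.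
rewrite qE; apply/andP; split.
  have := qA' (u - b *: w); rewrite H => /andP[h _].
  have /andP[_ h2] := qA' u.
  rewrite -(ler_pM2l (exprn_gt0 2 b0)) mulrA expr2 mulfK ?gt_eqF //.
  have h0 : 0 <= a * fro2 (u - b *: w) by rewrite mulr_ge0 ?fro2_ge0 ?ltW.
  nra.
have /andP[h _] := qA' w.
have H2 : 0 <= fro2 (u - a *: w) by exact: fro2_ge0.
have uw : (u *m w^T) 0 0 = qform A w by rewrite {1}uE /qform.
have wu : (w *m u^T) 0 0 = qform A w.
  by rewrite /qform {1}uE trmx_mul symA mulmxA.
have F : fro2 (u - a *: w) = fro2 u - 2 * a * qform A w + a ^+ 2 * fro2 w.
  by rewrite -scaleNr fro2_line uw wu; ring.
rewrite -(ler_pM2l a0) mulVKf ?gt_eqF //.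
rewrite F in H2; nra.
Qed.

(** Evaluating the form at [e_i + e_j] and [e_i - e_j] bounds [A_ii + A_jj] plus or minus [2 A_ij]
    by [2 b], and the diagonal entries are nonnegative. *)
Lemma qbounded_entry a b A i j : 0 <= a -> qbounded a b A -> `|A i j| <= b.
Proof.
move=> a0 [symA qA].
have qd (k l : 'I_p) :
    ((delta_mx 0 k : 'rV[R]_p) *m A *m (delta_mx 0 l : 'rV[R]_p)^T) 0 0 = A k l.
  by rewrite -rowE trmx_delta -colE !mxE.
have fd k l :
    ((delta_mx 0 k : 'rV[R]_p) *m (delta_mx 0 l : 'rV[R]_p)^T) 0 0 = (k == l)%:R :> R.
  by rewrite trmx_delta mul_delta_mx_cond; case: (k == l); rewrite ?mulr1n ?mulr0n mxE ?eqxx.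
have dg k : 0 <= A k k <= b.
  have := qA (delta_mx 0 k); rewrite /qform qd fro2_rv fd eqxx !mulr1 => /andP[h1 ->].
  by rewrite (le_trans a0 h1).
have [<-|nij] := eqVneq i j; first by have /andP[h1 h2] := dg i; rewrite ger0_norm.
have Aji : A j i = A i j by rewrite -{1}symA mxE.
have H (s : R) : qform A (delta_mx 0 i + s *: delta_mx 0 j) =
    A i i + 2 * s * A i j + s ^+ 2 * A j j.
  by rewrite qform_line /qform !qd Aji; ring.
have F (s : R) : fro2 (delta_mx 0 i + s *: delta_mx 0 j : 'rV[R]_p) = 1 + s ^+ 2.
  by rewrite fro2_line !fro2_rv !fd !eqxx (eq_sym j) (negbTE nij) /=; ring.
have /andP[_] := qA (delta_mx 0 i + 1 *: delta_mx 0 j).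
have /andP[_] := qA (delta_mx 0 i + (-1) *: delta_mx 0 j).
rewrite !H !F; have /andP[? ?] := dg i; have /andP[? ?] := dg j => h1 h2.
rewrite ler_norml; apply/andP; split; nra.
Qed.

End qbounded_theory.

(** * The log-determinant and the topology of matrices *)

Section logdet.
Context {R : realType}.

(* ln (1 + d) = 2 ln (sqrt (1 + d)) <= 2 (sqrt (1 + d) - 1) *)
Lemma ln1D_le_sqr (d : R) : -1 < d -> d <= 1 -> ln (1 + d) <= d - d ^+ 2 / 8.
Proof.
move=> d1 d2; have d0 : 0 < 1 + d by lra.
set s := Num.sqrt (1 + d); have s0 : 0 < s by rewrite sqrtr_gt0.
have sE : s ^+ 2 = 1 + d by rewrite sqr_sqrtr // ltW.
have l1 : ln s <= s - 1.
  by have := @le_ln1Dx R (s - 1); rewrite [1 + _]addrC subrK; apply; lra.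
rewrite -sE lnXn // mulr2n.
have s2 : s <= 1 + d / 2 - d ^+ 2 / 16.
  have h0 : 0 <= 1 + d / 2 - d ^+ 2 / 16 by nra.
  rewrite -(ler_pXn2r (ltn0Sn 1)) ?nnegrE ?(ltW s0) // sE.
  have d22 : 0 <= d ^+ 2 by exact: sqr_ge0.
  have d3 : d ^+ 3 <= d ^+ 2 by rewrite exprS ler_piMl.
  have d4 : 0 <= d ^+ 4 by rewrite -[4%N]/(2 * 2)%N exprM sqr_ge0.
  have -> : (1 + d / 2 - d ^+ 2 / 16) ^+ 2 =
    1 + d + d ^+ 2 / 8 - d ^+ 3 / 16 + d ^+ 4 / 256 by field.
  lra.
lra.
Qed.

Lemma ln_prod (I : finType) (f : I -> R) : (forall i, 0 < f i) ->
  ln (\prod_i f i) = \sum_i ln (f i).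
Proof.
move=> f0; suff [] : 0 < \prod_i f i /\ ln (\prod_i f i) = \sum_i ln (f i) by [].
elim/big_ind2 : _ => [|x1 x2 y1 y2 [? <-] [? <-]|i _]; rewrite ?ln1 //.
by rewrite lnM // mulr_gt0.
Qed.

(** [Om + D = (1 + D Sg) Om], so the change of the log-determinant is the sum of [ln (1 + e_i)] over
    the relative eigenvalues. The smallness of [D] forces [|e_i| <= 1/2], within the range of
    [ln1D_le_sqr]; the sum of the [e_i] is the linear term, and the sum of their squares is at least
    [a^2 fro2 D]. *)
Lemma logdet_upper p (a b : R) (Sg Om D : 'M[R]_p) : 0 < a -> qbounded a b Sg ->
  Sg *m Om = 1%:M -> 0 < \det Om -> D^T = D -> b ^+ 2 * fro2 D <= 4^-1 ->
  ln (\det (Om + D)) <= ln (\det Om) + \tr (D *m Sg) - a ^+ 2 / 8 * fro2 D.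
Proof.
move=> a0 qSg SgOm dO symD bD.
have [e [detE trE /andP[e1 e2]]] := relative_spectrum a0 qSg symD.
have e_le i : e 0 i ^+ 2 <= 4^-1.
  apply: le_trans bD; apply: le_trans e2.
  by rewrite (bigD1 i) //= lerDl sumr_ge0 // => j _; exact: sqr_ge0.
have e_bd i : -1 < e 0 i /\ e 0 i <= 1 by have := e_le i; split; nra.
have e_gt0 i : 0 < 1 + e 0 i by have [] := e_bd i; lra.
have -> : Om + D = (1%:M + D *m Sg) *m Om.
  by rewrite mulmxDl mul1mx -mulmxA SgOm mulmx1.
rewrite det_mulmx detE lnM ?posrE ?prodr_gt0 // addrC ln_prod // -addrA lerD2l.
apply: (@le_trans _ _ (\sum_i (e 0 i - e 0 i ^+ 2 / 8))).
  by apply: ler_sum => i _; have [? ?] := e_bd i; apply: ln1D_le_sqr.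
by rewrite sumrB trE lerD2l lerN2 -mulr_suml mulrAC ler_wpM2r // invr_ge0.
Qed.

End logdet.

Section lambda.
Context {R : realType} {p : nat}.

Lemma lambda_qbounded (a b : R) (A : 'M[R]_p) : A^T = A ->
  a < lambda_min A -> lambda_max A < b -> qbounded a b A.
Proof.
move=> symA la lb; have [K eK] := eigenvalues_bounded symA.
apply: eigenvalues_qbounded => // x ex; apply/andP; split.
  apply: (le_trans (ltW la)); apply: ge_inf => //.
  by exists (- K) => z /= /eK/andP[].
apply: (le_trans _ (ltW lb)); apply: ub_le_sup => //.
by exists K => z /= /eK/andP[].
Qed.
End lambda.

Section matrix_topology.
Context {R : realType}.

Lemma cvg_sumr (T : Type) (F : set_system T) (I : Type) (r : seq I) (P : pred I)
    (f : I -> T -> R) (g : I -> R) {FF : Filter F} :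
  (forall i, P i -> f i x @[x --> F] --> g i) ->
  \sum_(i <- r | P i) f i x @[x --> F] --> \sum_(i <- r | P i) g i.
Proof. by apply: cvg_big => //; exact: add_continuous. Qed.

Lemma cvg_prodr (T : Type) (F : set_system T) (I : Type) (r : seq I) (P : pred I)
    (f : I -> T -> R) (g : I -> R) {FF : Filter F} :
  (forall i, P i -> f i x @[x --> F] --> g i) ->
  \prod_(i <- r | P i) f i x @[x --> F] --> \prod_(i <- r | P i) g i.
Proof. by apply: cvg_big => //; exact: mul_continuous. Qed.

Lemma det_continuous p : continuous (fun A : 'M[R]_p => \det A).
Proof.
move=> A; apply: (@cvg_sumr _ (nbhs A)) => s _; apply: cvgM; first exact: cvg_cst.
by apply: (@cvg_prodr _ (nbhs A)) => i _; exact: coord_continuous.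
Qed.

Lemma trace_mul_continuous p (S : 'M[R]_p) : continuous (fun A : 'M[R]_p => \tr (S *m A)).
Proof.
have -> : (fun A : 'M[R]_p => \tr (S *m A)) = (fun A => \sum_i \sum_j S i j * A j i).
  by apply/funext => A; apply: eq_bigr => i _; rewrite mxE.
move=> A; apply: (@cvg_sumr _ (nbhs A)) => i _; apply: (@cvg_sumr _ (nbhs A)) => j _.
by apply: cvgM; [exact: cvg_cst | exact: coord_continuous].
Qed.

Lemma fro2_sub_continuous p (A0 : 'M[R]_p) : continuous (fun A : 'M[R]_p => fro2 (A - A0)).
Proof.
have -> : (fun A => fro2 (A - A0)) =
    (fun A : 'M[R]_p => \sum_i \sum_j (A i j - A0 i j) * (A i j - A0 i j)).
  by apply/funext => A; do 2!apply: eq_bigr => ? _; rewrite !mxE expr2.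
move=> A; apply: (@cvg_sumr _ (nbhs A)) => i _; apply: (@cvg_sumr _ (nbhs A)) => j _.
by apply: cvgM; apply: cvgB; try exact: cvg_cst; exact: coord_continuous.
Qed.

Lemma vec_mx_continuous m n : continuous (@vec_mx R m n).
Proof.
move=> v s /(nbhs_ballP (vec_mx v)) [e e0 es].
apply/nbhs_ballP; exists e => //= w [_ vw]; apply: es; split => // i j.
by rewrite !mxE; exact: vw.
Qed.

Definition sym_ball p (A0 : 'M[R]_p) (r : R) : set 'M[R]_p :=
  [set A | A^T = A /\ fro2 (A - A0) <= r].

Lemma closed_le_fun (T : topologicalType) (f : T -> R) (r : R) :
  continuous f -> closed [set x | f x <= r].
Proof.
move=> cf; rewrite (_ : [set x | _] = f @^-1` [set y | y <= r]) //.
by apply: (@closed_comp _ _ f) => [x _|]; [exact: cf | exact: closed_le].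
Qed.

Lemma closed_sym_ball p (A0 : 'M[R]_p) r : closed (sym_ball A0 r).
Proof.
have -> : sym_ball A0 r = (\bigcap_(ij in [set: 'I_p * 'I_p])
     [set A : 'M[R]_p | `|A ij.2 ij.1 - A ij.1 ij.2| <= 0]) `&` [set A | fro2 (A - A0) <= r].
  apply/seteqP; split => [A [symA ?]|A [AH ?]]; split => //.
    by move=> [i j] _ /=; rewrite -[in X in X - _]symA mxE subrr normr0.
  apply/matrixP => i j; rewrite mxE; have /= := AH (i, j) I.
  by rewrite normr_le0 subr_eq0 => /eqP.
apply: closedI; last by apply: closed_le_fun; exact: fro2_sub_continuous.
apply: closed_bigI => ij _.
apply: (@closed_le_fun _ (fun A : 'M[R]_p => `|A ij.2 ij.1 - A ij.1 ij.2|)) => A.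
exact: (cvg_norm (cvgB (@coord_continuous R p p ij.2 ij.1 A)
  (@coord_continuous R p p ij.1 ij.2 A))).
Qed.

(** Closed bounded sets of row vectors are compact, and the ball is the continuous image of such a
    set under [vec_mx]. *)
Lemma compact_sym_ball p (A0 : 'M[R]_p) r : compact (sym_ball A0 r).
Proof.
have -> : sym_ball A0 r = vec_mx @` (vec_mx @^-1` sym_ball A0 r).
  apply/seteqP; split => [A BA|A [v Bv <-]//].
  by exists (mxvec A); rewrite /= mxvecK.
apply: continuous_compact.
  by apply: continuous_subspaceT => v; exact: vec_mx_continuous.
apply: bounded_closed_compact; last first.
  apply: (@closed_comp _ _ vec_mx) => [v _|]; last exact: closed_sym_ball.
  exact: vec_mx_continuous.
pose K := \sum_i \sum_j `|A0 i j| + (1 + r).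
exists K; split; first exact: num_real.
move=> x Kx v [_ Bv]; apply: le_trans (ltW Kx).
have r0 : 0 <= r by apply: le_trans Bv; exact: fro2_ge0.
have entry_le (i j : 'I_p) : `|vec_mx v i j| <= K.
  have h1 : (vec_mx v i j - A0 i j) ^+ 2 <= r.
    apply: le_trans Bv; rewrite /fro2 (bigD1 i) //= (bigD1 j) //= !mxE -addrA lerDl.
    rewrite addr_ge0 ?sumr_ge0 // => k _; rewrite ?sqr_ge0 ?sumr_ge0 // => l _.
    exact: sqr_ge0.
  have h2 : `|vec_mx v i j - A0 i j| <= 1 + r.
    move: h1; rewrite -real_normK ?num_real // => h1.
    by have := normr_ge0 (vec_mx v i j - A0 i j); nra.
  have h3 : `|A0 i j| <= \sum_i \sum_j `|A0 i j|.
    rewrite (bigD1 i) //= (bigD1 j) //= -addrA lerDl.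
    by rewrite addr_ge0 ?sumr_ge0 // => k _; rewrite ?sumr_ge0.
  rewrite -(subrK (A0 i j) (vec_mx v i j)) (le_trans (ler_normD _ _)) // addrC lerD //.
rewrite [leLHS]/Num.norm /= mx_normrE; apply/bigmax_leP; split.
  by rewrite addr_ge0 ?sumr_ge0 ?addr_ge0 // => k _; rewrite sumr_ge0.
move=> [k l] _ /=; rewrite ord1 -[v]vec_mxK.
by case/mxvec_indexP: l => i j; rewrite mxvecE.
Qed.

(** A penalty is continuous only on the half-line, with no information to the left of 0; composing
    with the absolute value gives continuity on the whole line, as the objective requires. *)
Lemma continuous_comp_norm (g : R -> R) :
  {within `[0, +oo[, continuous g} -> continuous (fun t : R => g `|t|).
Proof.
move=> /subspace_continuousP cg t A.
have t0 : `[0, +oo[%classic `|t| by rewrite /= in_itv /= normr_ge0.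
move=> /(cg _ t0); rewrite /within /= => At.
have nt := @norm_continuous _ R^o t _ At.
by apply: (@filterS _ (nbhs t) _ _ _ _ nt) => s; apply; rewrite /= in_itv /= normr_ge0.
Qed.

Lemma q1_continuous p (g : R -> R) (S : 'M[R]_p) A :
  {within `[0, +oo[, continuous g} -> 0 < \det A -> {for A, continuous (q1 g S)}.
Proof.
move=> cg dA.
have h1 := @trace_mul_continuous p S A.
have h2 : (fun B => ln (\det B)) @ A --> ln (\det A).
  exact: (@cvg_comp _ _ _ (fun B : 'M[R]_p => \det B) (@ln R) _ _ _
    (@det_continuous p A) (continuous_ln dA)).
have h3 : (fun B : 'M[R]_p => \sum_i \sum_(j | i != j) g `|B i j|) @ A -->
    \sum_i \sum_(j | i != j) g `|A i j|.
  apply: (@cvg_sumr _ (nbhs A)) => i _; apply: (@cvg_sumr _ (nbhs A)) => j _.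
  have h : (fun B : 'M[R]_p => g `|B i j|) @ A --> g `|A i j|.
    exact: (@cvg_comp _ _ _ (fun B : 'M[R]_p => B i j) (fun t : R => g `|t|) _ _ _
      (@coord_continuous R p p i j A) (@continuous_comp_norm g cg (A i j))).
  exact: h.
exact: (cvgD (cvgB h1 h2) h3).
Qed.

Lemma sym_ball_minimizer p (f : 'M[R]_p -> R) A0 r :
  A0^T = A0 -> 0 <= r -> (forall A, sym_ball A0 r A -> {for A, continuous f}) ->
  exists2 A, sym_ball A0 r A & forall B, sym_ball A0 r B -> f A <= f B.
Proof.
move=> symA0 r0 cf; have [||A BA minA] := @compact_EVT_min _ R f _ _ (@compact_sym_ball p A0 r).
- by exists A0; split => //; rewrite subrr (eqP (_ : fro2 0 == 0)) // fro2_eq0.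
- by apply: continuous_in_subspaceT => A; rewrite inE => BA; exact: cf.
- by exists A => [|B BB]; [rewrite inE in BA | apply: minA; rewrite inE].
Qed.

End matrix_topology.

(** * Minimization over a ball around the true precision matrix *)

Section oracle_ball.
Context {R : realType} {p : nat}.
Variables (tau1 tau2 r : R) (Sg : 'M[R]_p).
Hypotheses (p_gt0 : (0 < p)%N) (tau1_gt0 : 0 < tau1) (r_gt0 : 0 < r).
Hypotheses (qSg : qbounded tau1 tau2 Sg) (hr : tau2 ^+ 2 * (4 * r ^+ 2) <= 4^-1).
Local Notation Om0 := (invmx Sg).
Local Notation ball2r := (sym_ball Om0 (4 * r ^+ 2)).

Let tau12 : tau1 <= tau2.
Proof.
have c0 : 0 < fro2 (const_mx 1 : 'rV[R]_p).
  rewrite lt_neqAle fro2_ge0 eq_sym fro2_eq0 andbT; apply/eqP => /rowP/(_ (Ordinal p_gt0)).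
  by move/eqP; rewrite !mxE oner_eq0.
by have /andP[h1 h2] := qSg.2 (const_mx 1); rewrite -(ler_pM2r c0) (le_trans h1).
Qed.

Let tau2_gt0 : 0 < tau2. Proof. exact: lt_le_trans tau12. Qed.

Let qOm0 : qbounded tau2^-1 tau1^-1 Om0. Proof. exact: qbounded_inv. Qed.

Let symOm0 : Om0^T = Om0. Proof. by case: qOm0. Qed.

(** The hypothesis on [r] amounts to [2 r <= 1 / (2 tau2)], so a perturbation of Frobenius norm
    [2 r] takes at most half of the lower bound [1 / tau2] of [Om0]. The radius [2 r] is twice that
    within which the minimizer will lie; the slack allows its entries to be moved inside the
    ball. *)
Lemma ball_qbounded X : ball2r X -> qbounded (2 * tau2)^-1 (tau1^-1 + 2 * r) X.
Proof.
move=> [symX BX]; have symD : (X - Om0)^T = X - Om0.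
  by rewrite linearB /= symX symOm0.
have := qboundedD qOm0 symD; rewrite [Om0 + _]addrC subrK => -[_ qX]; split => // v.
have D2r : Num.sqrt (fro2 (X - Om0)) <= 2 * r.
  rewrite -(ger0_norm (_ : 0 <= 2 * r)) ?mulr_ge0 ?(ltW r_gt0) // -sqrtr_sqr.
  by apply: ler_wsqrtr; rewrite exprMn -natrX.
have D2t : 2 * r <= (2 * tau2)^-1.
  rewrite -(ler_pM2r (_ : 0 < 2 * tau2)) ?mulr_gt0 // mulVf ?mulf_neq0 ?gt_eqF //.
  rewrite -(ler_pXn2r (ltn0Sn 1)) ?nnegrE ?mulr_ge0 ?(ltW r_gt0) ?(ltW tau2_gt0) //.
  rewrite expr1n (_ : (2 * r * (2 * tau2)) ^+ 2 = 4 * (tau2 ^+ 2 * (4 * r ^+ 2))); last by ring.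
  by rewrite -ler_pdivlMl // mulr1.
have /andP[h1 h2] := qX v; have v0 := fro2_ge0 v.
apply/andP; split; [apply: le_trans h1 | apply: le_trans h2 _]; apply: ler_wpM2r => //; last first.
  by rewrite lerD2l.
have -> : tau2^-1 = (2 * tau2)^-1 + (2 * tau2)^-1.
  by field; rewrite gt_eqF.
by lra.
Qed.

Lemma ball_spd X : ball2r X -> spd X.
Proof.
move=> BX; have [symX qX] := ball_qbounded BX; split => // v v0.
have /andP[h _] := qX v; apply: lt_le_trans h.
rewrite mulr_gt0 ?invr_gt0 ?mulr_gt0 //.
by rewrite lt_neqAle fro2_ge0 eq_sym fro2_eq0 v0.
Qed.

Lemma ball_det_gt0 X : ball2r X -> 0 < \det X.
Proof.
move=> BX; apply: qbounded_det_gt0 (ball_qbounded BX).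
by rewrite invr_gt0 mulr_gt0.
Qed.

Lemma ball_inv_qbounded X : ball2r X ->
  qbounded (tau1^-1 + 2 * r)^-1 (2 * tau2) (invmx X).
Proof.
move=> BX; rewrite -[X in qbounded _ X]invrK.
by apply: qbounded_inv (ball_qbounded BX); rewrite // invr_gt0 mulr_gt0.
Qed.

Lemma ball_unit X : ball2r X -> X \in unitmx.
Proof. by move=> /ball_det_gt0 dX; rewrite unitmxE unitfE gt_eqF. Qed.

(** [logdet_upper] based at [X] in place of [Om0], with the quadratic gain dropped: the tangent
    inequality of a concave function, restricted to nearby matrices. *)
Lemma logdet_concave X Y : ball2r X -> ball2r Y -> (2 * tau2) ^+ 2 * fro2 (Y - X) <= 4^-1 ->
  ln (\det Y) <= ln (\det X) + \tr ((Y - X) *m invmx X).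
Proof.
move=> BX BY XY; have a0 : 0 < (tau1^-1 + 2 * r)^-1.
  by rewrite invr_gt0 addr_gt0 ?invr_gt0 ?mulr_gt0.
have symD : (Y - X)^T = Y - X by rewrite linearB /= BX.1 BY.1.
have := logdet_upper a0 (ball_inv_qbounded BX) (mulVmx (ball_unit BX)) (ball_det_gt0 BX) symD XY.
rewrite [X + _]addrC subrK => /le_trans; apply; rewrite lerBlDr lerDl.
by rewrite mulr_ge0 ?fro2_ge0 // divr_ge0 // sqr_ge0.
Qed.

Lemma diag_Om0_gt0 i : 0 < Om0 i i.
Proof.
have /andP[h _] := qOm0.2 (delta_mx 0 i).
have -> : Om0 i i = qform Om0 (delta_mx 0 i).
  by rewrite /qform -rowE trmx_delta -colE !mxE.
apply: lt_le_trans h; rewrite mulr_gt0 ?invr_gt0 //.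
rewrite lt_neqAle fro2_ge0 eq_sym fro2_eq0 andbT.
by apply/eqP => /rowP/(_ i)/eqP; rewrite !mxE !eqxx oner_eq0.
Qed.

(** The diagonal of [Om0] is positive and contributes exactly [p] pairs to [S1], so the truncated
    subtraction in [s1] is exact. *)
Lemma card_S1_offdiag :
  #|[pred ij : 'I_p * 'I_p | (Om0 ij.1 ij.2 != 0) && (ij.1 != ij.2)]| = s1 Om0.
Proof.
rewrite /s1.
have -> : #|S1 Om0| = (#|[pred ij : 'I_p * 'I_p | (Om0 ij.1 ij.2 != 0%R) && (ij.1 == ij.2)]| +
   #|[pred ij : 'I_p * 'I_p | (Om0 ij.1 ij.2 != 0%R) && (ij.1 != ij.2)]|)%N.
  rewrite -!sum1_card (bigID (fun ij => ij.1 == ij.2)) /=.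
  by congr (_ + _)%N; apply: eq_bigl => ij; rewrite !inE.
rewrite [X in (X + _)%N](_ : _ = p) ?addKn //.
rewrite -[RHS]card_ord -(card_imset _ (_ : injective (fun i : 'I_p => (i, i)))); last first.
  by move=> i j [].
apply: eq_card => -[i j]; rewrite !inE /=; apply/andP/imsetP => [[_ /eqP ->]|[k _ [-> ->]]].
  by exists j.
by rewrite eqxx gt_eqF // diag_Om0_gt0.
Qed.

Section minimizer.
Variables (S : 'M[R]_p) (g : R -> R) (kap a eta B : R).
Hypotheses (kap_ge0 : 0 <= kap) (a_ge0 : 0 <= a).
Hypothesis SSg : forall i j, `|S i j - Sg i j| <= kap.
Hypotheses (g_cont : {within `[0, +oo[, continuous g}) (g0 : g 0 = 0).
Hypothesis g_support : forall i j (x : R), Om0 i j != 0 -> i != j -> `|x| <= 2 * r ->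
  - (a * `|x| + eta * x ^+ 2) <= g `|Om0 i j + x| - g `|Om0 i j|.
Hypotheses (eta_ge0 : 0 <= eta) (B_ge0 : 0 <= B).
Hypothesis g_noise : forall D : 'M[R]_p, fro2 D <= 4 * r ^+ 2 ->
  \sum_(ij : 'I_p * 'I_p | Om0 ij.1 ij.2 == 0) (kap * `|D ij.1 ij.2| - g `|D ij.1 ij.2|)
    <= B * Num.sqrt (fro2 D).
Hypothesis rate_r :
  kap * Num.sqrt #|S1 Om0|%:R + a * Num.sqrt (s1 Om0)%:R + B < (tau1 ^+ 2 / 8 - eta) * r.

Lemma fro2_pair (D : 'M[R]_p) : fro2 D = \sum_(ij : 'I_p * 'I_p) D ij.1 ij.2 ^+ 2.
Proof. by rewrite /fro2 pair_bigA. Qed.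

Lemma offdiag_pair (F : 'I_p -> 'I_p -> R) :
  \sum_i \sum_(j | i != j) F i j = \sum_(ij : 'I_p * 'I_p | ij.1 != ij.2) F ij.1 ij.2.
Proof. by rewrite (pair_big_dep xpredT (fun i j => i != j)). Qed.

(** Put [F = ||D||]. The log-determinant gains [tau1^2 / 8 * F^2]. Against it stand the noise on the
    support, [kap sqrt |S1| F]; the penalty there, [a sqrt s F + eta F^2]; and the excess of noise
    over penalty off the support, [B F]. Here [g] is abstract, to cover both the penalty and its
    perturbation by a ramp. *)
Lemma q1_shell (D : 'M[R]_p) : D^T = D -> r ^+ 2 <= fro2 D <= 4 * r ^+ 2 ->
  q1 g S Om0 < q1 g S (Om0 + D).
Proof.
move=> symD /andP[Dr D2r]; set F := Num.sqrt (fro2 D).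
have F0 : 0 <= F by exact: sqrtr_ge0.
have FE : fro2 D = F ^+ 2 by rewrite sqr_sqrtr // fro2_ge0.
have rF : r <= F by rewrite -(ler_pXn2r (ltn0Sn 1)) ?nnegrE ?(ltW r_gt0) // -FE.
have uSg : Sg \in unitmx by apply: qbounded_unit qSg.
have dO : 0 < \det Om0 by apply: qbounded_det_gt0 qOm0; rewrite invr_gt0.
have BD : tau2 ^+ 2 * fro2 D <= 4^-1.
  by apply: le_trans hr; rewrite ler_wpM2l // sqr_ge0.
have := logdet_upper tau1_gt0 qSg (mulmxV uSg) dO symD BD => ld.
set sup := fun ij : 'I_p * 'I_p => Om0 ij.1 ij.2 != 0.
have trD : \tr (S *m D) - \tr (D *m Sg) =
    \sum_(ij : 'I_p * 'I_p) (S ij.1 ij.2 - Sg ij.1 ij.2) * D ij.1 ij.2.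
  rewrite [\tr (D *m _)]mxtrace_mulC -linearB -mulmxBl /= /mxtrace.
  rewrite -(pair_bigA _ (fun i j => (S i j - Sg i j) * D i j)) /=.
  apply: eq_bigr => i _; rewrite mxE; apply: eq_bigr => j _.
  by rewrite -[in D j i]symD !mxE.
have lin : - \sum_(ij : 'I_p * 'I_p) kap * `|D ij.1 ij.2| <= \tr (S *m D) - \tr (D *m Sg).
  rewrite trD -sumrN; apply: ler_sum => ij _.
  have : `|(S ij.1 ij.2 - Sg ij.1 ij.2) * D ij.1 ij.2| <= kap * `|D ij.1 ij.2|.
    by rewrite normrM ler_wpM2r.
  by rewrite ler_norml => /andP[].
have D_le ij : `|D ij.1 ij.2| <= 2 * r.
  rewrite -(ler_pXn2r (ltn0Sn 1)) ?nnegrE ?mulr_ge0 ?(ltW r_gt0) // real_normK ?num_real //.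
  rewrite exprMn -natrX; apply: le_trans D2r; rewrite fro2_pair (bigD1 ij) //= lerDl.
  by apply: sumr_ge0 => *; exact: sqr_ge0.
pose pen (ij : 'I_p * 'I_p) := g `|Om0 ij.1 ij.2 + D ij.1 ij.2| - g `|Om0 ij.1 ij.2|.
have qE : q1 g S (Om0 + D) - q1 g S Om0 = \tr (S *m D) - (ln (\det (Om0 + D)) - ln (\det Om0))
    + \sum_(ij : 'I_p * 'I_p | ij.1 != ij.2) pen ij.
  rewrite /q1 !offdiag_pair mulmxDr linearD /= /pen sumrB.
  rewrite (eq_bigr (fun ij => g `|Om0 ij.1 ij.2 + D ij.1 ij.2|)); last by move=> ij _; rewrite mxE.
  by ring.
have pen_off : \sum_(ij : 'I_p * 'I_p | ~~ sup ij) g `|D ij.1 ij.2| =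
    \sum_(ij : 'I_p * 'I_p | (ij.1 != ij.2) && ~~ sup ij) pen ij.
  apply: eq_big => [ij|ij]; rewrite /sup negbK; last first.
    by move=> /eqP O0; rewrite /pen O0 add0r normr0 g0 subr0.
  by case: (eqVneq ij.1 ij.2) => [->|//]; rewrite gt_eqF // diag_Om0_gt0.
have pen_on : - (a * (Num.sqrt (s1 Om0)%:R * F) + eta * F ^+ 2) <=
    \sum_(ij : 'I_p * 'I_p | (ij.1 != ij.2) && sup ij) pen ij.
  apply: (@le_trans _ _ (\sum_(ij : 'I_p * 'I_p | (ij.1 != ij.2) && sup ij)
      - (a * `|D ij.1 ij.2| + eta * D ij.1 ij.2 ^+ 2))); last first.
    by apply: ler_sum => ij /andP[h1 h2]; apply: g_support.
  rewrite sumrN lerN2 big_split -!mulr_sumr /= lerD //; last first.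
    rewrite ler_wpM2l // -FE fro2_pair [leRHS](bigID (fun ij => (ij.1 != ij.2) && sup ij)) /= lerDl.
    by apply: sumr_ge0 => *; exact: sqr_ge0.
  rewrite ler_wpM2l //; apply: le_trans (sum_norm_le_sqrt_card _ _) _.
  rewrite ler_pM ?sqrtr_ge0 ?ler_wsqrtr //.
    by rewrite -card_S1_offdiag ler_nat; apply: eq_leq; apply: eq_card => ij; rewrite !inE /= andbC.
  rewrite fro2_pair [leRHS](bigID (fun ij => (ij.1 != ij.2) && sup ij)) /= lerDl.
  by apply: sumr_ge0 => *; exact: sqr_ge0.
have lin_on : \sum_(ij : 'I_p * 'I_p | sup ij) kap * `|D ij.1 ij.2| <=
    kap * (Num.sqrt #|S1 Om0|%:R * F).
  rewrite -mulr_sumr ler_wpM2l //; apply: le_trans (sum_norm_le_sqrt_card _ _) _.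
  rewrite ler_pM ?sqrtr_ge0 ?ler_wsqrtr //.
    by rewrite ler_nat; apply: eq_leq; apply: eq_card => ij; rewrite !inE.
  by rewrite fro2_pair [leRHS](bigID sup) /= lerDl; apply: sumr_ge0 => *; exact: sqr_ge0.
have noise : \sum_(ij : 'I_p * 'I_p | ~~ sup ij) kap * `|D ij.1 ij.2| -
    \sum_(ij : 'I_p * 'I_p | ~~ sup ij) g `|D ij.1 ij.2| <= B * F.
  rewrite -sumrB; apply: le_trans (g_noise D2r).
  by rewrite le_eqVlt; apply/orP; left; apply/eqP; apply: eq_bigl => ij; rewrite /sup negbK.
rewrite -subr_gt0 qE (bigID sup) /= -pen_off.
move: lin; rewrite (bigID sup) /= => lin.
rewrite FE in ld.
(* [rate_r] holds with [F] in place of [r], since [r <= F] and the coefficient of [r] is positive: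
   its product with [r] exceeds a nonnegative quantity. *)
have rr : (kap * Num.sqrt #|S1 Om0|%:R + a * Num.sqrt (s1 Om0)%:R + B) * F <
    (tau1 ^+ 2 / 8 - eta) * F * F.
  rewrite ltr_pM2r; last exact: lt_le_trans rF.
  apply: lt_le_trans rate_r _; rewrite ler_wpM2l //.
  apply: ltW; rewrite -(pmulr_lgt0 _ r_gt0); apply: le_lt_trans rate_r.
  rewrite !addr_ge0 ?mulr_ge0 ?sqrtr_ge0 //.
nra.
Qed.

Lemma q1_minimizer : exists X : 'M[R]_p,
  [/\ ball2r X, fro2 (X - Om0) < r ^+ 2 & forall Y, ball2r Y -> q1 g S X <= q1 g S Y].
Proof.
have r4 : 0 <= 4 * r ^+ 2 by rewrite mulr_ge0 ?sqr_ge0.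
have [X BX minX] := sym_ball_minimizer symOm0 r4
  (fun A BA => q1_continuous (S := S) g_cont (ball_det_gt0 BA)).
exists X; split => //; rewrite ltNge; apply/negP => rX.
have BO : ball2r Om0 by split=> //; rewrite subrr (eqP (_ : fro2 0 == 0)) // fro2_eq0.
have := minX _ BO; apply/negP; rewrite -ltNge.
have symD : (X - Om0)^T = X - Om0 by rewrite linearB /= BX.1 symOm0.
have := q1_shell symD; rewrite [Om0 + _]addrC subrK; apply.
by rewrite rX BX.2.
Qed.

End minimizer.

Lemma closed_entries_le (X : 'M[R]_p) (e : R) :
  closed [set Y : 'M[R]_p | forall i j, `|X i j - Y i j| <= e].
Proof.
have -> : [set Y : 'M[R]_p | forall i j, `|X i j - Y i j| <= e] =
    \bigcap_(ij in [set: 'I_p * 'I_p]) [set Y : 'M[R]_p | `|X ij.1 ij.2 - Y ij.1 ij.2| <= e].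
  apply/seteqP; split => [Y YH [i j] _ | Y YH i j]; first exact: YH.
  exact: (YH (i, j)).
apply: closed_bigI => ij _.
apply: (@closed_le_fun _ _ (fun Y : 'M[R]_p => `|X ij.1 ij.2 - Y ij.1 ij.2|)) => Y.
exact: (cvg_norm (cvgB (cvg_cst (X ij.1 ij.2)) (@coord_continuous R p p ij.1 ij.2 Y))).
Qed.

(** As [g - pen] is constant near each off-diagonal entry of [X], and the diagonal is not penalized,
    the two objectives differ by a constant near [X]. The closed set is a small entrywise box around
    [X] cut with the ball; the strict bound on [fro2 (X - Om0)] makes [X] interior to it relative to
    the symmetric matrices. *)
Lemma ball_local_minimizer (S X : 'M[R]_p) (g pen : R -> R) :
  sym_ball Om0 (4 * r ^+ 2) X -> fro2 (X - Om0) < r ^+ 2 ->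
  (forall Y, ball2r Y -> q1 g S X <= q1 g S Y) ->
  (forall i j, i != j -> \forall t \near X i j,
     g `|t| - pen `|t| = g `|X i j| - pen `|X i j|) ->
  local_minimizer (q1 pen S) X.
Proof.
move=> BX Xr minX gpen.
have nearX : nbhs X [set Y : 'M[R]_p | forall ij : 'I_p * 'I_p, ij.1 != ij.2 ->
    g `|Y ij.1 ij.2| - pen `|Y ij.1 ij.2| = g `|X ij.1 ij.2| - pen `|X ij.1 ij.2|].
  apply: (@filter_forall _ _ (fun ij => [set Y : 'M[R]_p | ij.1 != ij.2 ->
    g `|Y ij.1 ij.2| - pen `|Y ij.1 ij.2| = g `|X ij.1 ij.2| - pen `|X ij.1 ij.2|])
    (nbhs X)) => -[i j] /=; have [->|nij] := eqVneq i j; first by apply: nearW.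
  have h := @coord_continuous R p p i j X _ (gpen i j nij).
  by apply: (@filterS _ (nbhs X) _ _ _ _ h) => Y /= hY _.
have /nbhs_ballP[e e0 eX] := nearX.
pose C := ball2r `&` [set Y : 'M[R]_p | forall i j, `|X i j - Y i j| <= e / 2].
have e2 : 0 < e / 2 by rewrite divr_gt0.
have CX Y : C Y -> ball X e Y.
  move=> [_ /= XY]; split => // i j; apply: le_lt_trans (XY i j) _.
  by rewrite ltr_pdivrMr // ltr_pMr // ltr1n.
exists C; split.
- by apply: closedI; [exact: closed_sym_ball | exact: closed_entries_le].
- by move=> Y [/ball_spd].
- split; first by split => // i j; rewrite subrr normr0 ltW.
  have n1 : \forall Y \near X, fro2 (Y - Om0) < 4 * r ^+ 2.
    have := @fro2_sub_continuous R p Om0 X; move/cvgr_lt; apply.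
    by apply: lt_le_trans Xr _; rewrite ler_peMl ?sqr_ge0 // ler1n.
  have n2 : \forall Y \near X, ball X (e / 2) Y by apply/nbhs_ballP; exists (e / 2).
  near=> Y => -[symY _]; split; first by split => //; apply: ltW; near: Y.
  have [_ XY] : ball X (e / 2) Y by near: Y.
  by move=> i j; apply/ltW/XY.
- have qE Y : q1 pen S Y = q1 g S Y -
      \sum_(ij : 'I_p * 'I_p | ij.1 != ij.2) (g `|Y ij.1 ij.2| - pen `|Y ij.1 ij.2|).
    by rewrite /q1 !offdiag_pair sumrB; ring.
  move=> Y CY; rewrite !qE.
  rewrite [X in _ <= _ - X](eq_bigr (fun ij => g `|X ij.1 ij.2| - pen `|X ij.1 ij.2|)).
    by rewrite lerD2r; apply: minX; case: CY.
  by move=> ij nij; apply: (eX Y (CX Y CY)).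
Unshelve. all: by end_near.
Qed.

(** * Small nonzero entries of a minimizer *)

Section wells.
Variables (S X : 'M[R]_p) (g : R -> R) (i j : 'I_p) (tau kap' kap3 : R).
Hypotheses (symS : S^T = S) (nij : i != j) (g0 : g 0 = 0).
Hypotheses (BX : ball2r X) (Xr : fro2 (X - Om0) < r ^+ 2).
Hypothesis minX : forall Y, ball2r Y -> q1 g S X <= q1 g S Y.
Hypotheses (x_neq0 : X i j != 0) (x_tau : `|X i j| <= tau) (tau_r : tau <= r / 2).
Hypotheses (gx : kap' * `|X i j| <= g `|X i j|) (gtau : g tau <= kap3 * tau).

(** Moving along [E] changes the entries [(i, j)] and [(j, i)] together and so preserves symmetry.
    Trace, log-determinant and penalty all pick up a factor 2, which cancels. *)
Let E : 'M[R]_p := delta_mx i j + delta_mx j i.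
Let x := X i j.
Let Om t : 'M[R]_p := X + (t - x) *: E.

Let symE : E^T = E.
Proof. by rewrite /E linearD /= !trmx_delta addrC. Qed.

Let Xji : X j i = x. Proof. by rewrite -BX.1 mxE. Qed.

Let EE k l : E k l = (((k == i) && (l == j)) || ((k == j) && (l == i)))%:R.
Proof.
rewrite !mxE; case: (eqVneq k i) => [->|ki] /=; last by rewrite add0r.
case: (eqVneq l j) => [->|lj] /=; first by rewrite (negbTE nij) addr0.
by rewrite (negbTE nij) /= addr0.
Qed.

Let fro2E : fro2 E = 2.
Proof.
rewrite fro2_tr symE /E mulmxDl !mulmxDr !mul_delta_mx_cond eqxx (negbTE nij).
rewrite eq_sym (negbTE nij) !mulr0n add0r addr0 eqxx mulr1n linearD /=.
have tr1 (k : 'I_p) : \tr (delta_mx k k : 'M[R]_p) = 1.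
  rewrite /mxtrace (bigD1 k) //= mxE !eqxx big1 ?addr0 // => l lk.
  by rewrite mxE (negbTE lk).
by rewrite !tr1.
Qed.

Let OmS t : (Om t)^T = Om t.
Proof. by rewrite /Om linearD linearZ /= BX.1 symE. Qed.

Let OmE t k l :
  Om t k l = if ((k == i) && (l == j)) || ((k == j) && (l == i)) then t else X k l.
Proof.
rewrite /Om mxE [X in _ + X]mxE EE; case: ifPn => [|_]; last by rewrite mulr0 addr0.
by case/orP => /andP[/eqP -> /eqP ->]; rewrite ?Xji mulr1 addrC subrK.
Qed.

Let trE (A : 'M[R]_p) : A^T = A -> \tr (A *m E) = 2 * A i j.
Proof.
move=> symA; have tr1 (k l : 'I_p) : \tr (A *m delta_mx k l) = A l k.
  rewrite mxtrace_mulC /mxtrace (bigD1 k) //= big1 ?addr0 => [|m mk].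
    rewrite mxE (bigD1 l) //= mxE !eqxx mul1r big1 ?addr0 // => m ml.
    by rewrite mxE (negbTE ml) andbF mul0r.
  by rewrite mxE big1 // => n _; rewrite mxE (negbTE mk) mul0r.
by rewrite mulmxDr linearD /= !tr1 -[in A j i]symA mxE mulrDl mul1r.
Qed.

Let Om_sub t u : Om t - Om u = (t - u) *: E.
Proof. by rewrite /Om opprD addrACA subrr add0r -scalerBl opprB addrA subrK. Qed.

Let OmX : Om x = X. Proof. by rewrite /Om subrr scale0r addr0. Qed.

Let fro2Z (c : R) (A : 'M[R]_p) : fro2 (c *: A) = c ^+ 2 * fro2 A.
Proof.
rewrite /fro2 mulr_sumr; apply: eq_bigr => k _; rewrite mulr_sumr.
by apply: eq_bigr => l _; rewrite mxE exprMn.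
Qed.

Let fro2_triangle (A C : 'M[R]_p) (u v : R) : 0 <= u -> 0 <= v ->
  fro2 A <= u ^+ 2 -> fro2 C <= v ^+ 2 -> fro2 (A + C) <= (u + v) ^+ 2.
Proof.
move=> u0 v0 Au Cv.
have cs : \sum_(kl : 'I_p * 'I_p) A kl.1 kl.2 * C kl.1 kl.2 <= u * v.
  apply: le_trans (CauchySchwarz_sum _ _ _) _; rewrite ler_pM ?sqrtr_ge0 //.
    by rewrite -fro2_pair -[leRHS]ger0_norm // -sqrtr_sqr ler_wsqrtr.
  by rewrite -fro2_pair -[leRHS]ger0_norm // -sqrtr_sqr ler_wsqrtr.
have -> : fro2 (A + C) = fro2 A + fro2 C + 2 * \sum_(kl : 'I_p * 'I_p) A kl.1 kl.2 * C kl.1 kl.2.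
  rewrite !fro2_pair mulr_sumr -!big_split; apply: eq_bigr => kl _ /=; rewrite mxE; ring.
by rewrite sqrrD; move: cs; rewrite -mulr_natl; lra.
Qed.

Let tau_ge0 : 0 <= tau. Proof. exact: le_trans x_tau. Qed.

Let Om_ball t : `|t - x| <= tau -> ball2r (Om t).
Proof.
move=> tx; split; first exact: OmS.
have -> : Om t - Om0 = (X - Om0) + (t - x) *: E by rewrite /Om addrAC.
rewrite (_ : 4 * r ^+ 2 = (r + r) ^+ 2); last by ring.
apply: fro2_triangle; rewrite ?(ltW r_gt0) ?(ltW Xr) //.
rewrite fro2Z fro2E -real_normK ?num_real //.
have := normr_ge0 (t - x); move: tau_r tx r_gt0 tau_ge0; move: `|t - x| => z; nra.
Qed.

Let B t := invmx (Om t).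

Let Om_near t u : `|t - u| <= tau -> (2 * tau2) ^+ 2 * fro2 (Om t - Om u) <= 4^-1.
Proof.
move=> tu; rewrite Om_sub fro2Z fro2E; have h : (t - u) ^+ 2 <= (r / 2) ^+ 2.
  rewrite -real_normK ?num_real // ler_pXn2r ?nnegrE ?divr_ge0 ?(ltW r_gt0) //.
  exact: le_trans tau_r.
have h2 := sqr_ge0 tau2; have h3 : 0 <= (t - u) ^+ 2 by exact: sqr_ge0.
have : tau2 ^+ 2 * (t - u) ^+ 2 <= tau2 ^+ 2 * (r / 2) ^+ 2 by rewrite ler_wpM2l.
move: hr; rewrite !exprMn; nra.
Qed.

(** Minimality of [X] against [Om t], with the log-determinants compared by the tangent at [Om t].
    Thus the gradient [S - B t] of the smooth part appears at the competitor and not at [X]. *)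
Let step t : `|t - x| <= tau -> (t - x) * (B t i j - S i j) <= g `|t| - g `|x|.
Proof.
move=> tx; have Bt := Om_ball tx.
have xt : `|x - t| <= tau by rewrite distrC.
have := logdet_concave Bt BX; rewrite -{1 3}OmX => /(_ (Om_near xt)).
rewrite Om_sub -scalemxAl linearZ /= mxtrace_mulC trE; last by rewrite trmx_inv OmS.
move=> ld; have := minX Bt; rewrite /q1 !offdiag_pair.
have -> : S *m Om t = S *m X + (t - x) *: (S *m E).
  by rewrite /Om mulmxDr scalemxAr.
rewrite linearD linearZ /= trE //.
have pE : \sum_(kl : 'I_p * 'I_p | kl.1 != kl.2) g `|Om t kl.1 kl.2| =
   \sum_(kl : 'I_p * 'I_p | kl.1 != kl.2) g `|X kl.1 kl.2| + 2 * (g `|t| - g `|x|).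
  have nji : j != i by rewrite eq_sym.
  have nn : (j, i) != (i, j) by rewrite xpair_eqE negb_and nji.
  rewrite (bigD1 (i, j)) //= [in RHS](bigD1 (i, j)) //=.
  rewrite (bigD1 (j, i)) ?nji ?nn //= [in RHS](bigD1 (j, i)) ?nji ?nn //=.
  rewrite !OmE !eqxx /= orbT Xji.
  rewrite [X in _ + (_ + X) = _](eq_bigr (fun kl => g `|X kl.1 kl.2|)); last first.
    move=> [k l] /=; rewrite !xpair_eqE !negb_and => /andP[/andP[_ n1] n2].
    by rewrite OmE -!negb_and in n1 n2 *; rewrite (negbTE n1) (negbTE n2).
  by rewrite -/x; ring.
by move: ld; rewrite pE ?OmX -/(B t); lra.
Qed.

(** The resolvent identity [B 0 - B t = t B 0 E B t]; its [(i, j)] entry is [t] times a sum of two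
    products of entries of inverses, each entry at most [2 tau2]. *)
Let inv_diff t : `|t - x| <= tau -> `|0 - x| <= tau ->
  `|B 0 i j - B t i j| <= 8 * tau2 ^+ 2 * `|t|.
Proof.
move=> /Om_ball Bt /Om_ball B0.
have BE : B 0 - B t = t *: (B 0 *m E *m B t).
  have tE : t *: E = Om t - Om 0 by rewrite Om_sub subr0.
  rewrite scalemxAl scalemxAr tE /B.
  by rewrite mulmxBr mulmxBl mulVmx ?ball_unit // -mulmxA mulmxV ?ball_unit // mul1mx mulmx1.
have deltaE (A C : 'M[R]_p) k l m n : (A *m delta_mx k l *m C) m n = A m k * C l n.
  rewrite mxE (bigD1 l) //= mxE (bigD1 k) //= mxE !eqxx mulr1 !big1 ?addr0 //.
    by move=> o ol; rewrite mxE big1 ?mul0r // => q _; rewrite mxE (negbTE ol) andbF mulr0.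
  by move=> o ok; rewrite mxE (negbTE ok) mulr0.
have -> : B 0 i j - B t i j = t * (B 0 i i * B t j j + B 0 i j * B t i j).
  have := congr1 (fun M : 'M[R]_p => M i j) BE.
  rewrite /= [X in X = _ -> _]mxE [X in _ + X]mxE [in RHS]mxE => ->.
  by rewrite /E mulmxDr mulmxDl mxE !deltaE.
have entry (A : 'M[R]_p) k l : ball2r A -> `|invmx A k l| <= 2 * tau2.
  move=> BA; apply: qbounded_entry (ball_inv_qbounded BA).
  by rewrite invr_ge0 addr_ge0 ?invr_ge0 ?mulr_ge0 // ltW.
rewrite normrM mulrC ler_wpM2r // (le_trans (ler_normD _ _)) // !normrM.
have -> : 8 * tau2 ^+ 2 = 2 * tau2 * (2 * tau2) + 2 * tau2 * (2 * tau2) by ring.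
by rewrite lerD // ler_pM ?entry.
Qed.

(* The entry X i j is compared with 0 and with an entry of size tau.  As 0 does
   not win, the gradient of the smooth part at 0 is at least kap'; it is still
   at least kap' - 8 tau2^2 tau at tau, which would make tau win. *)
Lemma no_small_entry : kap' <= 8 * tau2 ^+ 2 * tau + kap3.
Proof.
have x0 : 0 < `|x| by rewrite normr_gt0.
pose s := Num.sg x.
have s1 : `|s| = 1 by rewrite normr_sg x_neq0.
have sx : x = s * `|x| by rewrite -numEsg.
have tx : s * tau - x = s * (tau - `|x|) by rewrite {1}sx mulrBr.
have st : `|s * tau - x| <= tau.
  rewrite tx normrM s1 mul1r ger0_norm ?subr_ge0 //.
  by rewrite lerBlDr lerDl ltW.
have s0 : `|0 - x| <= tau by rewrite sub0r normrN.
have d0 := inv_diff st s0.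
rewrite normrM s1 mul1r ger0_norm // in d0.
have h0 : kap' <= s * (B 0 i j - S i j).
  have := step s0; rewrite normr0 g0 !sub0r {1}sx mulNr lerN2 => h.
  rewrite -(ler_pM2r x0) mulrAC; exact: le_trans gx h.
have h1 : (tau - `|x|) * (s * (B (s * tau) i j - S i j)) <= kap3 * tau - kap' * `|x|.
  have := step st; rewrite normrM s1 mul1r ger0_norm // tx -mulrA mulrCA => /le_trans; apply.
  by rewrite lerD // lerN2.
have h2 : s * (B 0 i j - S i j) - 8 * tau2 ^+ 2 * tau <= s * (B (s * tau) i j - S i j).
  rewrite lerBlDr -lerBlDl -mulrBr opprB addrA subrK.
  by apply: le_trans (ler_norm _) _; rewrite normrM s1 mul1r.
have t0 : 0 < tau by exact: lt_le_trans x_tau.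
have L0 : 0 <= 8 * tau2 ^+ 2 by rewrite mulr_ge0 ?sqr_ge0.
rewrite leNgt; apply/negP => hc.
move: h0 h1 h2 x0 x_tau L0 hc; rewrite -/x.
move: (s * (B 0 i j - S i j)) (s * (B (s * tau) i j - S i j)) `|x| (8 * tau2 ^+ 2) => u w z L.
move=> h0 h1 h2 z0 zt L0 hc.
have h3 : (tau - z) * (kap' - L * tau) <= (tau - z) * w.
  by rewrite ler_wpM2l ?subr_ge0 //; lra.
have : kap' * tau <= (L * tau + kap3) * tau.
  have : 0 <= L * tau * z by rewrite !mulr_ge0 // ltW.
  nra.
by rewrite ler_pM2r // leNgt hc.
Qed.

End wells.
End oracle_ball.

(** * Penalties *)

Section smooth_penalty.
Context {R : realType}.
Variables (f f1 f2 : R -> R) (c D : R).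
Hypothesis f_nondecr : {in `[0, +oo[ &, {homo f : t u / t <= u}}.
Hypotheses (c_gt0 : 0 < c) (D_ge0 : 0 <= D).
Hypothesis f_der : forall t, c < t -> is_derive t 1 f (f1 t) /\ is_derive t 1 f1 (f2 t).
Hypothesis f_lip : forall t u, c < t -> c < u ->
  `|f2 t - f2 u| <= D * `|t - u|.

Lemma MVT_above (h h1 : R -> R) (u v : R) : c < u -> u < v ->
  (forall t, c < t -> is_derive t 1 h (h1 t)) ->
  exists2 xi, u < xi < v & h v - h u = h1 xi * (v - u).
Proof.
move=> cu uv dh.
have := @MVT R h h1 u v uv; case.
- move=> x; rewrite in_itv /= => /andP[ux _].
  by apply: dh; exact: lt_trans ux.
- apply: derivable_within_continuous => x; rewrite in_itv /= => /andP[ux _].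
  by have [] := dh _ (lt_le_trans cu ux).
- by move=> xi; rewrite in_itv /= => xi1 xi2; exists xi.
Qed.

(* A very negative f'' at w would, f'' being Lipschitz, make f' negative and f
   decreasing shortly after w. *)
Lemma derive2_lower (w a e : R) : c < w -> f1 w <= a -> 0 <= a -> 0 < e ->
  - (a / e + 2 * D * e) <= f2 w.
Proof.
move=> cw fw a0 e0.
have we : c < w + e by lra.
have wee : w + e < w + 2 * e by lra.
have [x /andP[x1 x2] xE] := MVT_above we wee (fun t ct => (f_der ct).1).
have fx0 : 0 <= f1 x.
  have : f (w + e) <= f (w + 2 * e) by apply: f_nondecr; rewrite ?in_itv /= ?andbT; move: c_gt0; lra.
  rewrite -subr_ge0 xE pmulr_lge0 //; lra.
have wx : w < x by lra.
have [z /andP[z1 z2] zE] := MVT_above cw wx (fun t ct => (f_der ct).2).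
have lz : f2 z - f2 w <= D * (2 * e).
  apply: le_trans (ler_norm _) _; apply: le_trans (f_lip _ _) _; try lra.
  by rewrite ler_wpM2l // ger0_norm; lra.
have az : - (a / e) <= f2 z.
  have h : - a <= f2 z * (x - w) by rewrite -zE; lra.
  rewrite -mulNr ler_pdivrMr //.
  have xw : e <= x - w by lra.
  have [z0|z0] := leP 0 (f2 z); last by nra.
  by have := mulr_ge0 z0 (ltW e0); lra.
lra.
Qed.

(** If [|w + x| >= |w|], monotonicity suffices. Otherwise two mean values give a decrease of at most
    [(a + eta h) h] with [h = |x|]: [f'] grows to the left of [|w|] at most at the rate allowed by
    the lower bound on [f''], namely [a / e + 2 D e] from [derive2_lower] at [|w|] and [D rho] from
    the Lipschitz condition. The shift [e] is left free. *)
Lemma penalty_support_lower (w rho a e x : R) : c + rho < `|w| -> f1 `|w| <= a ->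
  0 <= a -> 0 < e -> `|x| <= rho ->
  - (a * `|x| + (a / e + 2 * D * e + D * rho) * x ^+ 2) <= f `|w + x| - f `|w|.
Proof.
move=> cw fw a0 e0 xr; set eta := a / e + _ + _.
have rho0 : 0 <= rho by exact: le_trans xr.
have ae0 : 0 <= a / e by rewrite divr_ge0 // ltW.
have eta0 : 0 <= eta by rewrite addr_ge0 ?mulr_ge0 // addr_ge0 // !mulr_ge0 // ltW.
have tri : `|w| <= `|w + x| + `|x| by have := ler_normB (w + x) x; rewrite addrK.
have x2 : x ^+ 2 = `|x| ^+ 2 by rewrite real_normK ?num_real.
move: (normr_ge0 x) (normr_ge0 w) (normr_ge0 (w + x)) tri fw cw xr; rewrite x2.
move: `|w| `|x| `|w + x| => u h v h0 u0 v0 tri fu cu hr.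
have [uv|vu] := leP u v.
  have : f u <= f v by apply: f_nondecr; rewrite ?in_itv /= ?andbT.
  have : 0 <= a * h + eta * h ^+ 2 by rewrite addr_ge0 ?mulr_ge0 ?sqr_ge0.
  lra.
have cv : c < v by lra.
have [y /andP[y1 y2] yE] := MVT_above cv vu (fun t ct => (f_der ct).1).
have cy : c < y by lra.
have [z /andP[z1 z2] zE] := MVT_above cy y2 (fun t ct => (f_der ct).2).
have cu' : c < u by lra.
have d2 := derive2_lower cu' fu a0 e0.
have lz : f2 u - f2 z <= D * rho.
  apply: le_trans (ler_norm _) _; apply: le_trans (f_lip _ _) _; try lra.
  by rewrite ler_wpM2l // ger0_norm; lra.
have z_lo : - eta <= f2 z by rewrite /eta; lra.
have y_hi : f1 y <= a + eta * h.
  have : - (eta * h) <= f2 z * (u - y).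
    rewrite -mulNr.
    apply: (@le_trans _ _ (- eta * (u - y))); last by rewrite ler_wpM2r //; lra.
    by rewrite !mulNr lerN2 ler_wpM2l //; lra.
  lra.
have : (a + eta * h) * (u - v) <= (a + eta * h) * h.
  by rewrite ler_wpM2l ?addr_ge0 ?mulr_ge0 //; lra.
have : f1 y * (u - v) <= (a + eta * h) * (u - v).
  by rewrite ler_wpM2r //; lra.
rewrite -yE expr2; lra.
Qed.

End smooth_penalty.

Section wells.
Context {R : realType}.

Definition ramp (dl c t : R) : R := c * Num.min 1 (Num.max 0 (t / dl - 1)).

Lemma ramp_continuous dl c : continuous (ramp dl c).
Proof.
move=> t; apply: cvgM; first exact: cvg_cst.
have h1 : (fun s : R => s / dl - 1) @ t --> t / dl - 1.
  by apply: cvgB; [apply: cvgM; [exact: cvg_id | exact: cvg_cst] | exact: cvg_cst].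
have := @continuous_min R R (cst 1) (fun s => Num.max 0 (s / dl - 1)) t.
apply; first exact: cvg_cst.
have := @continuous_max R R (cst 0) (fun s => s / dl - 1) t.
by apply => //; exact: cvg_cst.
Qed.

Lemma ramp_low dl c t : 0 < dl -> t <= dl -> ramp dl c t = 0.
Proof.
move=> d0 td; rewrite /ramp max_l ?min_r ?mulr0 //.
by rewrite subr_le0 ler_pdivrMr // mul1r.
Qed.

Lemma ramp_high dl c t : 0 < dl -> 2 * dl <= t -> ramp dl c t = c.
Proof.
move=> d0 td; have h : 1 <= t / dl - 1 by rewrite lerBrDr ler_pdivlMr //; lra.
by rewrite /ramp max_r ?min_l ?mulr1 //; lra.
Qed.

Lemma ramp_ge0 dl c t : 0 <= c -> 0 <= ramp dl c t.
Proof. by move=> c0; rewrite mulr_ge0 // le_min ler01 /= le_max lexx. Qed.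

Variables (f : R -> R) (lam k0 : R).
Hypotheses (lam_gt0 : 0 < lam) (k0_gt0 : 0 < k0).
Hypothesis f_cont : {within `[0, +oo[, continuous f}.
Hypothesis f_nondecr : {in `[0, +oo[ &, {homo f : t u / t <= u}}.
Hypothesis f_sing : f t / (lam * t) @[t --> 0^'+] --> k0.

(** Singularity normalizes the penalty: a finite limit of [f t / (lam t)] forces [f t] to 0, and
    continuity carries this to the origin. *)
Lemma penalty_at0 : f 0 = 0.
Proof.
have [_ f0] := (continuous_within_itvcyP 0 f).1 f_cont.
have id0 : (fun t : R => lam * t) @ 0^'+ --> lam * 0.
  apply: cvgM; first exact: cvg_cst.
  by apply: cvg_at_right_filter; exact: cvg_id.
have h : (fun t => f t / (lam * t) * (lam * t)) @ 0^'+ --> k0 * (lam * 0) by apply: cvgM.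
rewrite !mulr0 in h.
have h' : f t @[t --> 0^'+] --> 0.
  apply: (cvg_trans _ h); apply: near_eq_cvg; near=> t.
  have t0 : 0 < t by near: t; exact: nbhs_right_gt.
  by rewrite /= mulfVK // mulf_neq0 ?gt_eqF.
exact: (cvg_unique _ f0 h').
Unshelve. all: by end_near. Qed.

Lemma penalty_near0 : exists2 dl : R, 0 < dl &
  forall t : R, 0 <= t <= dl -> k0 * lam / 2 * t <= f t.
Proof.
have : \forall t \near 0^'+, k0 / 2 < f t / (lam * t).
  by move/cvgr_gt: f_sing; apply; move: k0_gt0; lra.
case=> e /= e0 eH; exists (e / 2) => [|t /andP[t0 te]]; first by rewrite divr_gt0.
have [->|tn0] := eqVneq t 0; first by rewrite mulr0 penalty_at0.
have tp : 0 < t by rewrite lt_neqAle eq_sym tn0.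
have /= h : k0 / 2 < f t / (lam * t).
  by apply: eH => //=; rewrite sub0r normrN gtr0_norm //; lra.
rewrite ltr_pdivlMr ?mulr_gt0 // in h; apply: ltW; apply: le_lt_trans h.
by rewrite le_eqVlt; apply/orP; left; apply/eqP; field.
Qed.

(* The interval on which f lies above a line through 0 depends on lam, and it
   may be much shorter than tstar.  Let tau be close to the largest t <= tstar
   with f t <= k0 lam t / 8.  Adding a ramp of height 2 kap tau near 0 makes f
   dominate kap t up to tstar, and going from 0 to tau stays cheap. *)
Lemma penalty_wells (kap tstar m : R) : 0 <= kap -> kap <= k0 * lam / 8 ->
  0 < tstar -> 0 < m ->
  exists (g : R -> R) (dl : R), [/\ [/\ 0 < dl, 2 * dl <= tstar & 2 * dl <= m],
    {within `[0, +oo[, continuous g},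
    g 0 = 0 /\ (forall t : R, 0 <= t -> kap * t <= g t \/ tstar < t),
    (forall t : R, 0 <= t -> f t <= g t) &
    [/\ forall t : R, t <= dl -> g t = f t,
       (exists c, forall t : R, 2 * dl <= t -> g t = f t + c),
       (forall t : R, 0 <= t <= 2 * dl -> k0 * lam / 2 * t <= f t) &
       (forall t : R, g t = f t) \/
       exists2 tau, 2 * dl <= tau <= tstar & g tau <= (k0 * lam / 8 + 2 * kap) * tau]].
Proof.
move=> kap0 kapk ts0 m0.
have kl : 0 < k0 * lam by exact: mulr_gt0.
have [d d0 dH] := penalty_near0.
pose dl := Num.min d (Num.min tstar m) / 2.
have dl0 : 0 < dl by rewrite divr_gt0 // !lt_min d0 ts0 m0.
have dlE : 2 * dl = Num.min d (Num.min tstar m) by rewrite /dl; field.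
have dl1 : 2 * dl <= d by rewrite dlE ge_min lexx.
have dl2 : 2 * dl <= tstar by rewrite dlE !ge_min lexx orbT.
have dl3 : 2 * dl <= m by rewrite dlE !ge_min lexx !orbT.
have near0 t : 0 <= t <= 2 * dl -> k0 * lam / 2 * t <= f t.
  by move=> /andP[t1 t2]; apply: dH; rewrite t1 (le_trans t2).
pose A := [set t | [/\ 0 < t, t <= tstar & f t <= k0 * lam / 8 * t]].
have [A0|/set0P/negP/negPn/eqP A0] := pselect (A !=set0); last first.
  exists f, dl; split; [by split | by [] | | by [] | split].
  - split=> [|t t0]; first exact: penalty_at0.
    have [tt|] := leP t tstar; last by right.
    left; have [->|tn0] := eqVneq t 0; first by rewrite mulr0 penalty_at0.
    rewrite leNgt; apply/negP => ft; suff : A t by rewrite A0.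
    split => //; first by rewrite lt_neqAle eq_sym tn0.
    apply: ltW; apply: lt_le_trans ft _; rewrite ler_wpM2r //.
  - by [].
  - by exists 0 => t _; rewrite addr0.
  - exact: near0.
  - by left.
have supA : has_sup A by split => //; exists tstar => t [].
have [t0 At0] := A0.
have sup_gt0 : 0 < sup A.
  by have [h _ _] := At0; apply: lt_le_trans h _; exact: (ub_le_sup supA.2).
(* The supremum need not belong to [A]; an element beyond half of it suffices. All of [A] then lies
   below [2 tau], where the height [2 kap tau] covers [kap t], while beyond [2 tau] the penalty does
   so by itself. *)
have [tau [tau1 tau2 tau3] tauH] := sup_adherent (divr_gt0 sup_gt0 (ltr0Sn _ 1)) supA.
have Atau t : A t -> t <= 2 * tau.
  move=> At; have := ub_le_sup supA.2 At; move: tauH; lra.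
have tau_dl : 2 * dl <= tau.
  rewrite leNgt; apply/negP => td.
  have h : k0 * lam / 2 * tau <= f tau by apply: near0; rewrite !ltW.
  have : k0 * lam * tau <= 0 by lra.
  by rewrite leNgt mulr_gt0.
exists (fun t => f t + ramp dl (2 * kap * tau) t), dl; split; [by split | | | | split].
- move=> t; apply: continuousD; first exact: f_cont.
  by apply: continuous_subspaceT; exact: ramp_continuous.
- split=> [|t t0']; first by rewrite penalty_at0 ramp_low ?addr0 // ltW.
  have [tt|] := leP t tstar; last by right.
  left; have [td|td] := leP t (2 * dl).
    have h1 : k0 * lam / 2 * t <= f t by apply: near0; rewrite t0' td.
    have h2 : 0 <= ramp dl (2 * kap * tau) t by rewrite ramp_ge0 // !mulr_ge0 // ltW.
    have h3 : kap * t <= k0 * lam / 8 * t by rewrite ler_wpM2r.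
    have h4 : 0 <= k0 * lam * t by rewrite mulr_ge0 // ltW.
    lra.
  rewrite ramp_high ?(ltW td) //.
  have ft0 : 0 <= f t.
    by rewrite -penalty_at0; apply: f_nondecr; rewrite ?in_itv /= ?lexx ?t0'.
  have [t2|t2] := leP t (2 * tau).
    have : kap * t <= kap * (2 * tau) by rewrite ler_wpM2l.
    lra.
  have tp : 0 < t by lra.
  have ft : k0 * lam / 8 * t < f t.
    rewrite ltNge; apply/negP => h; have /Atau : A t by split.
    lra.
  have h3 : kap * t <= k0 * lam / 8 * t by rewrite ler_wpM2r.
  have h5 : 0 <= kap * tau by rewrite mulr_ge0 // ltW.
  lra.
- by move=> t _; rewrite lerDl ramp_ge0 // !mulr_ge0 // ltW.
- by move=> t td; rewrite ramp_low // addr0.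
- by exists (2 * kap * tau) => t td; rewrite ramp_high.
- exact: near0.
- right; exists tau; first by rewrite tau_dl.
  by rewrite ramp_high // mulrDl; lra.
Qed.

End wells.

(** * Existence of the local minimizer for a fixed sample *)

Section fixed_n.
Context {R : realType} {p : nat}.
Variables (tau1 tau2 r : R) (Sg S : 'M[R]_p) (pen : R -> R) (kap a : R).
Hypotheses (p_gt0 : (0 < p)%N) (tau1_gt0 : 0 < tau1) (r_gt0 : 0 < r).
Hypotheses (qSg : qbounded tau1 tau2 Sg) (hr : tau2 ^+ 2 * (4 * r ^+ 2) <= 4^-1).
Hypotheses (symS : S^T = S) (kap_ge0 : 0 <= kap) (a_ge0 : 0 <= a).
Hypothesis SSg : forall i j, `|S i j - Sg i j| <= kap.
Hypothesis pen_cont : {within `[0, +oo[, continuous pen}.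
Hypothesis pen_nondecr : {in `[0, +oo[ &, {homo pen : t u / t <= u}}.
Local Notation Om0 := (invmx Sg).

Lemma bounded_noise_local_minimizer (eta B : R) : pen 0 = 0 -> 0 <= eta -> 0 <= B ->
  (forall i j (x : R), Om0 i j != 0 -> i != j -> `|x| <= 2 * r ->
    - (a * `|x| + eta * x ^+ 2) <= pen `|Om0 i j + x| - pen `|Om0 i j|) ->
  (forall D : 'M[R]_p, fro2 D <= 4 * r ^+ 2 ->
    \sum_(ij : 'I_p * 'I_p | Om0 ij.1 ij.2 == 0) (kap * `|D ij.1 ij.2| - pen `|D ij.1 ij.2|)
      <= B * Num.sqrt (fro2 D)) ->
  kap * Num.sqrt #|S1 Om0|%:R + a * Num.sqrt (s1 Om0)%:R + B < (tau1 ^+ 2 / 8 - eta) * r ->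
  exists X, local_minimizer (q1 pen S) X /\ fro2 (X - Om0) < r ^+ 2.
Proof.
move=> pen0 eta0 B0 support noise rate_r.
have [X [BX Xr minX]] := q1_minimizer p_gt0 tau1_gt0 r_gt0 qSg hr kap_ge0 a_ge0 SSg
  pen_cont pen0 support eta0 B0 noise rate_r.
exists X; split => //; apply: (ball_local_minimizer p_gt0 tau1_gt0 r_gt0 qSg hr BX Xr minX).
by move=> i j _; near=> t; rewrite !subrr.
Unshelve. all: by end_near. Qed.

(** The crude count of at most [p^2] pairs; it is affordable when [p] is bounded. *)
Lemma sum_support_card (P : pred ('I_p * 'I_p)) (D : 'M[R]_p) :
  \sum_(ij | P ij) kap * `|D ij.1 ij.2| <= kap * p%:R * Num.sqrt (fro2 D).
Proof.
rewrite -mulr_sumr -mulrA ler_wpM2l //.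
apply: le_trans (sum_norm_le_sqrt_card _ _) _; rewrite ler_pM ?sqrtr_ge0 //.
  rewrite -[p%:R]ger0_norm // -sqrtr_sqr ler_wsqrtr // -natrX ler_nat.
  by apply: leq_trans (max_card _) _; rewrite card_prod card_ord mulnn.
rewrite ler_wsqrtr // fro2_pair [leRHS](bigID P) /= lerDl.
by apply: sumr_ge0 => *; exact: sqr_ge0.
Qed.

(** The ramp is completed before [c], so it is constant wherever the support entries range and
    leaves [penalty_support_lower] intact. Near a zero entry of the minimizer it vanishes; a nonzero
    entry has to be shown larger than [2 dl]. *)
Lemma wells_local_minimizer (lam k0 c D e tstar : R) (pen1 pen2 : R -> R) :
  0 < lam -> 0 < k0 -> pen t / (lam * t) @[t --> 0^'+] --> k0 ->
  0 < c -> 0 <= D ->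
  (forall t, c < t -> is_derive t 1 pen (pen1 t) /\ is_derive t 1 pen1 (pen2 t)) ->
  (forall t u, c < t -> c < u -> `|pen2 t - pen2 u| <= D * `|t - u|) ->
  (forall i j, Om0 i j != 0 -> c + 2 * r < `|Om0 i j| /\ pen1 `|Om0 i j| <= a) ->
  0 < e -> kap <= k0 * lam / 8 -> 0 < tstar -> tstar <= r / 2 ->
  8 * tau2 ^+ 2 * tstar < k0 * lam / 8 ->
  kap * Num.sqrt #|S1 Om0|%:R + a * Num.sqrt (s1 Om0)%:R + 2 * kap / tstar * r
    < (tau1 ^+ 2 / 8 - (a / e + 2 * D * e + D * (2 * r))) * r ->
  exists X, local_minimizer (q1 pen S) X /\ fro2 (X - Om0) < r ^+ 2.
Proof.
move=> lam0 k00 sing c0 D0 der lip supp e0 kapk ts0 tsr tsl.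
set eta := a / e + _ + _ => rate_r.
have eta0 : 0 <= eta.
  by rewrite /eta !addr_ge0 // ?mulr_ge0 ?invr_ge0 // ?mulr_ge0 // ltW.
have [g [dl [[dl0 dlt dlc] gcont [g0 g_lo] gpen [g_eq [cst g_cst] pen_lo g_well]]]] :=
  penalty_wells lam0 k00 pen_cont pen_nondecr sing kap_ge0 kapk ts0 c0.
have g_support i j (x : R) : Om0 i j != 0 -> i != j -> `|x| <= 2 * r ->
    - (a * `|x| + eta * x ^+ 2) <= g `|Om0 i j + x| - g `|Om0 i j|.
  move=> Oij nij xr; have [Oc Oa] := supp i j Oij.
  have h := penalty_support_lower pen_nondecr c0 D0 der lip Oc Oa a_ge0 e0 xr.
  have tri : `|Om0 i j| <= `|Om0 i j + x| + `|x| by have := ler_normB (Om0 i j + x) x; rewrite addrK.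
  have h1 : 2 * dl <= `|Om0 i j + x| by lra.
  have h2 : 2 * dl <= `|Om0 i j| by move: r_gt0; lra.
  by rewrite -/eta in h; rewrite !g_cst //; move: h; lra.
have g_noise (M : 'M[R]_p) : fro2 M <= 4 * r ^+ 2 ->
  \sum_(ij : 'I_p * 'I_p | Om0 ij.1 ij.2 == 0) (kap * `|M ij.1 ij.2| - g `|M ij.1 ij.2|)
    <= (2 * kap / tstar * r) * Num.sqrt (fro2 M).
  (* Only entries beyond [tstar] contribute, each at most [kap z^2 / tstar]. Since [||M|| <= 2 r],
     the total [kap / tstar * ||M||^2] is linear in [||M||] with the coefficient claimed. *)
  move=> Mr; apply: (@le_trans _ _ (kap / tstar * fro2 M)).
    rewrite fro2_pair [X in _ * X](bigID (fun ij => Om0 ij.1 ij.2 == 0)) /=.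
    rewrite mulrDr mulr_sumr ler_wpDr //.
      rewrite mulr_ge0 ?divr_ge0 // ?(ltW ts0) //.
      by apply: sumr_ge0 => *; exact: sqr_ge0.
    apply: ler_sum => ij _; set z := `|M _ _|.
    rewrite -real_normK ?num_real // -/z.
    have z0 : 0 <= z by exact: normr_ge0.
    have gz0 : 0 <= g z.
      apply: le_trans (gpen z z0).
      by rewrite -(penalty_at0 lam0 pen_cont sing) pen_nondecr ?in_itv /= ?lexx ?z0.
    case: (g_lo z z0) => h.
      apply: (@le_trans _ _ 0); first by rewrite subr_le0.
      by rewrite mulr_ge0 ?divr_ge0 ?sqr_ge0 // ltW.
    apply: (@le_trans _ _ (kap * z)); first by rewrite gerBl.
    rewrite -mulrA ler_wpM2l // expr2 mulrA ler_peMl // mulrC ler_pdivlMr // mul1r ltW //.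
  have F2 : fro2 M = Num.sqrt (fro2 M) * Num.sqrt (fro2 M) by rewrite -expr2 sqr_sqrtr // fro2_ge0.
  have Fr : Num.sqrt (fro2 M) <= 2 * r.
    rewrite -(ger0_norm (_ : 0 <= 2 * r)) ?mulr_ge0 ?(ltW r_gt0) // -sqrtr_sqr.
    by apply: ler_wsqrtr; rewrite exprMn -natrX.
  rewrite {1}F2 mulrA ler_wpM2r ?sqrtr_ge0 //.
  have -> : 2 * kap / tstar * r = kap / tstar * (2 * r) by ring.
  by rewrite ler_wpM2l // divr_ge0 // ltW.
have B0 : 0 <= 2 * kap / tstar * r by rewrite !mulr_ge0 ?invr_ge0 // ltW.
have [X [BX Xr minX]] := q1_minimizer p_gt0 tau1_gt0 r_gt0 qSg hr kap_ge0 a_ge0 SSg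
  gcont g0 g_support eta0 B0 g_noise rate_r.
exists X; split => //; apply: (ball_local_minimizer p_gt0 tau1_gt0 r_gt0 qSg hr BX Xr minX).
move=> i j nij.
have [gE|[tau /andP[tau_dl tau_ts] gtau]] := g_well.
  by near=> t; rewrite !gE !subrr.
have [Xij0|Xij] := eqVneq (X i j) 0.
  near=> t; have td : `|t| <= dl.
    near: t; have := @norm_continuous _ R^o (X i j) => /cvgr_le; apply.
    by rewrite Xij0 normr0.
  by rewrite Xij0 normr0 !g_eq ?subrr // ltW.
have X_large : 2 * dl < `|X i j|.
  have [Oij0|Oij] := eqVneq (Om0 i j) 0; last first.
    have [Oc _] := supp i j Oij.
    have Dr : `|X i j - Om0 i j| <= r.
      rewrite -(ler_pXn2r (ltn0Sn 1)) ?nnegrE ?(ltW r_gt0) // real_normK ?num_real //.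
      apply: le_trans (ltW Xr); rewrite fro2_pair (bigD1 (i, j)) //= !mxE lerDl.
      by apply: sumr_ge0 => *; exact: sqr_ge0.
    have := ler_normB (X i j) (X i j - Om0 i j); rewrite opprB addrC subrK.
    by move: r_gt0; lra.
  rewrite ltNge; apply/negP => Xdl.
  have gx : k0 * lam / 2 * `|X i j| <= g `|X i j|.
    by apply: le_trans (gpen _ (normr_ge0 _)); apply: pen_lo; rewrite normr_ge0 Xdl.
  have xt : `|X i j| <= tau by exact: le_trans tau_dl.
  have tr : tau <= r / 2 by exact: le_trans tsr.
  (* The fractions of [k0 lam] collide: the slope [1/2] near 0 would be at most [1/8] for the slope
     at [tau], plus [2/8] for [2 kap], plus [8 tau2^2 tau], which is less than [1/8]. *)
  have := no_small_entry p_gt0 tau1_gt0 r_gt0 qSg hr symS nij g0 BX Xr minX Xij xt tr gx gtau.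
  have t8 : 8 * tau2 ^+ 2 * tau <= 8 * tau2 ^+ 2 * tstar.
    by rewrite ler_wpM2l // mulr_ge0 ?sqr_ge0.
  have kl : 0 < k0 * lam by rewrite mulr_gt0.
  lra.
near=> t; have td : 2 * dl <= `|t|.
  near: t; have := @norm_continuous _ R^o (X i j) => /cvgr_ge; apply => //.
by rewrite !g_cst // ?(ltW X_large) // addrAC subrr add0r addrAC subrr add0r.
Unshelve. all: by end_near. Qed.

End fixed_n.

(** * Concentration of the sample covariance *)

Section integral_factor.
Context {R : realType} {d d' : measure_display} {T : measurableType d} {T' : measurableType d'}.
Variables (P : {measure set T -> \bar R}) (Y : T -> T').
Hypothesis mY : measurable_fun setT Y.

Lemma measurable_preimage_setT (B : set T') : measurable B -> measurable (Y @^-1` B).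
Proof. by move=> mB; rewrite -(setTI (_ @^-1` _)); exact: mY. Qed.

Import HBNNSimple.

Lemma integral_factor_nnsfun (h : T -> R) (c : R) (s : {nnsfun T' >-> R}) :
  measurable_fun setT h -> (forall w, 0 <= h w) -> 0 <= c ->
  (forall B, measurable B ->
    \int[P]_w (h w * \1_B (Y w))%:E = c%:E * P (Y @^-1` B))%E ->
  (\int[P]_w (h w * s (Y w))%:E =
    c%:E * \sum_(k \in range s) k%:E * P (Y @^-1` (s @^-1` [set k])))%E.
Proof.
move=> mh h0 c0 H.
pose F (k : R) w := (h w * (k * \1_(s @^-1` [set k]) (Y w)))%:E.
have mB k : measurable (s @^-1` [set k]) by exact: measurable_sfunP.
have mF k : measurable_fun setT (F k).
  apply/measurable_EFinP; apply: measurable_funM => //; apply: measurable_funM => //.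
  by apply: (measurableT_comp _ mY); exact: measurable_indic.
have F0 k w : (0 <= F k w)%E by rewrite lee_fin mulr_ge0 // -lee_fin EFinM nnfun_muleindic_ge0.
transitivity (\int[P]_w \sum_(k \in range s) F k w)%E.
  apply: eq_integral => w _; rewrite fsumEFin // fimfunE /F; congr EFin.
  by rewrite mulr_fsumr; apply: eq_fsbigr => k _.
rewrite ge0_integral_fsum // ge0_mule_fsumr; last first.
  move=> k; have [k0|k0] := leP 0%R k; first by rewrite mule_ge0 ?lee_fin.
  by rewrite preimage_nnfun0 // preimage_set0 measure0 mule0.
apply: eq_fsbigr => k _; have [k0|k0] := leP 0%R k; last first.
  rewrite /F preimage_nnfun0 // preimage_set0 measure0 !mule0.
  by apply: integral0_eq => w _; rewrite indic0 !mulr0.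
rewrite muleCA -H // -ge0_integralZl_EFin //.
- by apply: eq_integral => w _; rewrite /F -EFinM mulrCA.
- by move=> w _; rewrite lee_fin mulr_ge0.
- apply/measurable_EFinP; apply: measurable_funM => //.
  by apply: (measurableT_comp _ mY); exact: measurable_indic.
Qed.

(** Factorization on sets extends to simple functions by linearity, and to nonnegative measurable
    functions by monotone convergence on both sides. *)
Lemma integral_factor (h : T -> R) (g : T' -> R) (c : R) :
  measurable_fun setT h -> (forall w, 0 <= h w) -> 0 <= c ->
  measurable_fun setT g -> (forall x, 0 <= g x) ->
  (forall B, measurable B ->
    \int[P]_w (h w * \1_B (Y w))%:E = c%:E * P (Y @^-1` B))%E ->
  (\int[P]_w (h w * g (Y w))%:E = c%:E * \int[P]_w (g (Y w))%:E)%E.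
Proof.
move=> mh h0 c0 mg g0 H.
have mEg : measurable_fun setT (EFin \o g) by exact/measurable_EFinP.
pose s := nnsfun_approx measurableT mEg.
have s_cvg x : (s n x)%:E @[n --> \oo] --> (g x)%:E.
  by apply: (cvg_nnsfun_approx measurableT mEg) => // y _; rewrite lee_fin.
have s_cvgR x : s n x @[n --> \oo] --> g x by have /fine_cvgP[] := s_cvg x.
have nd x m n : (m <= n)%N -> s m x <= s n x by move=> mn; exact/lefP/nd_nnsfun_approx.
have msY n : measurable_fun setT (fun w => s n (Y w)).
  exact: (measurableT_comp (measurable_funP (s n)) mY).
have sY n : (\int[P]_w (h w * s n (Y w))%:E = c%:E * \int[P]_w (s n (Y w))%:E)%E.
  rewrite (integral_factor_nnsfun _ mh h0 c0 H); congr (_ * _)%E.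
  have H1 B : measurable B -> (\int[P]_w (cst 1 w * \1_B (Y w))%:E = 1%:E * P (Y @^-1` B))%E.
    move=> mB; rewrite mul1e -[Y @^-1` B]setIT -integral_indic //.
      by apply: eq_integral => w _; rewrite mul1r.
    exact: measurable_preimage_setT.
  have := integral_factor_nnsfun (s n) (measurable_cst (1 : R)) (fun=> ler01) ler01 H1.
  by rewrite mul1e => <-; apply: eq_integral => w _; rewrite mul1r.
have lim_int (f : T -> R) : measurable_fun setT f -> (forall w, 0 <= f w) ->
    (\int[P]_w (f w * s n (Y w))%:E @[n --> \oo] --> \int[P]_w (f w * g (Y w))%:E)%E.
  move=> mf f0.
  have -> : (\int[P]_w (f w * g (Y w))%:E = \int[P]_w (limn (fun n => (f w * s n (Y w))%:E)))%E.
    apply: eq_integral => w _; apply/esym/cvg_lim => //.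
    by apply: cvg_EFin; [exact: nearW | apply: cvgM; [exact: cvg_cst | exact: s_cvgR]].
  apply: cvg_monotone_convergence => //.
  - by move=> k; apply/measurable_EFinP/measurable_funM.
  - by move=> k w _; rewrite lee_fin mulr_ge0.
  - by move=> w _ a b ab; rewrite lee_fin ler_wpM2l // nd.
have c1 := lim_int h mh h0.
have c2 : (c%:E * \int[P]_w (s n (Y w))%:E @[n --> \oo] --> c%:E * \int[P]_w (g (Y w))%:E)%E.
  apply: cvgeZl => //; have := lim_int (cst 1) (measurable_cst _) (fun=> ler01).
  under eq_fun do under eq_integral do rewrite mul1r.
  by under eq_integral do rewrite mul1r.
have c2' : (\int[P]_w (h w * s n (Y w))%:E @[n --> \oo] --> c%:E * \int[P]_w (g (Y w))%:E)%E.
  by under eq_fun do rewrite sY.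
exact: (cvg_unique _ c1 c2').
Qed.
End integral_factor.

(** * Expectation of a product over an i.i.d. sample *)

Section iid_product.
Context {R : realType} {d : measure_display} {T : measurableType d}.
Context {P : probability T R} {p n : nat}.
Variables (y : 'I_n -> {RV P >-> p.-tuple R}) (g : p.-tuple R -> R) (m : 'I_n -> R).
Hypothesis y_iid : iid y.
Hypotheses (mg : measurable_fun setT g) (g0 : forall x, 0 <= g x).
Hypothesis gm : forall i, (\int[P]_w (g (y i w))%:E = (m i)%:E)%E.

Let m0 i : 0 <= m i.
Proof. by rewrite -lee_fin -gm; apply: integral_ge0 => w _; rewrite lee_fin. Qed.

Let my i : measurable_fun setT (y i) := measurable_funPT (y i).

(** A hybrid: the first [k] factors are already functions [g], the others still indicators. Raising
    [k] trades one indicator for [g]. *)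
Let factor (k : nat) (B : 'I_n -> set (p.-tuple R)) (w : T) (i : 'I_n) : R :=
  if (i < k)%N then g (y i w) else \1_(B i) (y i w).

Let factor_int (k : nat) (B : 'I_n -> set (p.-tuple R)) (i : 'I_n) : R :=
  if (i < k)%N then m i else fine (P (y i @^-1` B i)).

Let factor_ge0 k B w i : 0 <= factor k B w i.
Proof. by rewrite /factor; case: ifP. Qed.

Let factor_int_ge0 k B i : 0 <= factor_int k B i.
Proof. by rewrite /factor_int; case: ifP => // _; rewrite fine_ge0. Qed.

Let measurable_factor k B i : (forall i, measurable (B i)) ->
  measurable_fun setT (fun w => factor k B w i).
Proof.
move=> mB; rewrite /factor; case: (i < k)%N.
  exact: (measurableT_comp mg (my i)).
by apply: (measurableT_comp _ (my i)); exact: measurable_indic.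
Qed.

(** The base case is the product rule for events. The sets are quantified inside the induction
    because varying the set at index [k] in the induction hypothesis yields the premise of
    [integral_factor]. *)
Let iid_partial_product k B : (k <= n)%N -> (forall i, measurable (B i)) ->
  (\int[P]_w (\prod_i factor k B w i)%:E = (\prod_i factor_int k B i)%:E)%E.
Proof.
elim: k B => [|k IHk] B kn mB.
  have -> : (\prod_i factor_int 0 B i)%:E = P (\bigcap_(i in [set: 'I_n]) (y i @^-1` B i)).
    rewrite y_iid.1 //; elim/big_ind2 : _ => // [u1 u2 v1 v2 <- <-|i _].
      by rewrite EFinM.
    by rewrite /factor_int /= fineK // fin_num_measure //; exact: measurable_preimage_setT.
  rewrite -[X in P X]setIT -integral_indic //; last first.
    by apply: fin_bigcap_measurable => // i _; exact: measurable_preimage_setT.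
  apply: eq_integral => w _; congr EFin.
  rewrite /factor /= indicE.
  under eq_bigr do rewrite indicE.
  have [wB|nwB] := boolP (w \in _).
    rewrite big1 // => i _; rewrite mem_set //; move: wB; rewrite inE => /(_ i); exact.
  have [i nB] : exists i, ~ B i (y i w).
    apply: contrapT => H; move/negP: nwB; apply; rewrite inE => i _ /=.
    by apply: contrapT => nB; apply: H; exists i.
  by rewrite (bigD1 i) //= memNset // mul0r.
pose i0 := Ordinal kn.
pose h w := \prod_(i | i != i0) factor k.+1 B w i.
have neq_lt i : i != i0 -> (i < k.+1)%N = (i < k)%N.
  by move=> ii0; rewrite ltnS leq_eqVlt; case: eqP => // ik; case/eqP: ii0; exact: val_inj.
have hE B' w : (forall i, i != i0 -> B' i = B i) -> \prod_(i | i != i0) factor k B' w i = h w.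
  by move=> BB; apply: eq_bigr => i ii0; rewrite /factor neq_lt // BB.
have cE B' : (forall i, i != i0 -> B' i = B i) ->
    \prod_(i | i != i0) factor_int k B' i = \prod_(i | i != i0) factor_int k.+1 B i.
  by move=> BB; apply: eq_bigr => i ii0; rewrite /factor_int neq_lt // BB.
have H B' : measurable B' -> (\int[P]_w (h w * \1_B' (y i0 w))%:E =
    (\prod_(i | i != i0) factor_int k.+1 B i)%:E * P (y i0 @^-1` B'))%E.
  move=> mB'; pose Bi i := if i == i0 then B' else B i.
  have BiE i : i != i0 -> Bi i = B i by rewrite /Bi => /negbTE ->.
  have Bi0 : Bi i0 = B' by rewrite /Bi eqxx.
  have mBi i : measurable (Bi i) by rewrite /Bi; case: eqP.
  have := IHk Bi (ltnW kn) mBi.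
  rewrite [in RHS](bigD1 i0) //= cE // {1}/factor_int /= ltnn Bi0 EFinM muleC.
  rewrite fineK ?fin_num_measure //; last exact: measurable_preimage_setT.
  move=> <-; apply: eq_integral => w _; congr EFin.
  by rewrite (bigD1 i0) //= hE // {1}/factor /= ltnn Bi0 mulrC.
transitivity (\int[P]_w (h w * g (y i0 w))%:E)%E.
  apply: eq_integral => w _; congr EFin.
  have fi0 : factor k.+1 B w i0 = g (y i0 w) by rewrite /factor /= ltnSn.
  by rewrite (bigD1 i0) //= fi0 mulrC.
rewrite (integral_factor (my i0) _ _ _ mg g0 H).
- rewrite gm -EFinM [in RHS](bigD1 i0) //= mulrC; congr (_ * _)%:E.
  by rewrite /factor_int ltnSn.
- rewrite /h; under eq_fun do rewrite big_mkcond.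
  apply: measurable_prod => i _; case: (i != i0) => //; exact: measurable_factor.
- by move=> w; apply: prodr_ge0.
- by apply: prodr_ge0.
Qed.

Lemma iid_integral_prod : (\int[P]_w (\prod_i g (y i w))%:E = (\prod_i m i)%:E)%E.
Proof.
have := @iid_partial_product n (fun=> setT) (leqnn n) (fun=> measurableT).
have -> : \prod_i factor_int n (fun=> setT) i = \prod_i m i.
  by apply: eq_bigr => i _; rewrite /factor_int ltn_ord.
move=> <-; apply: eq_integral => w _; congr EFin; apply: eq_bigr => i _.
by rewrite /factor ltn_ord.
Qed.

End iid_product.

Section expR_bounds.
Context {R : realType}.

(** For [x >= 0], iterate [e^x <= 1 + x e^x]; for [x < 0], use
    [e^x <= 1 / (1 - x) <= 1 + x + x^2]. *)
Lemma expR_quadratic (x : R) : expR x <= 1 + x + x ^+ 2 * expR `|x|.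
Proof.
have [x0|x0] := leP 0 x.
  rewrite ger0_norm //.
  have h : expR x <= 1 + x * expR x.
    have := expR_ge1Dx (- x); rewrite expRN => h.
    have e0 := expR_gt0 x.
    have : (1 - x) * expR x <= 1 by rewrite -ler_pdivlMr // mul1r.
    lra.
  have : x * expR x <= x * (1 + x * expR x) by rewrite ler_wpM2l.
  rewrite expr2; lra.
rewrite ltr0_norm //.
have z0 : 0 < 1 - x by lra.
have h1 : expR x <= (1 - x)^-1.
  rewrite -[x]opprK expRN lef_pV2 ?posrE ?expR_gt0 ?opprK //.
  exact: expR_ge1Dx.
have h2 : (1 - x)^-1 <= 1 + x + x ^+ 2.
  rewrite -(ler_pM2r z0) mulVf ?gt_eqF //.
  have : 0 <= - x ^+ 3 by rewrite exprS -mulNr mulr_ge0 ?sqr_ge0 //; lra.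
  rewrite !exprS expr0; lra.
have h3 : 1 <= expR (- x) by have := expR_ge1Dx (- x); lra.
have h4 : x ^+ 2 <= x ^+ 2 * expR (- x) by rewrite ler_peMr ?sqr_ge0.
lra.
Qed.

(** The exponent [l] is split in halves. One half dominates [e^|th u|], the other absorbs the square
    through [z^2 / 2 <= e^z] at [z = l |u| / 2], whence [8 / l^2]. Finally [|ab|] is at most the
    larger of the two squares. *)
Lemma expR_product_le (l th a b : R) : 0 < l -> `|th| <= l / 2 ->
  expR (th * (a * b)) <= 1 + th * (a * b) +
    th ^+ 2 * (8 / l ^+ 2) * (expR (l * a ^+ 2) + expR (l * b ^+ 2)).
Proof.
move=> l0 thl; set u := a * b; set v := expR _ + expR _.
apply: le_trans (expR_quadratic _) _; rewrite lerD2l exprMn.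
rewrite -[leLHS]mulrA -[leRHS]mulrA ler_wpM2l ?sqr_ge0 //.
have ab : `|u| <= Num.max (a ^+ 2) (b ^+ 2).
  rewrite /u normrM -(real_normK (num_real a)) -(real_normK (num_real b)).
  have [ab|ba] := leP `|a| `|b|.
    have h : `|a| * `|b| <= `|b| ^+ 2 by rewrite expr2 ler_wpM2r.
    by rewrite le_max h orbT.
  have h : `|a| * `|b| <= `|a| ^+ 2 by rewrite expr2 ler_wpM2l // ltW.
  by rewrite le_max h.
have ev : expR (l * `|u|) <= v.
  have [/max_idPr E|/ltW/max_idPl E] := leP (a ^+ 2) (b ^+ 2).
    rewrite E in ab; apply: (@le_trans _ _ (expR (l * b ^+ 2))).
      by rewrite ler_expR ler_wpM2l // ltW.
    by rewrite lerDr expR_ge0.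
  rewrite E in ab; apply: (@le_trans _ _ (expR (l * a ^+ 2))).
    by rewrite ler_expR ler_wpM2l // ltW.
  by rewrite lerDl expR_ge0.
have h1 : expR `|th * u| <= expR (l / 2 * `|u|) by rewrite ler_expR normrM ler_wpM2r.
have h2 : u ^+ 2 <= 8 / l ^+ 2 * expR (l / 2 * `|u|).
  have z0 : 0 <= l / 2 * `|u| by rewrite mulr_ge0 // divr_ge0 // ltW.
  have := expR_ge1Dxn 1 z0; rewrite -(real_normK (num_real u)) => h.
  rewrite -ler_pdivrMl ?divr_gt0 ?exprn_gt0 //; apply: le_trans h.
  rewrite !factS fact0 muln1 exprMn invf_div.
  apply: (@le_trans _ _ ((l / 2) ^+ 2 * `|u| ^+ 2 / 2)); last by rewrite lerDr.
  by rewrite le_eqVlt; apply/orP; left; apply/eqP; field.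
apply: (@le_trans _ _ (u ^+ 2 * expR (l / 2 * `|u|))); first by rewrite ler_wpM2l ?sqr_ge0.
apply: (@le_trans _ _ (8 / l ^+ 2 * expR (l / 2 * `|u|) * expR (l / 2 * `|u|))).
  by rewrite ler_wpM2r ?expR_ge0.
rewrite -[leLHS]mulrA ler_wpM2l ?divr_ge0 ?exprn_ge0 ?(ltW l0) // -expRD.
by rewrite -mulrDl -splitr.
Qed.

Lemma product_le_expR (l a b : R) : 0 < l ->
  `|a * b| <= l^-1 * (expR (l * a ^+ 2) + expR (l * b ^+ 2)).
Proof.
move=> l0; rewrite ler_pdivlMl //.
have h : 2 * `|a * b| <= a ^+ 2 + b ^+ 2.
  rewrite normrM -(real_normK (num_real a)) -(real_normK (num_real b)).
  have := sqr_ge0 (`|a| - `|b|); rewrite sqrrB -[_ *+ 2]mulr_natl; lra.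
have ha := expR_ge1Dx (l * a ^+ 2); have hb := expR_ge1Dx (l * b ^+ 2).
have : l * (2 * `|a * b|) <= l * (a ^+ 2 + b ^+ 2) by rewrite ler_wpM2l // ltW.
have : 0 <= l * `|a * b| by rewrite mulr_ge0 // ltW.
lra.
Qed.

End expR_bounds.

(** * Chernoff bound for the entries of the sample covariance *)

Section sample_tail.
Context {R : realType} {d : measure_display} {T : measurableType d}.
Context {P : probability T R} {p n : nat}.
Variables (y : 'I_n -> {RV P >-> p.-tuple R}) (Sg : 'M[R]_p) (l Bd : R).
Hypotheses (y_iid : iid y) (y_mean : mean_zero y) (y_cov : has_covariance y Sg).
Hypotheses (l_gt0 : 0 < l).
Hypothesis y_subgauss : forall (i : 'I_n) (j : 'I_p),
  (\int[distribution P (entry_sq (y i) j)]_(t in `[0%R, +oo[) (expR (l * t))%:E <= Bd%:E)%E.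

Let mentry i j : measurable_fun setT (entry (y i) j) := measurable_entry (y i) j.

Lemma integral_exp_entry i j : (\int[P]_w (expR (l * entry (y i) j w ^+ 2))%:E <= Bd%:E)%E.
Proof.
apply: le_trans (y_subgauss i j); rewrite ge0_integral_pushforward //.
- rewrite (_ : _ @^-1` _ = setT) //; apply/seteqP; split => // w _ /=.
  by rewrite in_itv /= andbT sqr_ge0.
- apply: measurable_funTS; apply/measurable_EFinP; apply: measurableT_comp => //.
Qed.

Let mexp i j : measurable_fun setT (fun w => expR (l * entry (y i) j w ^+ 2)).
Proof.
apply: measurableT_comp => //; apply: measurable_funM; first exact: measurable_cst.
exact: measurable_funX.
Qed.

Let mprod i j k : measurable_fun setT (fun w => entry (y i) j w * entry (y i) k w).
Proof. exact: measurable_funM. Qed.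

Let integrable_exp i j : P.-integrable setT (fun w => (expR (l * entry (y i) j w ^+ 2))%:E).
Proof.
apply/integrableP; split; first exact/measurable_EFinP.
under eq_integral do rewrite gee0_abs ?lee_fin ?expR_ge0 //.
by apply: le_lt_trans (integral_exp_entry i j) _; rewrite ltry.
Qed.

Let integrable_prod i j k : P.-integrable setT (fun w => (entry (y i) j w * entry (y i) k w)%:E).
Proof.
apply: (le_integrable measurableT (g := fun w => (l^-1%:E *
   ((expR (l * entry (y i) j w ^+ 2))%:E + (expR (l * entry (y i) k w ^+ 2))%:E))%E)).
- exact/measurable_EFinP.
- move=> w _; rewrite -EFinD -EFinM !abse_EFin lee_fin.
  apply: le_trans (product_le_expR _ _ l_gt0) _; exact: ler_norm.
- by apply: integrableZl => //; apply: integrableD.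
Qed.

Lemma integral_entry_prod i j k :
  (\int[P]_w (entry (y i) j w * entry (y i) k w)%:E = (Sg j k)%:E)%E.
Proof.
have := y_cov i j k; rewrite unlock !y_mean /= => <-.
rewrite unlock; apply: eq_integral => w _; congr EFin.
by rewrite /= !fctE /= !subr0.
Qed.

Variable C : R.
Hypotheses (C_gt0 : 0 < C) (BdC : 16 * Bd / l ^+ 2 <= C).

(** The quadratic coefficient [16 Bd / l^2] comes from [8 / l^2] and two exponential moments, each
    at most [Bd]. *)
Lemma mgf_entry_prod i j k (th : R) : `|th| <= l / 2 ->
  (\int[P]_w (expR (th * (entry (y i) j w * entry (y i) k w)))%:E
    <= (1 + th * Sg j k + th ^+ 2 * C)%:E)%E.
Proof.
move=> thl; pose K := th ^+ 2 * (8 / l ^+ 2).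
have K0 : 0 <= K by rewrite mulr_ge0 ?sqr_ge0 // divr_ge0 // exprn_ge0 // ltW.
have i1 : P.-integrable setT (fun w => (1 + th%:E * (entry (y i) j w * entry (y i) k w)%:E)%E).
  apply: integrableD => //; last by apply: integrableZl.
  by apply: finite_measure_integrable_cst.
have i2 : P.-integrable setT (fun w => (K%:E *
    ((expR (l * entry (y i) j w ^+ 2))%:E + (expR (l * entry (y i) k w ^+ 2))%:E))%E).
  by apply: integrableZl => //; apply: integrableD.
apply: (@le_trans _ _ (\int[P]_w (((1 + th%:E * (entry (y i) j w * entry (y i) k w)%:E) +
  K%:E * ((expR (l * entry (y i) j w ^+ 2))%:E + (expR (l * entry (y i) k w ^+ 2))%:E)))))%E.
  apply: ge0_le_integral => //.
  - by apply/measurable_EFinP; do 2! apply: measurableT_comp => //.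
  - exact: (measurable_int P (integrableD measurableT i1 i2)).
  - by move=> w _; rewrite -!(EFinM, EFinD) lee_fin; exact: expR_product_le.
rewrite integralD // integralD //; last 2 first.
  by apply: finite_measure_integrable_cst.
  by apply: integrableZl.
rewrite integral_cst // mul1e integralZl // integral_entry_prod.
rewrite [X in (X + _ + _)%E](probability_setT P).
rewrite integralZl //; last by apply: integrableD.
rewrite integralD //.
rewrite -EFinM EFinD EFinD; apply: leeD => //.
apply: (@le_trans _ _ (K%:E * (Bd%:E + Bd%:E))%E).
  by apply: lee_wpmul2l; [rewrite lee_fin | apply: leeD; exact: integral_exp_entry].
rewrite -EFinD -EFinM lee_fin.
have -> : K * (Bd + Bd) = th ^+ 2 * (16 * Bd / l ^+ 2) by rewrite /K; field; rewrite gt_eqF.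
by rewrite ler_wpM2l ?sqr_ge0.
Qed.

(** One observation's factor in the Chernoff bound; the sign [s] selects the upper or the lower
    tail. *)
Let tail_fun (t th s : R) (j k : 'I_p) (x : p.-tuple R) : R :=
  expR (th * (s * (tnth x j * tnth x k - Sg j k) - t)).

Let measurable_tail_fun t th s j k : measurable_fun setT (tail_fun t th s j k).
Proof.
apply: measurableT_comp => //; apply: measurable_funM => //; apply: measurable_funB => //.
apply: measurable_funM => //; apply: measurable_funB => //.
by apply: measurable_funM; exact: (@measurable_tnth _ (measurableTypeR R)).
Qed.

(** [th = t / (2 C)] minimizes [th^2 C - th t], with value [- t^2 / (4 C)]; the restriction
    [t <= l C] keeps it at most [l / 2]. *)
Lemma integral_tail_fun i j k (s t : R) : `|s| = 1 -> 0 < t -> t <= l * C ->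
  (\int[P]_w (tail_fun t (t / (2 * C)) s j k (y i w))%:E
    <= (expR (- (t ^+ 2 / (4 * C))))%:E)%E.
Proof.
move=> s1 t0 tl; set th := t / (2 * C).
have th0 : 0 <= th by rewrite ltW // divr_gt0 // mulr_gt0.
have thl : `|th * s| <= l / 2.
  rewrite normrM s1 mulr1 ger0_norm // /th ler_pdivrMr ?mulr_gt0 //.
  by have -> : l / 2 * (2 * C) = l * C by field.
pose c := expR (- (th * (s * Sg j k + t))).
rewrite [leLHS](_ : _ =
    \int[P]_w (c%:E * (expR (th * s * (entry (y i) j w * entry (y i) k w)))%:E))%E; last first.
  apply: eq_integral => w _; rewrite -EFinM /c -expRD /tail_fun /entry; congr (expR _)%:E.
  by ring.
rewrite ge0_integralZl_EFin ?expR_ge0 //; last first.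
  by apply/measurable_EFinP; do 2! apply: measurableT_comp => //.
apply: (@le_trans _ _ (c%:E * (1 + th * s * Sg j k + (th * s) ^+ 2 * C)%:E)%E).
  by apply: lee_wpmul2l; [rewrite lee_fin expR_ge0 | exact: mgf_entry_prod].
rewrite -EFinM lee_fin.
apply: (@le_trans _ _ (c * expR (th * s * Sg j k + (th * s) ^+ 2 * C))).
  by rewrite ler_wpM2l ?expR_ge0 // -addrA; exact: expR_ge1Dx.
have s2 : s ^+ 2 = 1 by rewrite -(real_normK (num_real s)) s1 expr1n.
rewrite /c -expRD ler_expR exprMn s2 mulr1 le_eqVlt; apply/orP; left; apply/eqP.
by rewrite /th; field; rewrite gt_eqF.
Qed.

Definition good_event (t : R) : set T :=
  [set w | forall j k, `|sample_cov y w j k - Sg j k| <= t].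

Lemma measurable_good_event t : measurable (good_event t).
Proof.
have -> : good_event t = \bigcap_(jk in [set: 'I_p * 'I_p])
    [set w | `|sample_cov y w jk.1 jk.2 - Sg jk.1 jk.2| <= t].
  apply/seteqP; split => [w wE [j k] _ | w wE j k]; first exact: wE.
  exact: (wE (j, k)).
apply: fin_bigcap_measurable => // -[j k] _ /=.
pose f w := `|sample_cov y w j k - Sg j k|.
have mf : measurable_fun setT f.
  apply: measurableT_comp => //; apply: measurable_funB => //.
  rewrite /sample_cov; under eq_fun do rewrite mxE.
  apply: measurable_funM => //; apply: measurable_sum => i; exact: mprod.
have -> : [set w | f w <= t] = setT `&` f @^-1` `]-oo, t].
  by apply/seteqP; split => w /=; rewrite in_itv /=; [split|case].
exact: mf.
Qed.

(** The indicator of the bad event is at most the sum of the Chernoff products over [p^2] index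
    pairs and two signs, since the product for the violated pair is at least 1. *)
Lemma good_event_prob (t : R) : (0 < n)%N -> 0 < t -> t <= l * C ->
  ((1 - 2 * p%:R ^+ 2 * expR (- (n%:R * t ^+ 2 / (4 * C))))%:E <= P (good_event t))%E.
Proof.
move=> n0 t0 tl; set th := t / (2 * C).
have th0 : 0 <= th by rewrite ltW // divr_gt0 // mulr_gt0.
pose F (x : 'I_p * 'I_p * bool) w :=
  (\prod_(i < n) tail_fun t th ((-1) ^+ x.2) x.1.1 x.1.2 (y i w))%:E.
have nR : 0 < n%:R :> R by rewrite ltr0n.
have F0 x w : (0 <= F x w)%E by rewrite lee_fin prodr_ge0 // => i _; exact: expR_ge0.
have mF x : measurable_fun setT (F x).
  apply/measurable_EFinP/measurable_prod => i _.
  exact: (measurableT_comp (measurable_tail_fun _ _ _ _ _) (measurable_funPT (y i))).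
have intF x : (\int[P]_w F x w <= (expR (- (n%:R * t ^+ 2 / (4 * C))))%:E)%E.
  have s1 : `|(-1) ^+ x.2 : R| = 1 by rewrite normrX normrN1 expr1n.
  pose m i := fine (\int[P]_w (tail_fun t th ((-1) ^+ x.2) x.1.1 x.1.2 (y i w))%:E)%E.
  have le_m i := integral_tail_fun i x.1.1 x.1.2 s1 t0 tl.
  have mE i : (\int[P]_w (tail_fun t th ((-1) ^+ x.2) x.1.1 x.1.2 (y i w))%:E = (m i)%:E)%E.
    rewrite /m fineK // ge0_fin_numE; first exact: le_lt_trans (le_m i) (ltry _).
    by apply: integral_ge0 => w _; rewrite lee_fin expR_ge0.
  rewrite /F (iid_integral_prod y_iid (measurable_tail_fun _ _ _ _ _) _ mE); last first.
    by move=> z; exact: expR_ge0.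
  rewrite lee_fin; apply: (@le_trans _ _ (\prod_(i < n) expR (- (t ^+ 2 / (4 * C))))).
    apply: ler_prod => i _; rewrite -!lee_fin -mE le_m andbT.
    by apply: integral_ge0 => w _; rewrite lee_fin expR_ge0.
  rewrite prodr_const card_ord -expRM_natl mulrN -mulrA; exact: lexx.
have mG := measurable_good_event t.
have bad : (P (~` good_event t) <= (2 * p%:R ^+ 2 * expR (- (n%:R * t ^+ 2 / (4 * C))))%:E)%E.
  rewrite -[X in P X]setIT -integral_indic //; last exact: measurableC.
  apply: (@le_trans _ _ (\int[P]_w \sum_(x <- index_enum _) F x w)%E).
    apply: ge0_le_integral => //.
    - exact/measurable_EFinP/measurable_indic/measurableC.
    - by apply: emeasurable_sum.
    - move=> w _; rewrite indicE; have [wB|_] := boolP (w \in _); last first.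
        by rewrite sume_ge0.
      have [j [k jk]] : exists j k, t < `|sample_cov y w j k - Sg j k|.
        move: wB; rewrite inE /= => /existsNP[j /existsNP[k /negP]]; rewrite -ltNge.
        by exists j, k.
      pose s : bool := sample_cov y w j k - Sg j k < 0.
      have sE : t < (-1) ^+ s * (sample_cov y w j k - Sg j k).
        rewrite /s; have [h|h] := ltP (sample_cov y w j k - Sg j k) 0.
          by rewrite expr1 mulN1r -(ltr0_norm h).
        by rewrite mul1r -(ger0_norm h).
      apply: (@le_trans _ _ (F (j, k, s) w)); last first.
        by rewrite (bigD1_seq (j, k, s)) ?mem_index_enum ?index_enum_uniq //= leeDl // sume_ge0.
      rewrite lee_fin -expR_sum -{1}expR0 ler_expR -mulr_sumr mulr_ge0 //.
      rewrite sumrB sumr_const card_ord -mulr_sumr sumrB sumr_const card_ord /=.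
      have -> : \sum_(i < n) tnth (y i w) j * tnth (y i w) k = n%:R * sample_cov y w j k.
        by rewrite mxE mulrA mulfV ?mul1r // gt_eqF.
      rewrite -[Sg j k *+ n]mulr_natl -[t *+ n]mulr_natl mulrBr.
      rewrite (_ : _ - _ = n%:R * ((-1) ^+ s * (sample_cov y w j k - Sg j k) - t)).
        by rewrite mulr_ge0 ?(ltW nR) // subr_ge0 ltW.
      by move: ((-1) ^+ s) (sample_cov _ _ _ _) => a b; ring.
  rewrite ge0_integral_sum //.
  apply: (@le_trans _ _ (\sum_(x <- index_enum ('I_p * 'I_p * bool)%type)
      (expR (- (n%:R * t ^+ 2 / (4 * C))))%:E)%E); first by apply: lee_sum => x _.
  rewrite sumEFin lee_fin sumr_const /= card_prod card_prod card_ord card_bool.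
  by rewrite -[leLHS]mulr_natl !natrM le_eqVlt; apply/orP; left; apply/eqP; ring.
have PC := probability_setC P mG.
have fP : P (good_event t) \is a fin_num by exact: fin_num_measure.
rewrite PC -(fineK fP) -EFinB lee_fin in bad.
by rewrite -(fineK fP) lee_fin; move: bad; rewrite lerBlDr lerBlDl addrC.
Qed.

End sample_tail.

(** * Asymptotics *)

Section rates.
Context {R : realType}.

Lemma eqO_near (f g : nat -> R) : f =O_\oo g ->
  exists2 K : R, 0 < K & \forall n \near \oo, `|f n| <= K * `|g n|.
Proof. by move=> /eqO_exP[K K0 H]; exists K. Qed.

Variables (p : nat -> nat) (Om0 : forall n, 'M[R]_(p n)).
Hypothesis p2 : forall n, (2 <= p n)%N.
Local Notation logp n := (ln ((p n)%:R : R)).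
Local Notation s n := (s1 (Om0 n)).

Lemma logp_gt0 n : 0 < logp n.
Proof. by rewrite ln_gt0 // ltr1n p2. Qed.

Lemma rate_ge0 n : 0 <= rate Om0 n.
Proof. by rewrite !mulr_ge0 ?invr_ge0 // ltW // logp_gt0. Qed.

Lemma rate_gt0 n : (0 < n)%N -> 0 < rate Om0 n.
Proof.
move=> n0; rewrite /rate divr_gt0 ?ltr0n // mulr_gt0 ?logp_gt0 // ltr0n.
by rewrite addn_gt0 (leq_trans _ (p2 n)).
Qed.

Lemma s1_le n : (p n + s n <= 2 * p n ^ 2)%N.
Proof.
have h : (#|S1 (Om0 n)| <= p n ^ 2)%N.
  by apply: leq_trans (max_card _) _; rewrite card_prod card_ord mulnn.
have h2 : (p n <= p n ^ 2)%N by rewrite -mulnn leq_pmulr // (leq_trans _ (p2 n)).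
by rewrite mul2n -addnn leq_add // (leq_trans (leq_subr _ _)).
Qed.

(** If [log p >= L], the surplus factor [(log p)^(k-1)] in the growth condition pushes the rate
    below [dl]; this is where [k > 1] enters and what defines [L]. Otherwise [p <= e^L], and the
    rate is a constant over [n]. *)
Lemma rate_near0 : dimension_growth Om0 ->
  forall dl : R, 0 < dl -> \forall n \near \oo, rate Om0 n < dl.
Proof.
move=> [k k1 /eqO_near[K K0 HK]] dl dl0.
have k10 : 0 < k - 1 by rewrite subr_gt0.
pose L := (2 * K / dl + 1) `^ (k - 1)^-1.
have b0 : 0 < 2 * K / dl + 1 by rewrite addr_gt0 // divr_gt0 // mulr_gt0.
have L0 : 0 < L by rewrite powR_gt0.
have LE : L `^ (k - 1) = 2 * K / dl + 1 by rewrite -powRrM mulVf ?gt_eqF // powRr1 // ltW.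
near=> n.
have n0 : 0 < n%:R :> R by rewrite ltr0n; near: n; exact: nbhs_infty_gt.
have lp := logp_gt0 n.
have [lL|lL] := leP L (logp n).
  have : `|(p n + s n)%:R * logp n `^ k / n%:R| <= K * `|1| by near: n.
  rewrite normr1 mulr1 ger0_norm; last by rewrite !mulr_ge0 ?invr_ge0 // powR_ge0.
  have -> : logp n `^ k = logp n `^ (k - 1) * logp n.
    by rewrite -{3}[logp n]powRr1 ?(ltW lp) // -powRD ?subrK // (gt_eqF lp) implybT.
  move=> h; have h2 : L `^ (k - 1) <= logp n `^ (k - 1).
    by rewrite ge0_ler_powR ?nnegrE ?(ltW k10) ?(ltW L0) ?(ltW lp).
  rewrite LE in h2.
  have h3 : (2 * K / dl + 1) * rate Om0 n <= K.
    apply: le_trans h.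
    have -> : (p n + s n)%:R * (logp n `^ (k - 1) * logp n) / n%:R =
       logp n `^ (k - 1) * rate Om0 n by rewrite /rate; ring.
    by rewrite ler_wpM2r // rate_ge0.
  rewrite ltNge; apply/negP => dr.
  have : (2 * K / dl + 1) * dl <= K by apply: le_trans h3; rewrite ler_wpM2l // ltW.
  rewrite mulrDl mulfVK ?gt_eqF // mul1r; lra.
have pe : (p n)%:R <= expR L.
  by rewrite -[leLHS]lnK ?posrE ?ltr0n ?(leq_trans _ (p2 n)) // ler_expR ltW.
have psE : (p n + s n)%:R <= 2 * expR L ^+ 2.
  apply: (@le_trans _ _ (2 * (p n)%:R ^+ 2)); first by rewrite -natrX -natrM ler_nat s1_le.
  by rewrite ler_wpM2l // lerXn2r // nnegrE // expR_ge0.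
rewrite /rate ltr_pdivrMr //.
apply: (@le_lt_trans _ _ (2 * expR L ^+ 2 * L)).
  by apply: ler_pM => //; rewrite ltW.
rewrite -ltr_pdivrMl //; near: n; exact: nbhs_infty_gtr.
Unshelve. all: by end_near. Qed.

End rates.

Section core.
Context {R : realType} {d : nat -> measure_display} {T : forall n, measurableType (d n)}.
Context {P : forall n, probability (T n) R} {p : nat -> nat}.
Variables (Sigma0 : forall n, 'M[R]_(p n)) (tau1 tau2 : R).
Variable y : forall n, 'I_n -> {RV (P n) >-> (p n).-tuple R}.
Local Notation Om0 := (fun n => invmx (Sigma0 n)).
Local Notation logp n := (ln ((p n)%:R : R)).
Local Notation s n := (s1 (Om0 n)).
Hypothesis p2 : forall n, (2 <= p n)%N.
Hypothesis sample : forall n,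
  [/\ iid (@y n), mean_zero (@y n) & has_covariance (@y n) (Sigma0 n)].
Hypothesis subgauss : sub_gaussian y.
Hypothesis tau1_gt0 : 0 < tau1.
Hypothesis spectrum : forall n, tau1 < lambda_min (Sigma0 n) /\ lambda_max (Sigma0 n) < tau2.
Hypothesis growth : dimension_growth Om0.

Definition noise_level n : R := Num.sqrt (logp n / n%:R).
Local Notation eps := noise_level.

Lemma noise_level_ge0 n : 0 <= eps n. Proof. exact: sqrtr_ge0. Qed.

Lemma noise_level_gt0 n : (0 < n)%N -> 0 < eps n.
Proof. by move=> n0; rewrite sqrtr_gt0 divr_gt0 ?ltr0n // logp_gt0. Qed.

Lemma noise_level_sqr n : eps n ^+ 2 = logp n / n%:R.
Proof. by rewrite sqr_sqrtr // divr_ge0 // ltW // logp_gt0. Qed.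

Lemma sqrt_rate n : Num.sqrt (rate Om0 n) = Num.sqrt (p n + s n)%:R * eps n.
Proof. by rewrite -sqrtrM // /rate mulrA. Qed.

Lemma noise_level_card n (k : nat) : (k <= p n + s n)%N ->
  eps n * Num.sqrt k%:R <= Num.sqrt (rate Om0 n).
Proof.
by move=> kps; rewrite sqrt_rate mulrC ler_wpM2r ?noise_level_ge0 // ler_wsqrtr // ler_nat.
Qed.

Lemma card_S1_le n : (#|S1 (Om0 n)| <= p n + s n)%N.
Proof. by rewrite /s1 -leq_subLR. Qed.

(** Symmetry of [Sigma0 n] is read off the covariance of an observation, hence [0 < n]. *)
Lemma Sigma0_qbounded n : (0 < n)%N -> qbounded tau1 tau2 (Sigma0 n).
Proof.
move=> n0; have [_ _ cov] := sample n; have [l1 l2] := spectrum n.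
apply: lambda_qbounded => //; apply/matrixP => j k; rewrite mxE.
have i : 'I_n := Ordinal n0.
by apply: EFin_inj; rewrite -!(cov i) covarianceC.
Qed.

Lemma sample_cov_sym n w : (sample_cov (@y n) w)^T = sample_cov (@y n) w.
Proof.
apply/matrixP => j k; rewrite !mxE; congr (_ * _).
by apply: eq_bigr => i _; rewrite mulrC.
Qed.

Lemma good_event_near : exists2 C : R, 0 < C & forall q : nat,
  \forall n \near \oo,
    ((1 - 2 / (p n)%:R ^+ q)%:E <=
     P n (good_event (@y n) (Sigma0 n) (2 * Num.sqrt (C * q.+2%:R) * eps n)))%E.
Proof.
have [l0 l00 H] := subgauss; pose l := l0 / 2.
have l_gt0 : 0 < l by rewrite divr_gt0.
have [|B HB] := H l.
  by rewrite ger0_norm ?(ltW l_gt0) // l_gt0 ltr_pdivrMr // ltr_pMr // ltr1n.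
pose C := Num.max 1 (16 * B / l ^+ 2).
have C0 : 0 < C by rewrite lt_max ltr01.
have BC : 16 * B / l ^+ 2 <= C by rewrite le_max lexx orbT.
exists C => // q; set M := 2 * Num.sqrt _.
have M0 : 0 < M by rewrite mulr_gt0 // sqrtr_gt0 mulr_gt0.
near=> n.
have n0 : (0 < n)%N by near: n; exact: nbhs_infty_gt.
have [i1 i2 i3] := sample n.
have t0 : 0 < M * eps n by rewrite mulr_gt0 // noise_level_gt0.
have tl : M * eps n <= l * C.
  have rl : rate Om0 n < (l * C / M) ^+ 2.
    near: n; apply: rate_near0 => //; rewrite exprn_gt0 // divr_gt0 // mulr_gt0 //.
  have lC0 : 0 <= l * C / M by rewrite divr_ge0 ?mulr_ge0 // ltW.
  rewrite mulrC -ler_pdivlMr // -[leRHS]ger0_norm // -sqrtr_sqr.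
  apply: le_trans (ler_wsqrtr (ltW rl)).
  have := @noise_level_card n 1; rewrite sqrtr1 mulr1; apply.
  by rewrite addn_gt0 (leq_trans _ (p2 n)).
apply: le_trans (good_event_prob i1 i2 i3 l_gt0 (HB n) C0 BC n0 t0 tl).
rewrite lee_fin lerD2l lerN2.
have -> : n%:R * (M * eps n) ^+ 2 / (4 * C) = q.+2%:R * logp n.
  rewrite /M !exprMn noise_level_sqr sqr_sqrtr; last by rewrite mulr_ge0 // ltW.
  by field; rewrite !gt_eqF // ltr0n.
have p0 : 0 < (p n)%:R :> R by rewrite ltr0n (leq_trans _ (p2 n)).
rewrite expRN expRM_natl lnK ?posrE // -mulrA ler_wpM2l //.
rewrite (_ : _ ^+ q.+2 = (p n)%:R ^+ q * (p n)%:R ^+ 2); last by rewrite -exprD addn2.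
rewrite le_eqVlt; apply/orP; left; apply/eqP; move: (gt_eqF p0) (gt_eqF (exprn_gt0 q p0)).
by move: ((p n)%:R ^+ q) => z h1 h2; field; rewrite h1 h2.
Unshelve. all: by end_near. Qed.

(** What both kinds of penalty provide on the support: a slope whose total cost is of the order of
    the radius, and a curvature loss [tau1^2 / 32], a quarter of the gain of the log-determinant.
    [Mr] is arbitrary because the radius is chosen only after [Ca] is known. *)
Definition support_bound (pen : R -> R -> R) (lam a : nat -> R) (Ca : R) : Prop :=
  forall Mr, \forall n \near \oo,
    [/\ 0 <= a n, a n * Num.sqrt (s n)%:R <= Ca * Num.sqrt (rate Om0 n) &
      forall i j (x : R), Om0 n i j != 0 -> i != j ->
        `|x| <= 2 * (Mr * Num.sqrt (rate Om0 n)) ->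
        - (a n * `|x| + tau1 ^+ 2 / 32 * x ^+ 2) <=
        pen (lam n) `|Om0 n i j + x| - pen (lam n) `|Om0 n i j|].

Lemma radius_near (Mr dl : R) : 0 < dl ->
  \forall n \near \oo, Mr * Num.sqrt (rate Om0 n) <= dl.
Proof.
move=> dl0; have [M0|M0] := leP Mr 0.
  by near=> n; apply: (le_trans _ (ltW dl0)); rewrite mulr_le0_ge0.
near=> n.
have : rate Om0 n < (dl / Mr) ^+ 2.
  by near: n; apply: rate_near0 => //; rewrite exprn_gt0 // divr_gt0.
move=> h; rewrite -ler_pdivlMl // mulrC -[leRHS]ger0_norm ?divr_ge0 ?(ltW dl0) ?(ltW M0) //.
by rewrite -sqrtr_sqr ler_wsqrtr // ltW.
Unshelve. all: by end_near. Qed.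

Lemma radius_small (Mr : R) : \forall n \near \oo,
  tau2 ^+ 2 * (4 * (Mr * Num.sqrt (rate Om0 n)) ^+ 2) <= 4^-1.
Proof.
near=> n; have h : (4 * (`|tau2 * Mr| + 1)) * Num.sqrt (rate Om0 n) <= 1.
  by near: n; exact: radius_near.
set q := Num.sqrt _ in h *; have q0 : 0 <= q by exact: sqrtr_ge0.
have -> : tau2 ^+ 2 * (4 * (Mr * q) ^+ 2) = 4 * `|tau2 * Mr * q| ^+ 2.
  by rewrite real_normK ?num_real //; ring.
rewrite normrM (ger0_norm q0); have z0 := normr_ge0 (tau2 * Mr).
have : 4 * (`|tau2 * Mr| * q) <= 1 by lra.
have : 0 <= `|tau2 * Mr| * q by rewrite mulr_ge0.
by move: (`|tau2 * Mr| * q) => z; nra.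
Unshelve. all: by end_near. Qed.

Lemma bounded_noise_near (pen : R -> R -> R) (lam a : nat -> R) (Ca M Bc : R) :
  penalty pen lam -> (forall n, pen (lam n) 0 = 0) -> 0 <= Ca -> 0 <= M -> 0 <= Bc ->
  support_bound pen lam a Ca ->
  exists2 Mr : R, 0 < Mr & \forall n \near \oo, forall w,
    good_event (@y n) (Sigma0 n) (M * eps n) w ->
    (forall D : 'M[R]_(p n),
      \sum_(ij : 'I_(p n) * 'I_(p n) | Om0 n ij.1 ij.2 == 0)
        (M * eps n * `|D ij.1 ij.2| - pen (lam n) `|D ij.1 ij.2|)
      <= Bc * Num.sqrt (rate Om0 n) * Num.sqrt (fro2 D)) ->
    exists X, local_minimizer (q1 (pen (lam n)) (sample_cov (@y n) w)) X /\
      fro2 (X - Om0 n) <= Mr * rate Om0 n.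
Proof.
move=> pen_ok pen0 Ca0 M0 B0 supp.
(* With this [Mr] the net gain [(tau1^2 / 8 - tau1^2 / 32) Mr] is [3/2 (M + Ca + Bc + 1)], above the
   total loss [M + Ca + Bc]. *)
pose Mr := 16 * (M + Ca + Bc + 1) / tau1 ^+ 2.
have t12 : 0 < tau1 ^+ 2 by rewrite exprn_gt0.
have Mr0 : 0 < Mr by rewrite divr_gt0 // mulr_gt0 //; lra.
exists (Mr ^+ 2); first by rewrite exprn_gt0.
near=> n => w good noise.
have n0 : (0 < n)%N by near: n; exact: nbhs_infty_gt.
have rt0 : 0 < Num.sqrt (rate Om0 n) by rewrite sqrtr_gt0 rate_gt0.
have hr : tau2 ^+ 2 * (4 * (Mr * Num.sqrt (rate Om0 n)) ^+ 2) <= 4^-1.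
  by near: n; exact: radius_small.
have [a0 aCa suppn] : [/\ 0 <= a n, a n * Num.sqrt (s n)%:R <= Ca * Num.sqrt (rate Om0 n) &
      forall i j (x : R), Om0 n i j != 0 -> i != j ->
        `|x| <= 2 * (Mr * Num.sqrt (rate Om0 n)) ->
        - (a n * `|x| + tau1 ^+ 2 / 32 * x ^+ 2) <=
        pen (lam n) `|Om0 n i j + x| - pen (lam n) `|Om0 n i j|].
  by near: n; exact: supp.
have p0 : (0 < p n)%N by rewrite (leq_trans _ (p2 n)).
have r0 : 0 < Mr * Num.sqrt (rate Om0 n) by rewrite mulr_gt0.
have kap0 : 0 <= M * eps n by rewrite mulr_ge0 // noise_level_ge0.
have eta0 : 0 <= tau1 ^+ 2 / 32 by rewrite divr_ge0 // ltW.
have BB0 : 0 <= Bc * Num.sqrt (rate Om0 n) by rewrite mulr_ge0 // ltW.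
have [pc pm] := pen_ok n.
have [] := bounded_noise_local_minimizer p0 tau1_gt0 r0 (Sigma0_qbounded n0) hr kap0 a0
  good pc (pen0 n) eta0 BB0 suppn (fun D _ => noise D).
  have h1 : M * eps n * Num.sqrt #|S1 (Om0 n)|%:R <= M * Num.sqrt (rate Om0 n).
    by rewrite -mulrA ler_wpM2l // noise_level_card // card_S1_le.
  apply: (@le_lt_trans _ _ ((M + Ca + Bc) * Num.sqrt (rate Om0 n))).
    rewrite !mulrDl; lra.
  rewrite mulrA ltr_pM2r // /Mr.
  have -> : (tau1 ^+ 2 / 8 - tau1 ^+ 2 / 32) * (16 * (M + Ca + Bc + 1) / tau1 ^+ 2) =
     3 / 2 * (M + Ca + Bc + 1) by field; rewrite gt_eqF.
  lra.
move=> X [locX rX]; exists X; split => //.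
by apply: (le_trans (ltW rX)); rewrite exprMn sqr_sqrtr // rate_ge0.
Unshelve. all: by end_near. Qed.

End core.

(** * From bounds on good events to a single estimator *)

Section conclusion.
Context {R : realType} {d : nat -> measure_display} {T : forall n, measurableType (d n)}.
Context {P : forall n, probability (T n) R} {p : nat -> nat}.
Variables (Sigma0 : forall n, 'M[R]_(p n)) (tau1 tau2 : R).
Variable y : forall n, 'I_n -> {RV (P n) >-> (p n).-tuple R}.
Local Notation Om0 := (fun n => invmx (Sigma0 n)).
Hypothesis p2 : forall n, (2 <= p n)%N.
Hypothesis sample : forall n,
  [/\ iid (@y n), mean_zero (@y n) & has_covariance (@y n) (Sigma0 n)].
Hypothesis subgauss : sub_gaussian y.
Hypothesis tau1_gt0 : 0 < tau1.
Hypothesis spectrum : forall n, tau1 < lambda_min (Sigma0 n) /\ lambda_max (Sigma0 n) < tau2.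
Hypothesis growth : dimension_growth Om0.
Local Notation eps := (noise_level (R := R) (p := p)).
Local Notation good M n := (good_event (@y n) (Sigma0 n) (M * eps n)).

Definition minimizer_within (f : forall n, T n -> 'M[R]_(p n) -> R) (M : R) n w : Prop :=
  exists X, local_minimizer (f n w) X /\ fro2 (X - Om0 n) <= M * rate Om0 n.

Lemma frobenius_sqr q (A : 'M[R]_q) : frobenius A ^+ 2 = fro2 A.
Proof. by rewrite sqr_sqrtr // fro2_ge0. Qed.

(* Om_hat must not depend on the probability level e, hence this choice of a
   local minimizer whose distance to Om0 is, up to rounding, the smallest. *)
Lemma best_minimizer f n w : exists X0 : 'M[R]_(p n), forall m : nat,
  minimizer_within f m%:R w ->
  local_minimizer (f n w) X0 /\ fro2 (X0 - Om0 n) <= m%:R * rate Om0 n.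
Proof.
have [[m mw]|nw] := pselect (exists m : nat, minimizer_within f m%:R w); last first.
  by exists 0 => m mw; exfalso; apply: nw; exists m.
have ex : exists m, `[< minimizer_within f m%:R w >] by exists m; apply/asboolP.
have [m0 /asboolP[X0 [X0loc X0m]] m0_min] := ex_minnP ex.
exists X0 => k kw; split => //; apply: le_trans X0m _.
by rewrite ler_wpM2r ?rate_ge0 // ler_nat m0_min //; apply/asboolP.
Qed.

Lemma minimizer_conclusion (f : forall n, T n -> 'M[R]_(p n) -> R) :
  (forall e : R, 0 < e -> exists M : R, \forall n \near \oo, exists E : set (T n),
     [/\ measurable E, ((1 - e)%:E <= P n E)%E & forall w, E w -> minimizer_within f M w]) ->
  exists Om_hat : forall n, T n -> 'M[R]_(p n),
    with_prob_tending_to_1 P (fun n w => local_minimizer (f n w) (Om_hat n w)) /\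
    OP P (fun n w => frobenius (Om_hat n w - Om0 n) ^+ 2) (rate Om0).
Proof.
move=> H; pose Om_hat n w := projT1 (cid (best_minimizer f (n := n) w)).
have key M n w : minimizer_within f M w ->
    local_minimizer (f n w) (Om_hat n w) /\
    fro2 (Om_hat n w - Om0 n) <= (Num.trunc M).+1%:R * rate Om0 n.
  move=> [X [Xloc XM]]; apply: (projT2 (cid (best_minimizer f (n := n) w))).
  exists X; split => //; apply: le_trans XM _; rewrite ler_wpM2r ?rate_ge0 //.
  by apply: ltW; exact: truncnS_gt.
exists Om_hat; split => e e0; have [M HM] := H e e0.
  by apply: filterS HM => n [E [mE PE HE]]; exists E; split => // w /HE/key[].
exists (Num.trunc M).+1%:R; first by rewrite ltr0n.
apply: filterS HM => n [E [mE PE HE]]; exists E; split => // w /HE/key[_].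
by rewrite frobenius_sqr ger0_norm // fro2_ge0.
Qed.

Definition objective (pen : R -> R -> R) (lam : nat -> R) n w : 'M[R]_(p n) -> R :=
  q1 (pen (lam n)) (sample_cov (@y n) w).

(** The nonnegative penalty off the support is discarded; the noise there is at most
    [M eps p ||D||], and [eps sqrt p] is below the square root of the rate. The factor [sqrt P0]
    that is left over goes into the constant, for every [M]. *)
Lemma small_dimension (pen : R -> R -> R) (lam a : nat -> R) (Ca M : R) (P0 : nat) :
  penalty pen lam -> (forall n, pen (lam n) 0 = 0) -> 0 <= Ca -> 0 <= M ->
  support_bound Sigma0 tau1 pen lam a Ca ->
  exists Mr : R, \forall n \near \oo, forall w, (p n <= P0)%N ->
    good M n w -> minimizer_within (objective pen lam) Mr w.
Proof.
move=> pen_ok pen0 Ca0 M0 supp.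
have B0 : 0 <= M * Num.sqrt P0%:R by rewrite mulr_ge0 ?sqrtr_ge0.
have [Mr _ HMr] := bounded_noise_near p2 sample tau1_gt0 spectrum growth pen_ok pen0 Ca0 M0 B0 supp.
exists Mr; apply: filterS HMr => n H w pP gw; apply: (H w gw) => D.
have kap0 : 0 <= M * eps n by rewrite mulr_ge0 // sqrtr_ge0.
apply: (@le_trans _ _ (\sum_(ij : 'I_(p n) * 'I_(p n) | Om0 n ij.1 ij.2 == 0)
    M * eps n * `|D ij.1 ij.2|)).
  apply: ler_sum => ij _; rewrite gerBl.
  by rewrite -(pen0 n); apply: (pen_ok n).2; rewrite ?in_itv /= ?lexx ?normr_ge0.
apply: le_trans (sum_support_card kap0 _ _) _; rewrite ler_wpM2r ?sqrtr_ge0 //.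
rewrite -!mulrA ler_wpM2l //.
have h : eps n * Num.sqrt (p n)%:R <= Num.sqrt (rate Om0 n).
  by apply: noise_level_card => //; rewrite leq_addr.
have h2 : Num.sqrt (p n)%:R <= Num.sqrt P0%:R :> R by rewrite ler_wsqrtr // ler_nat.
rewrite -[(p n)%:R]sqr_sqrtr // expr2 mulrA mulrC.
by rewrite ler_pM ?mulr_ge0 ?sqrtr_ge0.
Qed.

(* The noise level at which the deviation has probability at most e depends on
   e, except when p is so large that already 2 / p <= e. *)
Lemma two_regimes (pen : R -> R -> R) (lam a : nat -> R) (C Ca : R) :
  0 < C ->
  (forall q : nat, \forall n \near \oo, ((1 - 2 / (p n)%:R ^+ q)%:E <=
     P n (good (2 * Num.sqrt (C * q.+2%:R)) n))%E) ->
  penalty pen lam -> (forall n, pen (lam n) 0 = 0) -> 0 <= Ca ->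
  support_bound Sigma0 tau1 pen lam a Ca ->
  (exists P0 : nat, exists Mr : R, \forall n \near \oo, forall w, (P0 <= p n)%N ->
    good (2 * Num.sqrt (C * 3%:R)) n w -> minimizer_within (objective pen lam) Mr w) ->
  exists Om_hat : forall n, T n -> 'M[R]_(p n),
    with_prob_tending_to_1 P (fun n w =>
      local_minimizer (q1 (pen (lam n)) (sample_cov (@y n) w)) (Om_hat n w)) /\
    OP P (fun n w => frobenius (Om_hat n w - Om0 n) ^+ 2) (rate Om0).
Proof.
move=> C0 prob pen_ok pen0 Ca0 supp [P0 [Mr1 large]].
apply: (minimizer_conclusion (f := objective pen lam)) => e e0.
(* One [k > 2 / e] serves both regimes: for [p <= P1] the exponent is [q = k], and [p^k >= 2^k > k];
   for [p > P1] already [p > k], so [q = 1] is enough. *)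
pose k := (Num.trunc (2 / e)).+1.
have ke : 2 / e < k%:R by exact: truncnS_gt.
pose P1 := maxn P0 k.
pose M := 2 * Num.sqrt (C * k.+2%:R).
have M0 : 0 <= M by rewrite mulr_ge0 ?sqrtr_ge0.
have [Mr2 small] := small_dimension P1 pen_ok pen0 Ca0 M0 supp.
exists (Num.max Mr1 Mr2); near=> n.
have p0 : 0 < (p n)%:R :> R by rewrite ltr0n (leq_trans _ (p2 n)).
have le_max1 f w : minimizer_within f Mr1 w -> minimizer_within f (Num.max Mr1 Mr2) (n := n) w.
  move=> [X [? h]]; exists X; split => //; apply: le_trans h _.
  by rewrite ler_wpM2r ?rate_ge0 // le_max lexx.
have le_max2 f w : minimizer_within f Mr2 w -> minimizer_within f (Num.max Mr1 Mr2) (n := n) w.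
  move=> [X [? h]]; exists X; split => //; apply: le_trans h _.
  by rewrite ler_wpM2r ?rate_ge0 // le_max lexx orbT.
have [pP|Pp] := leqP (p n) P1.
  exists (good M n); split; first exact: measurable_good_event.
    have : ((1 - 2 / (p n)%:R ^+ k)%:E <= P n (good M n))%E by near: n; exact: prob.
    apply: le_trans; rewrite lee_fin lerD2l lerN2.
    have kp : k%:R <= (p n)%:R ^+ k :> R.
      rewrite -natrX ler_nat; apply: leq_trans (ltnW (ltn_expl k (ltnSn 1))) _.
      by rewrite leq_exp2r.
    rewrite ler_pdivrMr ?exprn_gt0 // mulrC -ler_pdivrMr //.
    exact: le_trans (ltW ke) kp.
  move=> w gw; apply: le_max2; move: w pP gw; near: n; apply: filterS small => n H w ? ?; exact: H.
exists (good (2 * Num.sqrt (C * 3%:R)) n); split; first exact: measurable_good_event.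
  have : ((1 - 2 / (p n)%:R ^+ 1)%:E <= P n (good (2 * Num.sqrt (C * 3%:R)) n))%E.
    by near: n; exact: prob.
  apply: le_trans; rewrite lee_fin lerD2l lerN2 expr1.
  rewrite ler_pdivrMr // mulrC -ler_pdivrMr //.
  by apply: le_trans (ltW ke) _; rewrite ler_nat (leq_trans _ (ltnW Pp)) // leq_maxr.
have P0p : (P0 <= p n)%N by rewrite (leq_trans _ (ltnW Pp)) // leq_maxl.
move=> w gw; apply: le_max1; move: w P0p gw; near: n; apply: filterS large => n H w ? ?; exact: H.
Unshelve. all: by end_near. Qed.

End conclusion.

(** * Consequences of the asymptotic conditions on the penalty *)

Section penalty_regimes.
Context {R : realType} {d : nat -> measure_display} {T : forall n, measurableType (d n)}.
Context {P : forall n, probability (T n) R} {p : nat -> nat}.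
Variables (Sigma0 : forall n, 'M[R]_(p n)) (tau1 tau2 : R).
Variable y : forall n, 'I_n -> {RV (P n) >-> (p n).-tuple R}.
Local Notation Om0 := (fun n => invmx (Sigma0 n)).
Local Notation logp n := (ln ((p n)%:R : R)).
Local Notation s n := (s1 (Om0 n)).
Hypothesis p2 : forall n, (2 <= p n)%N.
Hypothesis sample : forall n,
  [/\ iid (@y n), mean_zero (@y n) & has_covariance (@y n) (Sigma0 n)].
Hypothesis tau1_gt0 : 0 < tau1.
Hypothesis spectrum : forall n, tau1 < lambda_min (Sigma0 n) /\ lambda_max (Sigma0 n) < tau2.
Hypothesis growth : dimension_growth Om0.
Local Notation eps := (noise_level (R := R) (p := p)).
Local Notation good M n := (good_event (@y n) (Sigma0 n) (M * eps n)).

Definition slope_rate n : R := Num.sqrt ((1 + (p n)%:R / (s n).+1%:R) * logp n / n%:R).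

Lemma slope_rate_ge0 n : 0 <= slope_rate n. Proof. exact: sqrtr_ge0. Qed.

(** [(1 + p / (s + 1)) s <= p + s]: the order allowed for the slope is such that, after
    Cauchy-Schwarz over the [s] support entries, it costs no more than the rate. *)
Lemma slope_rate_card n : slope_rate n * Num.sqrt (s n)%:R <= Num.sqrt (rate Om0 n).
Proof.
have lp := logp_gt0 (R := R) p2 n.
rewrite -sqrtrM; last by rewrite !mulr_ge0 ?invr_ge0 ?addr_ge0 ?mulr_ge0 ?invr_ge0 // ltW.
rewrite ler_wsqrtr // /rate.
have h : (1 + (p n)%:R / (s n).+1%:R) * (s n)%:R <= (p n + s n)%:R :> R.
  have h1 : (s n)%:R / (s n).+1%:R <= 1 :> R.
    by rewrite ler_pdivrMr ?ltr0n // mul1r ler_nat.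
  have : (p n)%:R * ((s n)%:R / (s n).+1%:R) <= (p n)%:R * 1 :> R by rewrite ler_wpM2l.
  rewrite natrD; move: (s n).+1%:R^-1 (p n)%:R (s n)%:R => z a b; lra.
have -> : (1 + (p n)%:R / (s n).+1%:R) * logp n / n%:R * (s n)%:R =
   (1 + (p n)%:R / (s n).+1%:R) * (s n)%:R * (logp n / n%:R) by ring.
by rewrite -[leRHS]mulrA ler_wpM2r // divr_ge0 // ltW.
Qed.

Lemma slope_rate_le n : slope_rate n <= 2 * Num.sqrt (rate Om0 n).
Proof.
have lp := logp_gt0 (R := R) p2 n.
have -> : 2 * Num.sqrt (rate Om0 n) = Num.sqrt (4 * rate Om0 n).
  rewrite (sqrtrM _ (ler0n R 4)); congr (_ * _).
  by rewrite (_ : 4%:R = 2 ^+ 2) ?sqrtr_sqr ?ger0_norm // -natrX.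
rewrite ler_wsqrtr // /rate !mulrA ler_wpM2r ?invr_ge0 // ler_wpM2r ?(ltW lp) //.
have h1 : (p n)%:R / (s n).+1%:R <= (p n)%:R :> R.
  by rewrite ler_pdivrMr ?ltr0n // ler_peMr // ler1n.
have h2 : 2 <= (p n)%:R :> R by rewrite ler_nat.
have h3 : 0 <= (s n)%:R :> R by [].
rewrite [X in 4 * X]natrD; move: h1 h2 h3; move: (_ / _) => z; move: (p n)%:R (s n)%:R => a b; lra.
Qed.

Lemma slope_near (Ca dl : R) : 0 <= Ca -> 0 < dl ->
  \forall n \near \oo, Ca * slope_rate n <= dl.
Proof.
move=> Ca0 dl0; near=> n.
have h : (Ca * 2) * Num.sqrt (rate Om0 n) <= dl by near: n; exact: radius_near.
by apply: le_trans h; rewrite -mulrA ler_wpM2l // slope_rate_le.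
Unshelve. all: by end_near. Qed.

Lemma max_pen'_ge q (f : R -> R) (A : 'M[R]_q) i j : A i j != 0 ->
  derive1 f `|A i j| <= max_pen' f A.
Proof.
move=> Aij; apply: ub_le_sup; last by exists (i, j) => //=; rewrite inE.
exists (\sum_(ij : 'I_q * 'I_q) `|derive1 f `|A ij.1 ij.2| |) => _ [ij _ <-].
by rewrite (bigD1 ij) //= (le_trans (ler_norm _)) // lerDl sumr_ge0.
Qed.

Lemma min_signal_le q (A : 'M[R]_q) i j : A i j != 0 -> min_signal A <= `|A i j|.
Proof.
move=> Aij; apply: ge_inf; last by exists (i, j) => //=; rewrite inE.
by exists 0 => _ [ij _ <-].
Qed.

Section smooth.
Variables (pen : R -> R -> R) (lam : nat -> R).
Hypothesis lam_gt0 : forall n, 0 < lam n.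
Hypothesis pen_ok : penalty pen lam.
Hypothesis pen_rates : penalty_rates Om0 pen lam.
Hypothesis pen_sing : penalty_singular pen lam.
Hypothesis pen_smooth : penalty_smooth pen lam.
Hypothesis rate_lam : rate Om0 =O_\oo (fun n => lam n ^+ 2).

Lemma pen_at0 n : pen (lam n) 0 = 0.
Proof.
have [k0 _ H] := pen_sing.
exact: (penalty_at0 (lam_gt0 n) (pen_ok n).1 (H n)).
Qed.

Lemma sqrt_rate_le_lam : exists2 K : R, 0 < K &
  \forall n \near \oo, Num.sqrt (rate Om0 n) <= K * lam n.
Proof.
have [K K0 H] := eqO_near rate_lam; exists (Num.sqrt K); first by rewrite sqrtr_gt0.
apply: filterS H => n; rewrite !ger0_norm ?sqr_ge0 ?rate_ge0 // => h.
by rewrite -[lam n]ger0_norm ?(ltW (lam_gt0 n)) // -sqrtr_sqr -sqrtrM ?(ltW K0) // ler_wsqrtr.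
Qed.

Lemma slope_bound : exists2 Ca : R, 0 < Ca & \forall n \near \oo, forall i j,
  Om0 n i j != 0 -> derive1 (pen (lam n)) `|Om0 n i j| <= Ca * slope_rate n.
Proof.
have [/eqO_near[Ca Ca0 H] _ _] := pen_rates; exists Ca => //.
apply: filterS H => n h i j Oij; apply: le_trans (max_pen'_ge _ Oij) _.
apply: le_trans (ler_norm _) _; apply: le_trans h _.
by rewrite ger0_norm ?slope_rate_ge0.
Qed.

(** The radius is itself [O(lam)], so the divergence of the signal relative to [lam] beats both
    terms. *)
Lemma signal_large (C Mr : R) : \forall n \near \oo, forall i j,
  Om0 n i j != 0 -> C * lam n + 2 * (Mr * Num.sqrt (rate Om0 n)) < `|Om0 n i j|.
Proof.
have [_ _ /cvgryPge H] := pen_rates.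
have [K K0 HK] := sqrt_rate_le_lam.
near=> n => i j Oij; apply: lt_le_trans (min_signal_le Oij).
have h1 : Num.sqrt (rate Om0 n) <= K * lam n by near: n.
have h2 : C + 2 * (`|Mr| * K) + 1 <= min_signal (Om0 n) / lam n by near: n; exact: H.
rewrite ler_pdivlMr // in h2; apply: lt_le_trans h2.
have h3 : Mr * Num.sqrt (rate Om0 n) <= `|Mr| * (K * lam n).
  apply: (@le_trans _ _ (`|Mr| * Num.sqrt (rate Om0 n))).
    by rewrite ler_wpM2r ?sqrtr_ge0 // ler_norm.
  by rewrite ler_wpM2l.
have := lam_gt0 n; lra.
Unshelve. all: by end_near. Qed.

Lemma penalty_smooth_pos : exists C D : R, [/\ 0 < C, 0 < D & forall n,
  (forall t, C * lam n < t -> is_derive t 1 (pen (lam n)) (derive1 (pen (lam n)) t) /\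
     is_derive t 1 (derive1 (pen (lam n))) (derive1 (derive1 (pen (lam n))) t)) /\
  (forall t u, C * lam n < t -> C * lam n < u ->
     `|derive1 (derive1 (pen (lam n))) t - derive1 (derive1 (pen (lam n))) u|
       <= D * `|t - u|)].
Proof.
have [C [D C0 H]] := pen_smooth; exists C, (Num.max D 1).
split; [exact: C0 | by rewrite lt_max ltr01 orbT | ].
move=> n; have [H1 H2] := H n; split => [t Ct|t u Ct Cu].
  have [d1 d2] := H1 t Ct.
  rewrite [derive1 (pen (lam n)) t]derive1E [derive1 (derive1 _) t]derive1E.
  by split; exact: derivableP.
by apply: le_trans (H2 t u Ct Cu) _; rewrite ler_wpM2r // le_max lexx.
Qed.

Lemma curvature_near (Ca D Mr : R) : 0 <= Ca -> 0 < D -> exists2 e : R, 0 < e &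
  \forall n \near \oo, Ca * slope_rate n / e + 2 * D * e +
    D * (2 * (Mr * Num.sqrt (rate Om0 n))) <= tau1 ^+ 2 / 32.
Proof.
move=> Ca0 D0; have t12 : 0 < tau1 ^+ 2 by rewrite exprn_gt0.
(* This fixes [2 D e = tau1^2 / 96]. With [e] fixed, the other two terms tend to 0 and are
   eventually below the same bound. *)
pose e := tau1 ^+ 2 / (192 * D).
have e0 : 0 < e by rewrite divr_gt0 // mulr_gt0.
have t96 : 0 < tau1 ^+ 2 / 96 by rewrite divr_gt0.
exists e => //; near=> n.
have h1 : Ca * slope_rate n <= tau1 ^+ 2 / 96 * e.
  by near: n; apply: slope_near => //; rewrite mulr_gt0.
have h2 : (2 * D * Mr) * Num.sqrt (rate Om0 n) <= tau1 ^+ 2 / 96 by near: n; exact: radius_near.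
have h3 : Ca * slope_rate n / e <= tau1 ^+ 2 / 96 by rewrite ler_pdivrMr.
have h4 : 2 * D * e = tau1 ^+ 2 / 96 by rewrite /e; field; rewrite gt_eqF.
have h5 : D * (2 * (Mr * Num.sqrt (rate Om0 n))) = (2 * D * Mr) * Num.sqrt (rate Om0 n) by ring.
rewrite h4 h5; lra.
Unshelve. all: by end_near. Qed.

Lemma smooth_support_bound : exists2 Ca : R, 0 < Ca &
  support_bound Sigma0 tau1 pen lam (fun n => Ca * slope_rate n) Ca /\
  \forall n \near \oo, forall i j, Om0 n i j != 0 ->
    derive1 (pen (lam n)) `|Om0 n i j| <= Ca * slope_rate n.
Proof.
have [Ca Ca0 HCa] := slope_bound; exists Ca => //; split => // Mr.
have [C [D [C0 D0 smooth]]] := penalty_smooth_pos.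
have [e e0 curv] := curvature_near Mr (ltW Ca0) D0.
near=> n.
have a0 : 0 <= Ca * slope_rate n by rewrite mulr_ge0 ?slope_rate_ge0 // ltW.
split => //.
  by rewrite -mulrA ler_wpM2l ?(ltW Ca0) // slope_rate_card.
have large : forall i j, Om0 n i j != 0 ->
    C * lam n + 2 * (Mr * Num.sqrt (rate Om0 n)) < `|Om0 n i j|.
  by near: n; exact: signal_large.
have slope : forall i j, Om0 n i j != 0 ->
    derive1 (pen (lam n)) `|Om0 n i j| <= Ca * slope_rate n.
  by near: n.
have crv : Ca * slope_rate n / e + 2 * D * e +
    D * (2 * (Mr * Num.sqrt (rate Om0 n))) <= tau1 ^+ 2 / 32 by near: n.
move=> i j x Oij _ xr.
have Cl0 : 0 < C * lam n by rewrite mulr_gt0.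
have [der lip] := smooth n.
apply: le_trans (penalty_support_lower (pen_ok n).2 Cl0 (ltW D0) der lip
  (large i j Oij) (slope i j Oij) a0 e0 xr).
by rewrite lerN2 lerD2l ler_wpM2r ?sqr_ge0.
Unshelve. all: by end_near. Qed.

(** From [eps sqrt p <= q], with [q] the square root of the rate, a large [p] makes the noise small
    against [q], and hence against [lam] because [q <= K lam]. *)
Lemma wells_near (M : R) : 0 < M ->
  exists P0 : nat, exists Mr : R, \forall n \near \oo, forall w, (P0 <= p n)%N ->
    good M n w -> minimizer_within Sigma0 (objective y pen lam) Mr w.
Proof.
move=> M0.
have [Ca Ca0 [_ slopeH]] := smooth_support_bound.
have [C [D [C0 D0 smooth]]] := penalty_smooth_pos.
have [k0 k00 sing] := pen_sing.
have [K K0 rK] := sqrt_rate_le_lam.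
have t12 : 0 < tau1 ^+ 2 by rewrite exprn_gt0.
(* Curvature and large off-support entries take [tau1^2 / 32] each from the gain [tau1^2 / 8]; what
   is left, times [Mr], is [M + Ca + 1]. *)
pose Mr := 16 * (M + Ca + 1) / tau1 ^+ 2.
have Mr0 : 0 < Mr by rewrite divr_gt0 // mulr_gt0 //; lra.
have tK0 : 0 <= tau2 ^+ 2 * K by rewrite mulr_ge0 ?sqr_ge0 // ltW.
(* [tstar] will be [rho q]. The first bound keeps it below half the radius; the second makes
   [8 tau2^2 tstar] at most [k0 lam / 16]. *)
pose rho := Num.min (Mr / 2) (k0 / (128 * (tau2 ^+ 2 * K + 1))).
have rho0 : 0 < rho by rewrite lt_min !divr_gt0 // mulr_gt0 //; lra.
have rho1 : rho <= Mr / 2 by rewrite ge_min lexx.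
have rho2 : 8 * tau2 ^+ 2 * (rho * K) <= k0 / 16.
  have h : rho <= k0 / (128 * (tau2 ^+ 2 * K + 1)) by rewrite ge_min lexx orbT.
  rewrite ler_pdivlMr in h; last by rewrite mulr_gt0 //; lra.
  have : 0 <= rho by exact: ltW.
  lra.
have [e e0 curv] := curvature_near Mr (ltW Ca0) D0.
(* Since [eps B <= q] once [sqrt p >= B], the first entry gives [kap <= k0 lam / 8], and the second
   bounds [2 kap / tstar] by [tau1^2 / 32]. *)
pose B := Num.max (8 * M * K / k0) (64 * M / (rho * tau1 ^+ 2)).
exists (Num.trunc (B ^+ 2)).+1, (Mr ^+ 2).
near=> n.
have n0 : (0 < n)%N by near: n; exact: nbhs_infty_gt.
have p0 : (0 < p n)%N by rewrite (leq_trans _ (p2 n)).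
have rt0 : 0 < Num.sqrt (rate Om0 n) by rewrite sqrtr_gt0 rate_gt0.
have hr : tau2 ^+ 2 * (4 * (Mr * Num.sqrt (rate Om0 n)) ^+ 2) <= 4^-1.
  by near: n; exact: radius_small.
have crv : Ca * slope_rate n / e + 2 * D * e +
    D * (2 * (Mr * Num.sqrt (rate Om0 n))) <= tau1 ^+ 2 / 32 by near: n.
have qK : Num.sqrt (rate Om0 n) <= K * lam n by near: n.
have large : forall i j, Om0 n i j != 0 ->
    C * lam n + 2 * (Mr * Num.sqrt (rate Om0 n)) < `|Om0 n i j|.
  by near: n; exact: signal_large.
have slope : forall i j, Om0 n i j != 0 ->
    derive1 (pen (lam n)) `|Om0 n i j| <= Ca * slope_rate n.
  by near: n.
set q := Num.sqrt (rate Om0 n) in rt0 hr crv qK large *.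
move=> w Pp gw.
have Bp : B <= Num.sqrt (p n)%:R.
  apply: (le_trans (ler_norm _)); rewrite -sqrtr_sqr ler_wsqrtr //.
  by apply: (le_trans (ltW (truncnS_gt _))); rewrite ler_nat.
have eps0 : 0 < eps n by exact: noise_level_gt0.
have eps_p : eps n * Num.sqrt (p n)%:R <= q by apply: noise_level_card => //; rewrite leq_addr.
have eps_B : eps n * B <= q by apply: le_trans eps_p; rewrite ler_wpM2l // ltW.
have r0 : 0 < Mr * q by rewrite mulr_gt0.
have kap0 : 0 <= M * eps n by rewrite mulr_ge0 // ltW.
have a0 : 0 <= Ca * slope_rate n by rewrite mulr_ge0 ?slope_rate_ge0 // ltW.
have aC : Ca * slope_rate n * Num.sqrt (s n)%:R <= Ca * q.
  by rewrite -mulrA ler_wpM2l ?(ltW Ca0) // slope_rate_card.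
have supp : forall i j, Om0 n i j != 0 -> C * lam n + 2 * (Mr * q) < `|Om0 n i j| /\
    derive1 (pen (lam n)) `|Om0 n i j| <= Ca * slope_rate n.
  by move=> i j Oij; split; [exact: large | exact: slope].
have Cl0 : 0 < C * lam n by rewrite mulr_gt0.
have [der lip] := smooth n.
have kapk : M * eps n <= k0 * lam n / 8.
  have h : 8 * M * K / k0 <= B by rewrite le_max lexx.
  have h1 : eps n * (8 * M * K / k0) <= K * lam n.
    by apply: le_trans qK; apply: le_trans eps_B; rewrite ler_wpM2l // ltW.
  have h2 : K * (8 * (M * eps n)) <= K * (k0 * lam n).
    have -> : K * (8 * (M * eps n)) = k0 * (eps n * (8 * M * K / k0)) by field; rewrite gt_eqF.
    by rewrite [leRHS]mulrCA ler_wpM2l // ltW.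
  rewrite ler_pM2l // in h2; lra.
have ts0 : 0 < rho * q by rewrite mulr_gt0.
have tsr : rho * q <= Mr * q / 2 by rewrite mulrAC ler_wpM2r // ltW.
have lam0 := lam_gt0 n.
have tsl : 8 * tau2 ^+ 2 * (rho * q) < k0 * lam n / 8.
  have h : 8 * tau2 ^+ 2 * (rho * q) <= 8 * tau2 ^+ 2 * (rho * K) * lam n.
    have -> : 8 * tau2 ^+ 2 * (rho * K) * lam n = 8 * tau2 ^+ 2 * (rho * (K * lam n)) by ring.
    apply: ler_wpM2l; first by rewrite mulr_ge0 ?sqr_ge0.
    by apply: ler_wpM2l => //; exact: ltW.
  have h2 : 8 * tau2 ^+ 2 * (rho * K) * lam n <= k0 / 16 * lam n by rewrite ler_wpM2r // ltW.
  have : 0 < k0 * lam n by rewrite mulr_gt0.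
  lra.
have kts : 2 * (M * eps n) / (rho * q) <= tau1 ^+ 2 / 32.
  have h : 64 * M / (rho * tau1 ^+ 2) <= B by rewrite le_max lexx orbT.
  have h1 : eps n * (64 * M / (rho * tau1 ^+ 2)) <= q.
    by apply: le_trans eps_B; rewrite ler_wpM2l // ltW.
  rewrite ler_pdivrMr //.
  have -> : 2 * (M * eps n) = rho * tau1 ^+ 2 / 32 * (eps n * (64 * M / (rho * tau1 ^+ 2))).
    by field; rewrite !gt_eqF.
  have -> : tau1 ^+ 2 / 32 * (rho * q) = rho * tau1 ^+ 2 / 32 * q by ring.
  by rewrite ler_wpM2l // divr_ge0 // mulr_ge0 // ltW.
have [] := wells_local_minimizer p0 tau1_gt0 r0 (Sigma0_qbounded sample spectrum n0) hr
  (sample_cov_sym y w) kap0 a0 gw (pen_ok n).1 (pen_ok n).2 lam0 k00 (sing n) Cl0 (ltW D0)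
  der lip supp e0 kapk ts0 tsr tsl.
  have h1 : M * eps n * Num.sqrt #|S1 (Om0 n)|%:R <= M * q.
    by rewrite -mulrA ler_wpM2l ?(ltW M0) // noise_level_card // card_S1_le.
  have h2 : 2 * (M * eps n) / (rho * q) * (Mr * q) <= tau1 ^+ 2 / 32 * (Mr * q).
    by rewrite ler_wpM2r // ltW.
  have h3 : (tau1 ^+ 2 / 8 - tau1 ^+ 2 / 32) * (Mr * q) <= (tau1 ^+ 2 / 8 -
    (Ca * slope_rate n / e + 2 * D * e + D * (2 * (Mr * q)))) * (Mr * q).
    by rewrite ler_wpM2r ?(ltW r0) //; move: crv; lra.
  apply: lt_le_trans h3.
  have h4 : tau1 ^+ 2 * (Mr * q) = 16 * (M + Ca + 1) * q.
    by rewrite /Mr; field; rewrite gt_eqF.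
  move: h1 h2 aC rt0 h4; lra.
move=> X [locX rX]; exists X; split => //.
by apply: (le_trans (ltW rX)); rewrite exprMn sqr_sqrtr // rate_ge0.
Unshelve. all: by end_near. Qed.

End smooth.
End penalty_regimes.

Lemma derive1_L1_penalty {R : realType} (l t : R) : 0 < t -> derive1 (L1_penalty l) t = l.
Proof.
move=> t0; rewrite derive1E.
have H : is_derive t 1 ((l : R) *: (@id R : R -> R)) (l *: (1 : R)) by apply: is_deriveZ.
have H2 : is_derive t 1 (L1_penalty l) (l *: (1 : R)).
  apply: (near_eq_is_derive _ H).
  near=> s; rewrite /L1_penalty gtr0_norm //; near: s; exact: lt_nbhsr.
have [_ ->] := H2; exact: mulr1.
Unshelve. all: by end_near. Qed.

(** * The L1-penalty *)

Section L1.
Context {R : realType} {d : nat -> measure_display} {T : forall n, measurableType (d n)}.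
Context {P : forall n, probability (T n) R} {p : nat -> nat}.
Variables (Sigma0 : forall n, 'M[R]_(p n)) (tau1 tau2 : R).
Variable y : forall n, 'I_n -> {RV (P n) >-> (p n).-tuple R}.
Local Notation Om0 := (fun n => invmx (Sigma0 n)).
Hypothesis p2 : forall n, (2 <= p n)%N.
Hypothesis sample : forall n,
  [/\ iid (@y n), mean_zero (@y n) & has_covariance (@y n) (Sigma0 n)].
Hypothesis tau1_gt0 : 0 < tau1.
Hypothesis spectrum : forall n, tau1 < lambda_min (Sigma0 n) /\ lambda_max (Sigma0 n) < tau2.
Hypothesis growth : dimension_growth Om0.
Local Notation eps := (noise_level (R := R) (p := p)).
Local Notation good M n := (good_event (@y n) (Sigma0 n) (M * eps n)).

Variable lam : nat -> R.
Hypothesis lam_gt0 : forall n, 0 < lam n.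
Hypothesis pen_ok : penalty L1_penalty lam.
Hypothesis pen_rates : penalty_rates Om0 L1_penalty lam.

Lemma L1_at0 n : L1_penalty (lam n) 0 = 0. Proof. by rewrite /L1_penalty normr0 mulr0. Qed.

(** The diagonal lies in [S1], and the slope of the penalty there is [lam n], so the condition on
    slopes bounds [lam n] itself. The rest is the triangle inequality, with no curvature loss. *)
Lemma L1_support_bound : exists2 Ca : R, 0 < Ca &
  support_bound Sigma0 tau1 L1_penalty lam (fun n => Ca * slope_rate Sigma0 n) Ca.
Proof.
have [Ca Ca0 H] := slope_bound pen_rates; exists Ca => // Mr; near=> n.
have n0 : (0 < n)%N by near: n; exact: nbhs_infty_gt.
have p0 : (0 < p n)%N by rewrite (leq_trans _ (p2 n)).
have slope : forall i j, Om0 n i j != 0 ->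
    derive1 (L1_penalty (lam n)) `|Om0 n i j| <= Ca * slope_rate Sigma0 n by near: n.
have lam_le : lam n <= Ca * slope_rate Sigma0 n.
  have dg := diag_Om0_gt0 p0 tau1_gt0 (Sigma0_qbounded sample spectrum n0) (Ordinal p0).
  have := slope _ _ (lt0r_neq0 dg).
  by rewrite derive1_L1_penalty // normr_gt0 lt0r_neq0.
split; first by rewrite mulr_ge0 ?slope_rate_ge0 // ltW.
  by rewrite -mulrA ler_wpM2l ?(ltW Ca0) // slope_rate_card.
move=> i j x _ _ _; rewrite /L1_penalty !normr_id -mulrBr.
apply: (@le_trans _ _ (- (lam n * `|x|))).
  rewrite lerN2 -[leLHS]addr0 lerD //; first by rewrite ler_wpM2r.
  by rewrite mulr_ge0 ?sqr_ge0 // divr_ge0 // sqr_ge0.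
rewrite -mulrN ler_wpM2l ?(ltW (lam_gt0 n)) // lerBrDr addrC lerBlDr.
by have := ler_normB (Om0 n i j + x) x; rewrite addrK.
Unshelve. all: by end_near. Qed.

(** Once [lam] exceeds the noise, the penalty pays for it entry by entry: [Bc] is 0, whatever the
    size of [p]. *)
Lemma L1_near (M : R) : 0 <= M -> (\forall n \near \oo, M * eps n <= lam n) ->
  exists P0 : nat, exists Mr : R, \forall n \near \oo, forall w, (P0 <= p n)%N ->
    good M n w -> minimizer_within Sigma0 (objective y L1_penalty lam) Mr w.
Proof.
move=> M0 Ml; have [Ca Ca0 supp] := L1_support_bound.
have [Mr _ HMr] := bounded_noise_near p2 sample tau1_gt0 spectrum growth pen_ok L1_at0
  (ltW Ca0) M0 (lexx 0) supp.
exists 0, Mr; near=> n => w _ gw.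
have H : forall w, good M n w -> (forall D : 'M[R]_(p n),
      \sum_(ij : 'I_(p n) * 'I_(p n) | Om0 n ij.1 ij.2 == 0)
        (M * eps n * `|D ij.1 ij.2| - L1_penalty (lam n) `|D ij.1 ij.2|)
      <= 0 * Num.sqrt (rate Om0 n) * Num.sqrt (fro2 D)) ->
    exists X, local_minimizer (q1 (L1_penalty (lam n)) (sample_cov (@y n) w)) X /\
      fro2 (X - Om0 n) <= Mr * rate Om0 n by near: n.
have Mln : M * eps n <= lam n by near: n.
apply: (H w gw) => D; rewrite !mul0r.
by apply: sumr_le0 => ij _; rewrite /L1_penalty normr_id subr_le0 ler_wpM2r.
Unshelve. all: by end_near. Qed.

End L1.

Theorem theorem1 (R : realType) (d : nat -> measure_display)
    (T : forall n, measurableType (d n)) (P : forall n, probability (T n) R)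
    (p : nat -> nat) (Sigma0 : forall n, 'M[R]_(p n))
    (y : forall n, 'I_n -> {RV (P n) >-> (p n).-tuple R})
    (tau1 tau2 : R) :
  let Om0 := fun n => invmx (Sigma0 n) in
  (forall n, (2 <= p n)%N) ->
  (forall n, [/\ iid (y n), mean_zero (y n) & has_covariance (y n) (Sigma0 n)]) ->
  sub_gaussian y ->
  0 < tau1 ->
  (forall n, tau1 < lambda_min (Sigma0 n) /\ lambda_max (Sigma0 n) < tau2) ->
  dimension_growth Om0 ->
  let conclusion := fun (pen : R -> R -> R) (lam : nat -> R) =>
    exists Om_hat : forall n, T n -> 'M[R]_(p n),
      with_prob_tending_to_1 P (fun n w =>
        local_minimizer (q1 (pen (lam n)) (sample_cov (y n) w)) (Om_hat n w)) /\
      OP P (fun n w => frobenius (Om_hat n w - Om0 n) ^+ 2) (rate Om0) in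
  let conditions := fun (pen : R -> R -> R) (lam : nat -> R) =>
    [/\ forall n, 0 < lam n, penalty pen lam, penalty_rates Om0 pen lam,
        penalty_singular pen lam & penalty_smooth pen lam] in
  (forall (pen : R -> R -> R) (lam : nat -> R),
     conditions pen lam ->
     rate Om0 =O_\oo (fun n => lam n ^+ 2) ->
     conclusion pen lam)
  /\
  (exists2 c0 : R, 0 < c0 & forall lam : nat -> R,
     conditions L1_penalty lam ->
     (\forall n \near \oo, ln ((p n)%:R) / n%:R <= c0 * lam n ^+ 2) ->
     conclusion L1_penalty lam).
Proof.
move=> Om0 p2 sample subgauss tau1_gt0 spectrum growth conclusion conditions.
have [C C0 prob] := good_event_near p2 sample subgauss growth.
(* The noise constant of the exponent [q = 1], where [q + 2 = 3]; it is independent of the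
   probability level. *)
pose M := 2 * Num.sqrt (C * 3%:R).
have M0 : 0 < M by rewrite mulr_gt0 // sqrtr_gt0 mulr_gt0.
split=> [pen lam [lam_gt0 pen_ok rates sing smooth] rate_lam|].
  have [Ca Ca0 [supp _]] :=
    smooth_support_bound p2 tau1_gt0 growth lam_gt0 pen_ok rates smooth rate_lam.
  apply: (two_regimes p2 sample tau1_gt0 spectrum growth C0 prob pen_ok _ (ltW Ca0) supp).
    exact: pen_at0 lam_gt0 pen_ok sing.
  exact: (wells_near p2 sample tau1_gt0 spectrum growth lam_gt0 pen_ok rates sing smooth rate_lam M0).
(* With this [c0] the condition on [lam] reads [M eps <= lam]. *)
exists (M ^- 2); first by rewrite invr_gt0 exprn_gt0.
move=> lam [lam_gt0 pen_ok rates sing smooth] log_lam.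
have [Ca Ca0 supp] := L1_support_bound p2 sample tau1_gt0 spectrum lam_gt0 rates.
apply: (two_regimes p2 sample tau1_gt0 spectrum growth C0 prob pen_ok _ (ltW Ca0) supp).
  exact: L1_at0.
apply: (L1_near p2 sample tau1_gt0 spectrum growth lam_gt0 pen_ok rates (ltW M0)).
apply: filterS log_lam => n h.
rewrite -ler_pdivlMl // -[leRHS]ger0_norm; last by rewrite mulr_ge0 ?invr_ge0 // ltW.
by rewrite -sqrtr_sqr ler_wsqrtr // exprMn exprVn.
Qed.
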